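(* Every finite-product double theory $\mathbb{T}$ has a unital virtual double category of models, for any choice of strict, pseudo, lax, or oplax maps of models. That is, for each such choice there is a virtual double category with units whose objects are models of $\mathbb{T}$, whose arrows are the maps of models of the chosen kind, whose proarrows are finite-product-preserving modules, and whose multicells are multimodulations.
   Context: Conventions. Double categories and double functors are pseudo unless otherwise stated. A proarrow is written $m\colon x\nrightarrow y$; a cell $\alpha\colon m\to n$ over $(f,g)$ has left side $f$ and right side $g$. External composition $\odot$ is in diagrammatic order; $\mathrm{id}_x$ is the external identity proarrow and $\mathrm{id}_f\colon\mathrm{id}_x\to\mathrm{id}_y$ the identity cell on $f\colon x\to y$; $\circ$ is composition of arrows and of cells in the arrow direction. Associators and unitors of double categories are suppressed below. A lax double functor $F$ has laxators $F_{m,n}\colon Fm\odot Fn\to F(m\odot n)$ and unitors $F_x\colon\mathrm{id}_{Fx}\to F\mathrm{id}_x$. For a span of sets $A\colon I\nrightarrow J$ with legs $\ell,r$, $a\colon i\nrightarrow j$ means $a\in A$, $\ell(a)=i$, $r(a)=j$. Finite products. $\mathbb{F}\mathsf{inFam}^*(\mathbb{D})$ is the double category with: objects $(I,\underline{x})$, a finite set $I$ and objects $x_i$ of $\mathbb D$; arrows $(f_0,f)\colon(I,\underline{x})\to(J,\underline{y})$, a function $f_0\colon J\to I$ and arrows $f_j\colon x_{f_0(j)}\to y_j$; proarrows $(A,\underline{m})\colon(I,\underline{x})\nrightarrow(J,\underline{y})$, a span of finite sets $A\colon I\nrightarrow J$ and proarrows $m_a\colon x_i\nrightarrow y_j$ for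 $a\colon i\nrightarrow j$; cells $(A,\underline{m})\to(B,\underline{n})$ over $((f_0,f),(g_0,g))$, a map of spans $(f_0,\alpha_0,g_0)$ from $B$ to $A$ and cells $\alpha_b\colon m_{\alpha_0(b)}\to n_b$ over $(f_k,g_l)$ for $b\colon k\nrightarrow l$; external composition by pullback of spans and $(\underline m\odot\underline n)_{(a,b)}=m_a\odot n_b$. $\mathbb{D}$ has lax finite products if $\Delta\colon\mathbb{D}\to\mathbb{F}\mathsf{inFam}^*(\mathbb{D})$ (singleton families) has a right adjoint $\Pi$ in the 2-category of double categories, lax functors and natural transformations, and strong finite products if moreover $\Pi$ is pseudo; the projections are $\pi_i\colon\Pi\underline{x}\to x_i$ and $\pi_a\colon\Pi\underline{m}\to m_a$ over $(\pi_i,\pi_j)$. A lax functor $F\colon\mathbb{D}\to\mathbb{E}$ between double categories with lax finite products preserves finite products if the canonical comparisons $\Phi_{\underline{x}}\colon F\Pi\underline{x}\to\Pi F\underline{x}$ (determined by $\pi_i\circ\Phi_{\underline x}=F\pi_i$) and $\Phi_{\underline{m}}\colon F\Pi\underline{m}\to\Pi F\underline{m}$ over $(\Phi_{\underline{x}},\Phi_{\underline{y}})$ (determined by $\pi_a\circ\Phi_{\underline m}=F\pi_a$) are isomorphisms for all finite families of objects and proarrows, where $F$ is applied elementwise to families. Theories and models. A finite-product double theory is a small, strict double category with strong finite products. A model of a finite-product double theory $\mathbb{T}$ in a double category $\mathbb{S}$ with lax finite products is a lax double functor $\mathbb{T}\to\mathbb{S}$ preserving finite products; if left unstated, the semantics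 is $\mathbb{S}=\mathbb{S}\mathsf{pan}$, the double category of sets, functions, and spans. Strict maps of models are (strict) natural transformations; pseudo, lax, and oplax maps of models are finite-product-preserving pseudo, lax, and oplax natural transformations. Lax transformations. For lax functors $F,G\colon\mathbb{D}\to\mathbb{E}$, a lax natural transformation $\alpha\colon F\Rightarrow G$ consists of arrows $\alpha_x\colon Fx\to Gx$; cells $\alpha_m\colon Fm\to Gm$ over $(\alpha_x,\alpha_y)$ for each $m\colon x\nrightarrow y$; and, for each arrow $f\colon x\to y$, a naturality comparison cell $\alpha_f\colon\mathrm{id}_{Fx}\to G\mathrm{id}_y$ over $(Gf\circ\alpha_x,\ \alpha_y\circ Ff)$; subject to: - $\alpha_{m\odot n}\circ F_{m,n}=G_{m,n}\circ(\alpha_m\odot\alpha_n)$ and $\alpha_{\mathrm{id}_x}\circ F_x=G_x\circ\mathrm{id}_{\alpha_x}$; - $\alpha_{1_x}=G_x\circ\mathrm{id}_{\alpha_x}$, and for $f\colon x\to y$, $g\colon y\to z$, $\alpha_{g\circ f}=G_{\mathrm{id}_z,\mathrm{id}_z}\circ\big((G\mathrm{id}_g\circ\alpha_f)\odot(\alpha_g\circ\mathrm{id}_{Ff})\big)$; - for each cell $\gamma\colon m\to n$ over $(f,g)$ with $n\colon w\nrightarrow z$, $G_{n,\mathrm{id}_z}\circ\big((G\gamma\circ\alpha_m)\odot\alpha_g\big)=G_{\mathrm{id}_w,n}\circ\big(\alpha_f\odot(\alpha_n\circ F\gamma)\big)$. Oplax transformations are defined dually, with $\alpha_f\colon\mathrm{id}_{Fx}\to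 G\mathrm{id}_y$ over $(\alpha_y\circ Ff,\ Gf\circ\alpha_x)$ and the order of external pasting with comparison cells reversed. A pseudo transformation is a lax one in which each $\alpha_f$ is invertible, i.e. there is a cell $\mathrm{id}_{Fx}\to G\mathrm{id}_y$ over $(\alpha_y\circ Ff,Gf\circ\alpha_x)$ whose two external composites with $\alpha_f$, followed by $G_{\mathrm{id}_y,\mathrm{id}_y}$, are $G_y\circ\mathrm{id}_{Gf\circ\alpha_x}$ and $G_y\circ\mathrm{id}_{\alpha_y\circ Ff}$. A (strict) natural transformation is one with $Gf\circ\alpha_x=\alpha_y\circ Ff$ and $\alpha_f=G_y\circ\mathrm{id}_{\alpha_y\circ Ff}$ for all $f$. A lax (pseudo, oplax) transformation preserves finite products if for every finite object family $(I,\underline{x})$ in $\mathbb{D}$ and $i\in I$, $G\pi_i\circ\alpha_{\Pi\underline{x}}=\alpha_{x_i}\circ F\pi_i$ and $\alpha_{\pi_i}=G_{x_i}\circ\mathrm{id}_{\alpha_{x_i}\circ F\pi_i}$. Transformations $\alpha\colon F\Rightarrow G$, $\beta\colon G\Rightarrow H$ compose componentwise on objects and proarrows, with (lax case) $(\beta\alpha)_f=H_{\mathrm{id}_y,\mathrm{id}_y}\circ\big((\beta_f\circ\mathrm{id}_{\alpha_x})\odot(\beta_{\mathrm{id}_y}\circ\alpha_f)\big)$. Modules. Let $\mathbb{I}=\{0\nrightarrow1\}$ be the walking proarrow. A module $M\colon F\nRightarrow G$ between lax functors $F,G\colon\mathbb{D}\to\mathbb{E}$ is a lax functor $M\colon\mathbb{D}\times\mathbb{I}\to\mathbb{E}$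 with $M(-,0)=F$, $M(-,1)=G$. Thus it has proarrows $Mm\colon Fx\nrightarrow Gy$ for $m\colon x\nrightarrow y$, cells $M\gamma\colon Mm\to Mn$ over $(Ff,Gg)$ for cells $\gamma\colon m\to n$ over $(f,g)$, and left and right actions $M^\ell_{m,n}\colon Fm\odot Mn\to M(m\odot n)$ and $M^r_{m,n}\colon Mm\odot Gn\to M(m\odot n)$. When $F$ and $G$ have product comparisons $\Phi$ and $\Psi$, $M$ preserves finite products if for every finite proarrow family $(A,\underline{m})\colon(I,\underline{x})\nrightarrow(J,\underline{y})$ the canonical cell $M\Pi\underline{m}\to\Pi M\underline{m}$ over $(\Phi_{\underline{x}},\Psi_{\underline{y}})$, determined by having composite $M\pi_a$ with $\pi_a\colon\Pi M\underline{m}\to Mm_a$ for every $a\in A$, is an isomorphism. Multimodulations. Given lax functors $F_0,\dots,F_k,G,H$ ($k\ge0$), modules $M_i\colon F_{i-1}\nRightarrow F_i$ and $N\colon G\nRightarrow H$, and transformations $\alpha\colon F_0\Rightarrow G$, $\beta\colon F_k\Rightarrow H$ (of the chosen kind), a multimodulation $\mu\colon(M_1,\dots,M_k)\to N$ over $(\alpha,\beta)$ assigns to each path $x_0\overset{m_1}{\nrightarrow}\cdots\overset{m_k}{\nrightarrow}x_k$ in $\mathbb{D}$ a cell $\mu_{m_1,\dots,m_k}\colon M_1m_1\odot\cdots\odot M_km_k\to N(m_1\odot\cdots\odot m_k)$ over $(\alpha_{x_0},\beta_{x_k})$ (for $k=0$: a cell $\mu_x\colon\mathrm{id}_{F_0x}\to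 N\mathrm{id}_x$ for each object $x$), subject to: - naturality: for cells $\gamma_i\colon m_i\to n_i$ over $(f_{i-1},f_i)$, with $f_i\colon x_i\to y_i$, $n=n_1\odot\cdots\odot n_k$, $\gamma=\gamma_1\odot\cdots\odot\gamma_k$ (for $k=0$, $\gamma=\mathrm{id}_{f_0}$), one has $N^r_{n,\mathrm{id}}\circ\big((N\gamma\circ\mu_{m_1,\dots,m_k})\odot\beta_{f_k}\big)=N^\ell_{\mathrm{id},n}\circ\big(\alpha_{f_0}\odot(\mu_{n_1,\dots,n_k}\circ(M_1\gamma_1\odot\cdots\odot M_k\gamma_k))\big)$ in the lax case (order of pasting reversed in the oplax case; for strict transformations this reduces to $N\gamma\circ\mu_{m_1,\dots,m_k}=\mu_{n_1,\dots,n_k}\circ(M_1\gamma_1\odot\cdots\odot M_k\gamma_k)$); - outer equivariance ($k\geq 1$): $\mu_{p\odot m_1,m_2,\dots,m_k}\circ((M_1)^\ell_{p,m_1}\odot1)=N^\ell\circ(\alpha_p\odot\mu_{m_1,\dots,m_k})$ and $\mu_{m_1,\dots,m_k\odot p}\circ(1\odot(M_k)^r_{m_k,p})=N^r\circ(\mu_{m_1,\dots,m_k}\odot\beta_p)$; for $k=0$, instead, $N^\ell\circ(\alpha_p\odot\mu_y)=N^r\circ(\mu_x\odot\beta_p)$ for all $p\colon x\nrightarrow y$; - inner equivariance: for $1\le i<k$ and $p$ composable between $m_i$ and $m_{i+1}$, $\mu_{\dots,m_i\odot p,m_{i+1},\dots}\circ(1\odot(M_i)^r_{m_i,p}\odot1)=\mu_{\dots,m_i,p\odot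 m_{i+1},\dots}\circ(1\odot(M_{i+1})^\ell_{p,m_{i+1}}\odot1)$. Multimodulations compose by pasting of components: the component of the composite of $\nu$ with $\mu_1,\dots,\mu_k$ is the component of $\nu$ at the composites of the respective blocks of proarrows, composed with the external composite of the corresponding components of the $\mu_i$. A virtual double category has objects, arrows forming a category, proarrows, and multicells from a finite (possibly empty) path of proarrows to a single proarrow, bounded by two arrows, with associative and unital composition of multicells. It has units (is unital) if every object $F$ has a proarrow $U_F\colon F\nRightarrow F$ and a nullary multicell into $U_F$ over identity arrows, composition with which induces bijections between multicells with source $(M_1,\dots,M_j,U_F,M_{j+1},\dots,M_k)$ and multicells with source $(M_1,\dots,M_j,M_{j+1},\dots,M_k)$ (same target and bounding arrows). *)

(* Defs.v *)
From mathcomp Require Import all_boot.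
From Stdlib Require Import FunctionalExtensionality ProofIrrelevance.

Set Implicit Arguments.
Unset Strict Implicit.
Unset Printing Implicit Defensive.

Declare Scope dbl_scope.
Delimit Scope dbl_scope with dbl.
Local Open Scope dbl_scope.

(* Operations of a pseudo double category, together with the laws of its
   category of arrows; the laws on cells are in [is_double_category].
   [cell m n f g] is the type of cells m -> n with left side f, right side g. *)
Record dbl := Dbl {
  ob : Type;
  arr : ob -> ob -> Type;
  pro : ob -> ob -> Type;
  cell : forall x y x' y' : ob,
    pro x y -> pro x' y' -> arr x x' -> arr y y' -> Type;
  ida : forall x, arr x x;
  compa : forall x y z, arr y z -> arr x y -> arr x z;
  compaA : forall x y z w (h : arr z w) (g : arr y z) (f : arr x y),
    compa h (compa g f) = compa (compa h g) f;
  comp1a : forall x y (f : arr x y), compa (ida y) f = f;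
  compa1 : forall x y (f : arr x y), compa f (ida x) = f;
  idc : forall x y (m : pro x y), cell m m (ida x) (ida y);
  compc : forall x y x' y' x'' y''
      (m : pro x y) (n : pro x' y') (p : pro x'' y'')
      (f : arr x x') (g : arr y y') (f' : arr x' x'') (g' : arr y' y''),
    cell n p f' g' -> cell m n f g -> cell m p (compa f' f) (compa g' g);
  (* external composition is in diagrammatic order *)
  idp : forall x, pro x x;
  compp : forall x y z, pro x y -> pro y z -> pro x z;
  idpc : forall x y (f : arr x y), cell (idp x) (idp y) f f;
  hcomp : forall x y z x' y' z'
      (m : pro x y) (n : pro y z) (m' : pro x' y') (n' : pro y' z')
      (f : arr x x') (g : arr y y') (h : arr z z'),
    cell m m' f g -> cell n n' g h -> cell (compp m n) (compp m' n') f h;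
  assoc : forall x y z w (m : pro x y) (n : pro y z) (p : pro z w),
    cell (compp (compp m n) p) (compp m (compp n p)) (ida x) (ida w);
  assocV : forall x y z w (m : pro x y) (n : pro y z) (p : pro z w),
    cell (compp m (compp n p)) (compp (compp m n) p) (ida x) (ida w);
  lun : forall x y (m : pro x y), cell (compp (idp x) m) m (ida x) (ida y);
  lunV : forall x y (m : pro x y), cell m (compp (idp x) m) (ida x) (ida y);
  run : forall x y (m : pro x y), cell (compp m (idp y)) m (ida x) (ida y);
  runV : forall x y (m : pro x y), cell m (compp m (idp y)) (ida x) (ida y)
}.

Arguments arr {d} x y.
Arguments pro {d} x y.
Arguments cell {d x y x' y'} m n f g.
Arguments ida {d} x.
Arguments compa {d x y z} g f.
Arguments idc {d x y} m.
Arguments compc {d x y x' y' x'' y'' m n p f g f' g'} b a.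
Arguments idp {d} x.
Arguments compp {d x y z} m n.
Arguments idpc {d x y} f.
Arguments hcomp {d x y z x' y' z' m n m' n' f g h} a b.
Arguments assoc {d x y z w} m n p.
Arguments assocV {d x y z w} m n p.
Arguments lun {d x y} m.
Arguments lunV {d x y} m.
Arguments run {d x y} m.
Arguments runV {d x y} m.

(* g ∘ f: arrows; b • a: cells in the arrow direction;
   m ⊙ n: proarrows; a ⊛ b: cells in the external direction. *)
Notation "g ∘ f" := (compa g f) (at level 40, left associativity) : dbl_scope.
Notation "b • a" := (compc b a) (at level 38, left associativity) : dbl_scope.
Notation "m ⊙ n" := (compp m n) (at level 35, right associativity) : dbl_scope.
Notation "a ⊛ b" := (hcomp a b) (at level 36, right associativity) : dbl_scope.

(* Equality of cells between the same proarrows whose sides are equal, but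
   perhaps not convertible (such as (h ∘ g) ∘ f and h ∘ (g ∘ f)). *)
Inductive ceq (D : dbl) (x y x' y' : ob D) (m : pro x y) (n : pro x' y')
    (f : arr x x') (g : arr y y') (a : cell m n f g) :
    forall (f' : arr x x') (g' : arr y y'), cell m n f' g' -> Prop :=
  ceq_refl : ceq a a.
Notation "a ≡ b" := (ceq a b) (at level 70, no associativity) : dbl_scope.

Definition recast (D : dbl) (x y x' y' : ob D) (m : pro x y) (n : pro x' y')
    (f f' : arr x x') (g g' : arr y y') (ef : f = f') (eg : g = g')
    (a : cell m n f g) : cell m n f' g' :=
  match ef in _ = f1, eg in _ = g1 return cell m n f1 g1 with
  | erefl, erefl => a
  end.

Lemma ceq_sym (D : dbl) (x y x' y' : ob D) (m : pro x y) (n : pro x' y')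
    (f f' : arr x x') (g g' : arr y y') (a : cell m n f g) (b : cell m n f' g') :
  a ≡ b -> b ≡ a.
Proof. by case. Qed.

Lemma ceq_trans (D : dbl) (x y x' y' : ob D) (m : pro x y) (n : pro x' y')
    (f f' f'' : arr x x') (g g' g'' : arr y y')
    (a : cell m n f g) (b : cell m n f' g') (c : cell m n f'' g'') :
  a ≡ b -> b ≡ c -> a ≡ c.
Proof. by case. Qed.

Lemma compc_ceq (D : dbl) (x y x' y' x'' y'' : ob D)
    (m : pro x y) (n : pro x' y') (p : pro x'' y'')
    (f f1 : arr x x') (g g1 : arr y y') (f' f1' : arr x' x'') (g' g1' : arr y' y'')
    (b : cell n p f' g') (b1 : cell n p f1' g1')
    (a : cell m n f g) (a1 : cell m n f1 g1) :
  b ≡ b1 -> a ≡ a1 -> b • a ≡ b1 • a1.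
Proof. by case; case. Qed.

Lemma recast_ceq (D : dbl) (x y x' y' : ob D) (m : pro x y) (n : pro x' y')
    (f f' : arr x x') (g g' : arr y y') (ef : f = f') (eg : g = g') (a : cell m n f g) :
  recast ef eg a ≡ a.
Proof. by case: _ / ef; case: _ / eg. Qed.

(* External composition of cells that share a side only up to equality. *)
Definition hcomp_along (D : dbl) (x y z x' y' z' : ob D)
    (m : pro x y) (n : pro y z) (m' : pro x' y') (n' : pro y' z')
    (f : arr x x') (g g' : arr y y') (h : arr z z') (e : g = g')
    (a : cell m m' f g) (b : cell n n' g' h) : cell (m ⊙ n) (m' ⊙ n') f h :=
  recast erefl e a ⊛ b.

(* Composition of globular cells, and of a globular cell after or before a
   cell, without identities left on the sides. *)
Definition gcomp (D : dbl) (x y : ob D) (m n p : pro x y)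
    (b : cell n p (ida x) (ida y)) (a : cell m n (ida x) (ida y)) :
    cell m p (ida x) (ida y) :=
  recast (comp1a _) (comp1a _) (b • a).
Definition postglob (D : dbl) (x y x' y' : ob D)
    (m : pro x y) (n p : pro x' y') (f : arr x x') (g : arr y y')
    (b : cell n p (ida x') (ida y')) (a : cell m n f g) : cell m p f g :=
  recast (comp1a _) (comp1a _) (b • a).
Definition preglob (D : dbl) (x y x' y' : ob D)
    (m n : pro x y) (p : pro x' y') (f : arr x x') (g : arr y y')
    (b : cell n p f g) (a : cell m n (ida x) (ida y)) : cell m p f g :=
  recast (compa1 _) (compa1 _) (b • a).

Record is_double_category (D : dbl) : Prop := IsDoubleCategory {
  compcA : forall (x0 y0 x1 y1 x2 y2 x3 y3 : ob D)
      (m0 : pro x0 y0) (m1 : pro x1 y1) (m2 : pro x2 y2) (m3 : pro x3 y3)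
      (f0 : arr x0 x1) (g0 : arr y0 y1) (f1 : arr x1 x2) (g1 : arr y1 y2)
      (f2 : arr x2 x3) (g2 : arr y2 y3)
      (c : cell m2 m3 f2 g2) (b : cell m1 m2 f1 g1) (a : cell m0 m1 f0 g0),
    c • (b • a) ≡ (c • b) • a;
  comp1c : forall (x y x' y' : ob D) (m : pro x y) (n : pro x' y')
      (f : arr x x') (g : arr y y') (a : cell m n f g), idc n • a ≡ a;
  compc1 : forall (x y x' y' : ob D) (m : pro x y) (n : pro x' y')
      (f : arr x x') (g : arr y y') (a : cell m n f g), a • idc m ≡ a;
  idpc_comp : forall (x y z : ob D) (g : arr y z) (f : arr x y),
    idpc (g ∘ f) = idpc g • idpc f;
  idpc_id : forall x : ob D, idpc (ida x) = idc (idp x);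
  hcomp_comp : forall (x y z x' y' z' x'' y'' z'' : ob D)
      (m : pro x y) (n : pro y z) (m' : pro x' y') (n' : pro y' z')
      (m'' : pro x'' y'') (n'' : pro y'' z'')
      (f : arr x x') (g : arr y y') (h : arr z z')
      (f' : arr x' x'') (g' : arr y' y'') (h' : arr z' z'')
      (a : cell m m' f g) (b : cell n n' g h)
      (a' : cell m' m'' f' g') (b' : cell n' n'' g' h'),
    (a' • a) ⊛ (b' • b) = (a' ⊛ b') • (a ⊛ b);
  hcomp_id : forall (x y z : ob D) (m : pro x y) (n : pro y z),
    idc m ⊛ idc n = idc (m ⊙ n);
  assocK : forall (x y z w : ob D) (m : pro x y) (n : pro y z) (p : pro z w),
    assocV m n p • assoc m n p ≡ idc ((m ⊙ n) ⊙ p);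
  assocVK : forall (x y z w : ob D) (m : pro x y) (n : pro y z) (p : pro z w),
    assoc m n p • assocV m n p ≡ idc (m ⊙ (n ⊙ p));
  lunK : forall (x y : ob D) (m : pro x y), lunV m • lun m ≡ idc (idp x ⊙ m);
  lunVK : forall (x y : ob D) (m : pro x y), lun m • lunV m ≡ idc m;
  runK : forall (x y : ob D) (m : pro x y), runV m • run m ≡ idc (m ⊙ idp y);
  runVK : forall (x y : ob D) (m : pro x y), run m • runV m ≡ idc m;
  assoc_nat : forall (x y z w x' y' z' w' : ob D)
      (m : pro x y) (n : pro y z) (p : pro z w)
      (m' : pro x' y') (n' : pro y' z') (p' : pro z' w')
      (f : arr x x') (g : arr y y') (h : arr z z') (k : arr w w')
      (a : cell m m' f g) (b : cell n n' g h) (c : cell p p' h k),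
    assoc m' n' p' • ((a ⊛ b) ⊛ c) ≡ (a ⊛ (b ⊛ c)) • assoc m n p;
  lun_nat : forall (x y x' y' : ob D) (m : pro x y) (n : pro x' y')
      (f : arr x x') (g : arr y y') (a : cell m n f g),
    lun n • (idpc f ⊛ a) ≡ a • lun m;
  run_nat : forall (x y x' y' : ob D) (m : pro x y) (n : pro x' y')
      (f : arr x x') (g : arr y y') (a : cell m n f g),
    run n • (a ⊛ idpc g) ≡ a • run m;
  pentagon : forall (x y z w v : ob D)
      (m : pro x y) (n : pro y z) (p : pro z w) (q : pro w v),
    (idc m ⊛ assoc n p q) • (assoc m (n ⊙ p) q • (assoc m n p ⊛ idc q))
      ≡ assoc m n (p ⊙ q) • assoc (m ⊙ n) p q;
  triangle : forall (x y z : ob D) (m : pro x y) (n : pro y z),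
    (idc m ⊛ lun n) • assoc m (idp y) n ≡ run m ⊛ idc n
}.

(* The globular cell m -> n that is the identity, given m = n. *)
Definition eqcell (D : dbl) (x y : ob D) (m n : pro x y) (e : m = n) :
    cell m n (ida x) (ida y) :=
  match e in _ = n' return cell m n' (ida x) (ida y) with erefl => idc m end.

Definition is_strict (D : dbl) : Prop :=
  [/\ forall (x y z w : ob D) (m : pro x y) (n : pro y z) (p : pro z w),
        exists e : (m ⊙ n) ⊙ p = m ⊙ (n ⊙ p), assoc m n p = eqcell e,
      forall (x y : ob D) (m : pro x y),
        exists e : idp x ⊙ m = m, lun m = eqcell e
    & forall (x y : ob D) (m : pro x y),
        exists e : m ⊙ idp y = m, run m = eqcell e].

(* The universe of the objects of [Span]; smallness is relative to it. *)
Definition SET := Type.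

Definition small_type (A : Type) : Prop :=
  exists (X : SET) (f : X -> A), bijective f.

Definition is_small (D : dbl) : Prop :=
  [/\ small_type (ob D),
      forall x y : ob D, small_type (arr x y),
      forall x y : ob D, small_type (pro x y)
    & forall (x y x' y' : ob D) (m : pro x y) (n : pro x' y')
        (f : arr x x') (g : arr y y'), small_type (cell m n f g)].

Definition iso_arr (D : dbl) (x y : ob D) (f : arr x y) : Prop :=
  exists g : arr y x, g ∘ f = ida x /\ f ∘ g = ida y.

Definition iso_cell (D : dbl) (x y x' y' : ob D) (m : pro x y) (n : pro x' y')
    (f : arr x x') (g : arr y y') (a : cell m n f g) : Prop :=
  exists (f' : arr x' x) (g' : arr y' y) (b : cell n m f' g'),
    b • a ≡ idc m /\ a • b ≡ idc n.

Record lax_data (D E : dbl) := LaxData {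
  lob :> ob D -> ob E;
  larr : forall x y, arr x y -> arr (lob x) (lob y);
  lpro : forall x y, pro x y -> pro (lob x) (lob y);
  lcell : forall x y x' y' (m : pro x y) (n : pro x' y')
      (f : arr x x') (g : arr y y'),
    cell m n f g -> cell (lpro m) (lpro n) (larr f) (larr g);
  laxator : forall x y z (m : pro x y) (n : pro y z),
    cell (lpro m ⊙ lpro n) (lpro (m ⊙ n)) (ida (lob x)) (ida (lob z));
  unitor : forall x,
    cell (idp (lob x)) (lpro (idp x)) (ida (lob x)) (ida (lob x));
  larr_id : forall x, larr (ida x) = ida (lob x);
  larr_comp : forall x y z (g : arr y z) (f : arr x y),
    larr (g ∘ f) = larr g ∘ larr f
}.

Arguments larr {D E} F {x y} f : rename.
Arguments lpro {D E} F {x y} m : rename.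
Arguments lcell {D E} F {x y x' y' m n f g} a : rename.
Arguments laxator {D E} F {x y z} m n : rename.
Arguments unitor {D E} F x : rename.

Record is_lax_functor (D E : dbl) (F : lax_data D E) : Prop := IsLaxFunctor {
  lcell_id : forall (x y : ob D) (m : pro x y),
    lcell F (idc m) ≡ idc (lpro F m);
  lcell_comp : forall (x y x' y' x'' y'' : ob D)
      (m : pro x y) (n : pro x' y') (p : pro x'' y'')
      (f : arr x x') (g : arr y y') (f' : arr x' x'') (g' : arr y' y'')
      (b : cell n p f' g') (a : cell m n f g),
    lcell F (b • a) ≡ lcell F b • lcell F a;
  laxator_nat : forall (x y z x' y' z' : ob D)
      (m : pro x y) (n : pro y z) (m' : pro x' y') (n' : pro y' z')
      (f : arr x x') (g : arr y y') (h : arr z z')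
      (a : cell m m' f g) (b : cell n n' g h),
    laxator F m' n' • (lcell F a ⊛ lcell F b) ≡ lcell F (a ⊛ b) • laxator F m n;
  unitor_nat : forall (x y : ob D) (f : arr x y),
    unitor F y • idpc (larr F f) ≡ lcell F (idpc f) • unitor F x;
  laxator_assoc : forall (x y z w : ob D)
      (m : pro x y) (n : pro y z) (p : pro z w),
    lcell F (assoc m n p) • (laxator F (m ⊙ n) p • (laxator F m n ⊛ idc (lpro F p)))
      ≡ laxator F m (n ⊙ p) •
          ((idc (lpro F m) ⊛ laxator F n p) • assoc (lpro F m) (lpro F n) (lpro F p));
  laxator_lun : forall (x y : ob D) (m : pro x y),
    lcell F (lun m) • (laxator F (idp x) m • (unitor F x ⊛ idc (lpro F m)))
      ≡ lun (lpro F m);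
  laxator_run : forall (x y : ob D) (m : pro x y),
    lcell F (run m) • (laxator F m (idp y) • (idc (lpro F m) ⊛ unitor F y))
      ≡ run (lpro F m)
}.

Definition is_pseudo_functor (D E : dbl) (F : lax_data D E) : Prop :=
  [/\ is_lax_functor F,
      forall (x y z : ob D) (m : pro x y) (n : pro y z), iso_cell (laxator F m n)
    & forall x : ob D, iso_cell (unitor F x)].

Definition lax_id (D : dbl) : lax_data D D := {|
  lob := fun x => x;
  larr := fun x y f => f;
  lpro := fun x y m => m;
  lcell := fun x y x' y' m n f g a => a;
  laxator := fun x y z m n => idc (m ⊙ n);
  unitor := fun x => idc (idp x);
  larr_id := fun x => erefl;
  larr_comp := fun x y z g f => erefl
|}.

Definition lax_comp (C D E : dbl) (G : lax_data D E) (F : lax_data C D) :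
    lax_data C E := {|
  lob := fun x => G (F x);
  larr := fun x y f => larr G (larr F f);
  lpro := fun x y m => lpro G (lpro F m);
  lcell := fun x y x' y' m n f g a => lcell G (lcell F a);
  laxator := fun x y z m n =>
    gcomp (recast (larr_id G _) (larr_id G _) (lcell G (laxator F m n)))
          (laxator G (lpro F m) (lpro F n));
  unitor := fun x =>
    gcomp (recast (larr_id G _) (larr_id G _) (lcell G (unitor F x)))
          (unitor G (F x));
  larr_id := fun x => etrans (congr1 (@larr _ _ G _ _) (larr_id F x)) (larr_id G (F x));
  larr_comp := fun x y z g f =>
    etrans (congr1 (@larr _ _ G _ _) (larr_comp F g f)) (larr_comp G _ _)
|}.

(* Components on objects and proarrows, compatible with external composition;
   no naturality yet. *)
Record pretrans (D E : dbl) (F G : lax_data D E) := Pretrans {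
  tob : forall x : ob D, arr (F x) (G x);
  tpro : forall (x y : ob D) (m : pro x y),
    cell (lpro F m) (lpro G m) (tob x) (tob y);
  tpro_comp : forall (x y z : ob D) (m : pro x y) (n : pro y z),
    tpro (m ⊙ n) • laxator F m n ≡ laxator G m n • (tpro m ⊛ tpro n);
  tpro_id : forall x : ob D,
    tpro (idp x) • unitor F x ≡ unitor G x • idpc (tob x)
}.

Arguments tob {D E F G} p x : rename.
Arguments tpro {D E F G} p {x y} m : rename.

(* Natural transformations: the 2-cells of the 2-category of double
   categories, lax functors and natural transformations. *)
Record nat_trans (D E : dbl) (F G : lax_data D E) := NatTrans {
  nt_pre :> pretrans F G;
  nt_arr : forall (x y : ob D) (f : arr x y),
    larr G f ∘ tob nt_pre x = tob nt_pre y ∘ larr F f;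
  nt_cell : forall (x y x' y' : ob D) (m : pro x y) (n : pro x' y')
      (f : arr x x') (g : arr y y') (c : cell m n f g),
    lcell G c • tpro nt_pre m ≡ tpro nt_pre n • lcell F c
}.

(* For cells a : id_x -> G id_w over (f, g) and b : id_x -> G id_w over (g, h):
   the composite G_{id_w,id_w} ∘ (a ⊙ b), up to unitors. *)
Definition paste (D E : dbl) (G : lax_data D E) (x : ob E) (w : ob D)
    (f g g' h : arr x (G w)) (e : g = g')
    (a : cell (idp x) (lpro G (idp w)) f g)
    (b : cell (idp x) (lpro G (idp w)) g' h) :
    cell (idp x) (lpro G (idp w)) f h :=
  postglob (recast (larr_id G w) (larr_id G w) (lcell G (lun (idp w))))
    (postglob (laxator G (idp w) (idp w))
      (preglob (hcomp_along e a b) (lunV (idp x)))).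

(* For a naturality comparison of a lax transformation, the sides are
   Gf ∘ α_x and α_y ∘ Ff. *)
Record lax_trans (D E : dbl) (F G : lax_data D E) := LaxTrans {
  lt_pre :> pretrans F G;
  lt_cmp : forall (x y : ob D) (f : arr x y),
    cell (idp (F x)) (lpro G (idp y))
      (larr G f ∘ tob lt_pre x) (tob lt_pre y ∘ larr F f);
  lt_cmp_id : forall x : ob D,
    lt_cmp (ida x) ≡ unitor G x • idpc (tob lt_pre x);
  lt_cmp_comp : forall (x y z : ob D) (g : arr y z) (f : arr x y),
    lt_cmp (g ∘ f) ≡
      paste (compaA _ _ _)
        (lcell G (idpc g) • lt_cmp f) (lt_cmp g • idpc (larr F f));
  lt_cell : forall (x y w z : ob D) (m : pro x y) (n : pro w z)
      (f : arr x w) (g : arr y z) (c : cell m n f g),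
    lcell G (run n) • (laxator G n (idp z) •
        (((lcell G c • tpro lt_pre m) ⊛ lt_cmp g) • runV (lpro F m)))
      ≡ lcell G (lun n) • (laxator G (idp w) n •
        ((lt_cmp f ⊛ (tpro lt_pre n • lcell F c)) • lunV (lpro F m)))
}.

Record oplax_trans (D E : dbl) (F G : lax_data D E) := OplaxTrans {
  ot_pre :> pretrans F G;
  ot_cmp : forall (x y : ob D) (f : arr x y),
    cell (idp (F x)) (lpro G (idp y))
      (tob ot_pre y ∘ larr F f) (larr G f ∘ tob ot_pre x);
  ot_cmp_id : forall x : ob D,
    ot_cmp (ida x) ≡ unitor G x • idpc (tob ot_pre x);
  ot_cmp_comp : forall (x y z : ob D) (g : arr y z) (f : arr x y),
    ot_cmp (g ∘ f) ≡
      paste (esym (compaA _ _ _))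
        (ot_cmp g • idpc (larr F f)) (lcell G (idpc g) • ot_cmp f);
  ot_cell : forall (x y w z : ob D) (m : pro x y) (n : pro w z)
      (f : arr x w) (g : arr y z) (c : cell m n f g),
    lcell G (lun n) • (laxator G (idp w) n •
        ((ot_cmp f ⊛ (lcell G c • tpro ot_pre m)) • lunV (lpro F m)))
      ≡ lcell G (run n) • (laxator G n (idp z) •
        (((tpro ot_pre n • lcell F c) ⊛ ot_cmp g) • runV (lpro F m)))
}.

Arguments lt_cmp {D E F G} l {x y} f.
Arguments ot_cmp {D E F G} o {x y} f.

Definition is_pseudo_trans (D E : dbl) (F G : lax_data D E)
    (a : lax_trans F G) : Prop :=
  forall (x y : ob D) (f : arr x y),
    exists b : cell (idp (F x)) (lpro G (idp y))
                 (tob a y ∘ larr F f) (larr G f ∘ tob a x),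
      paste erefl (lt_cmp a f) b ≡ unitor G y • idpc (larr G f ∘ tob a x) /\
      paste erefl b (lt_cmp a f) ≡ unitor G y • idpc (tob a y ∘ larr F f).

Definition is_strict_trans (D E : dbl) (F G : lax_data D E)
    (a : lax_trans F G) : Prop :=
  forall (x y : ob D) (f : arr x y),
    larr G f ∘ tob a x = tob a y ∘ larr F f /\
    lt_cmp a f ≡ unitor G y • idpc (tob a y ∘ larr F f).

(* Finite families of objects of D. Arrows and cells are contravariant in the
   index sets: f : (X_i) -> (Y_j) has a function J -> I and arrows
   X_{f j} -> Y_j. *)
Section FiniteFamilies.
Variable D : dbl.

Record fam := Fam { fidx : finType; fob :> fidx -> ob D }.

Record fam_arr (X Y : fam) := FamArr {
  fa_idx : fidx Y -> fidx X;
  fa_arr : forall j : fidx Y, arr (X (fa_idx j)) (Y j)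
}.

(* A span of finite sets I -|-> J is given by its fibres, so that
   [fp_idx i j] is the finite set of elements a : i -|-> j. Composition by
   pullback thus becomes [{j & A i j * B j k}]. *)
Record fam_pro (X Y : fam) := FamPro {
  fp_idx : fidx X -> fidx Y -> finType;
  fp_pro : forall i j, fp_idx i j -> pro (X i) (Y j)
}.
Arguments fp_idx {X Y} f i j.
Arguments fp_pro {X Y} f {i j} a.

Record fam_cell (X Y X' Y' : fam) (M : fam_pro X Y) (N : fam_pro X' Y')
    (f : fam_arr X X') (g : fam_arr Y Y') := FamCell {
  fc_idx : forall k l, fp_idx N k l -> fp_idx M (fa_idx f k) (fa_idx g l);
  fc_cell : forall k l (b : fp_idx N k l),
    cell (fp_pro M (fc_idx b)) (fp_pro N b) (fa_arr f k) (fa_arr g l)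
}.

Definition fam_ida (X : fam) : fam_arr X X :=
  FamArr (X := X) (fa_idx := fun i => i) (fun i => ida (X i)).

Definition fam_compa (X Y Z : fam) (g : fam_arr Y Z) (f : fam_arr X Y) :
    fam_arr X Z :=
  FamArr (X := X) (fa_idx := fun k => fa_idx f (fa_idx g k))
    (fun k => fa_arr g k ∘ fa_arr f (fa_idx g k)).

Lemma fam_compaA X Y Z W (h : fam_arr Z W) (g : fam_arr Y Z) (f : fam_arr X Y) :
  fam_compa h (fam_compa g f) = fam_compa (fam_compa h g) f.
Proof.
by congr FamArr; apply: functional_extensionality_dep => k; apply: compaA.
Qed.

Lemma fam_comp1a X Y (f : fam_arr X Y) : fam_compa (fam_ida Y) f = f.
Proof.
case: f => f0 f1; congr FamArr.
by apply: functional_extensionality_dep => k; apply: comp1a.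
Qed.

Lemma fam_compa1 X Y (f : fam_arr X Y) : fam_compa f (fam_ida X) = f.
Proof.
case: f => f0 f1; congr FamArr.
by apply: functional_extensionality_dep => k; apply: compa1.
Qed.

Definition fam_idc X Y (M : fam_pro X Y) : fam_cell M M (fam_ida X) (fam_ida Y) :=
  FamCell (f := fam_ida X) (g := fam_ida Y) (fc_idx := fun i j a => a)
    (fun i j a => idc (fp_pro M a)).

Definition fam_compc X Y X' Y' X'' Y''
    (M : fam_pro X Y) (N : fam_pro X' Y') (P : fam_pro X'' Y'')
    (f : fam_arr X X') (g : fam_arr Y Y') (f' : fam_arr X' X'') (g' : fam_arr Y' Y'')
    (b : fam_cell N P f' g') (a : fam_cell M N f g) :
    fam_cell M P (fam_compa f' f) (fam_compa g' g) :=
  FamCell (f := fam_compa f' f) (g := fam_compa g' g)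
    (fc_idx := fun k l c => fc_idx a (fc_idx b c))
    (fun k l c => fc_cell b c • fc_cell a (fc_idx b c)).

(* The identity proarrow on X: the identity span on its index set, with
   identity proarrows. *)
Definition eq_idp (I : Type) (X : I -> ob D) (i i' : I) (e : i = i') :
    pro (X i) (X i') :=
  match e in _ = k return pro (X i) (X k) with erefl => idp (X i) end.

Definition fam_idp (X : fam) : fam_pro X X :=
  FamPro (fp_idx := fun i i' => ({_ : unit | i == i'} : finType))
    (fun i i' t => eq_idp X (eqP (proj2_sig t))).

Definition fam_compp X Y Z (M : fam_pro X Y) (N : fam_pro Y Z) : fam_pro X Z :=
  FamPro
    (fp_idx := fun i k => ({j : fidx Y & (fp_idx M i j * fp_idx N j k)%type} : finType))
    (fun i k t => fp_pro M (tagged t).1 ⊙ fp_pro N (tagged t).2).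

Definition eq_idpc (I J : eqType) (X : I -> ob D) (Y : J -> ob D) (f0 : J -> I)
    (f : forall j, arr (X (f0 j)) (Y j)) (k l : J) (e : k = l) (e' : f0 k = f0 l) :
    cell (eq_idp X e') (eq_idp Y e) (f k) (f l) :=
  match e in _ = l
    return forall e' : f0 k = f0 l, cell (eq_idp X e') (eq_idp Y e) (f k) (f l)
  with erefl => fun e' =>
    match eq_irrelevance erefl e' in _ = e'
      return cell (eq_idp X e') (eq_idp Y erefl) (f k) (f k)
    with erefl => idpc (f k) end
  end e'.

Lemma fam_idpc_idx (I J : eqType) (f0 : J -> I) (k l : J) :
  k == l -> f0 k == f0 l.
Proof. by move/eqP->. Qed.

Definition fam_idpc X Y (f : fam_arr X Y) : fam_cell (fam_idp X) (fam_idp Y) f f :=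
  FamCell (M := fam_idp X) (N := fam_idp Y)
    (fc_idx := fun k l (t : {_ : unit | k == l}) =>
       exist (fun=> is_true (fa_idx f k == fa_idx f l))
         tt (fam_idpc_idx (fa_idx f) (proj2_sig t)))
    (fun k l t => eq_idpc (fa_arr f) _ _).

Definition fam_hcomp X Y Z X' Y' Z'
    (M : fam_pro X Y) (N : fam_pro Y Z) (M' : fam_pro X' Y') (N' : fam_pro Y' Z')
    (f : fam_arr X X') (g : fam_arr Y Y') (h : fam_arr Z Z')
    (a : fam_cell M M' f g) (b : fam_cell N N' g h) :
    fam_cell (fam_compp M N) (fam_compp M' N') f h :=
  FamCell (M := fam_compp M N) (N := fam_compp M' N')
    (fc_idx := fun k l (t : {j : fidx Y' & (fp_idx M' k j * fp_idx N' j l)%type}) =>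
       existT (fun j => (fp_idx M (fa_idx f k) j * fp_idx N j (fa_idx h l))%type)
         (fa_idx g (tag t)) (fc_idx a (tagged t).1, fc_idx b (tagged t).2))
    (fun k l t => fc_cell a (tagged t).1 ⊛ fc_cell b (tagged t).2).

Definition fam_assoc X Y Z W (M : fam_pro X Y) (N : fam_pro Y Z) (P : fam_pro Z W) :
    fam_cell (fam_compp (fam_compp M N) P) (fam_compp M (fam_compp N P))
      (fam_ida X) (fam_ida W) :=
  FamCell (M := fam_compp (fam_compp M N) P) (N := fam_compp M (fam_compp N P))
    (f := fam_ida X) (g := fam_ida W)
    (fc_idx := fun i l (t : fp_idx (fam_compp M (fam_compp N P)) i l) =>
       let u := (tagged t).2 in
       existT (fun k => (fp_idx (fam_compp M N) i k * fp_idx P k l)%type) (tag u)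
         (existT (fun j => (fp_idx M i j * fp_idx N j (tag u))%type) (tag t)
            ((tagged t).1, (tagged u).1),
          (tagged u).2))
    (fun i l t => assoc (fp_pro M (tagged t).1) (fp_pro N (tagged (tagged t).2).1)
                    (fp_pro P (tagged (tagged t).2).2)).

Definition fam_assocV X Y Z W (M : fam_pro X Y) (N : fam_pro Y Z) (P : fam_pro Z W) :
    fam_cell (fam_compp M (fam_compp N P)) (fam_compp (fam_compp M N) P)
      (fam_ida X) (fam_ida W) :=
  FamCell (M := fam_compp M (fam_compp N P)) (N := fam_compp (fam_compp M N) P)
    (f := fam_ida X) (g := fam_ida W)
    (fc_idx := fun i l (t : fp_idx (fam_compp (fam_compp M N) P) i l) =>
       let u := (tagged t).1 in
       existT (fun j => (fp_idx M i j * fp_idx (fam_compp N P) j l)%type) (tag u)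
         ((tagged u).1,
          existT (fun k => (fp_idx N (tag u) k * fp_idx P k l)%type) (tag t)
            ((tagged u).2, (tagged t).2)))
    (fun i l t => assocV (fp_pro M (tagged (tagged t).1).1)
                    (fp_pro N (tagged (tagged t).1).2) (fp_pro P (tagged t).2)).

Definition fam_lun X Y (M : fam_pro X Y) :
    fam_cell (fam_compp (fam_idp X) M) M (fam_ida X) (fam_ida Y) :=
  FamCell (M := fam_compp (fam_idp X) M) (f := fam_ida X) (g := fam_ida Y)
    (fc_idx := fun i j (a : fp_idx M i j) =>
       existT (fun i' => ({_ : unit | i == i'} * fp_idx M i' j)%type) i
         (exist (fun=> is_true (i == i)) tt (eqxx i), a))
    (fun i j a =>
       match eq_irrelevance erefl (eqP (eqxx i)) in _ = e
         return cell (eq_idp X e ⊙ fp_pro M a) (fp_pro M a) (ida _) (ida _)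
       with erefl => lun (fp_pro M a) end).

Definition fam_run X Y (M : fam_pro X Y) :
    fam_cell (fam_compp M (fam_idp Y)) M (fam_ida X) (fam_ida Y) :=
  FamCell (M := fam_compp M (fam_idp Y)) (f := fam_ida X) (g := fam_ida Y)
    (fc_idx := fun i j (a : fp_idx M i j) =>
       existT (fun j' => (fp_idx M i j' * {_ : unit | j' == j})%type) j
         (a, exist (fun=> is_true (j == j)) tt (eqxx j)))
    (fun i j a =>
       match eq_irrelevance erefl (eqP (eqxx j)) in _ = e
         return cell (fp_pro M a ⊙ eq_idp Y e) (fp_pro M a) (ida _) (ida _)
       with erefl => run (fp_pro M a) end).

Definition fp_castl X Y (M : fam_pro X Y) (i i' : fidx X) (j : fidx Y)
    (e : i = i') (a : fp_idx M i' j) : fp_idx M i j :=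
  match e in _ = k return fp_idx M k j -> fp_idx M i j with erefl => id end a.

Definition fp_castr X Y (M : fam_pro X Y) (i : fidx X) (j j' : fidx Y)
    (e : j = j') (a : fp_idx M i j) : fp_idx M i j' :=
  match e in _ = k return fp_idx M i k with erefl => a end.

Definition fp_castl_lunV X Y (M : fam_pro X Y) (i i' : fidx X) (j : fidx Y)
    (e : i = i') (a : fp_idx M i' j) :
    cell (fp_pro M (fp_castl e a)) (eq_idp X e ⊙ fp_pro M a) (ida _) (ida _) :=
  match e as e' in _ = k return forall a : fp_idx M k j,
    cell (fp_pro M (fp_castl e' a)) (eq_idp X e' ⊙ fp_pro M a) (ida _) (ida _)
  with erefl => fun a => lunV (fp_pro M a) end a.

Definition fp_castr_runV X Y (M : fam_pro X Y) (i : fidx X) (j j' : fidx Y)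
    (e : j = j') (a : fp_idx M i j) :
    cell (fp_pro M (fp_castr e a)) (fp_pro M a ⊙ eq_idp Y e) (ida _) (ida _) :=
  match e as e' in _ = k return
    cell (fp_pro M (fp_castr e' a)) (fp_pro M a ⊙ eq_idp Y e') (ida _) (ida _)
  with erefl => runV (fp_pro M a) end.

Definition fam_lunV X Y (M : fam_pro X Y) :
    fam_cell M (fam_compp (fam_idp X) M) (fam_ida X) (fam_ida Y) :=
  FamCell (N := fam_compp (fam_idp X) M) (f := fam_ida X) (g := fam_ida Y)
    (fc_idx := fun i j (t : fp_idx (fam_compp (fam_idp X) M) i j) =>
       fp_castl (eqP (proj2_sig (tagged t).1)) (tagged t).2)
    (fun i j t => fp_castl_lunV (eqP (proj2_sig (tagged t).1)) (tagged t).2).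

Definition fam_runV X Y (M : fam_pro X Y) :
    fam_cell M (fam_compp M (fam_idp Y)) (fam_ida X) (fam_ida Y) :=
  FamCell (N := fam_compp M (fam_idp Y)) (f := fam_ida X) (g := fam_ida Y)
    (fc_idx := fun i j (t : fp_idx (fam_compp M (fam_idp Y)) i j) =>
       fp_castr (eqP (proj2_sig (tagged t).2)) (tagged t).1)
    (fun i j t => fp_castr_runV (eqP (proj2_sig (tagged t).2)) (tagged t).1).

Definition FinFam : dbl := {|
  ob := fam; arr := fam_arr; pro := fam_pro; cell := fam_cell;
  ida := fam_ida; compa := fam_compa;
  compaA := fam_compaA; comp1a := fam_comp1a; compa1 := fam_compa1;
  idc := fam_idc; compc := fam_compc;
  idp := fam_idp; compp := fam_compp; idpc := fam_idpc; hcomp := fam_hcomp;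
  assoc := fam_assoc; assocV := fam_assocV;
  lun := fam_lun; lunV := fam_lunV; run := fam_run; runV := fam_runV
|}.

Definition sing_ob (x : ob D) : fam := @Fam unit (fun=> x).

Definition sing_arr x y (f : arr x y) : fam_arr (sing_ob x) (sing_ob y) :=
  FamArr (X := sing_ob x) (Y := sing_ob y) (fa_idx := id) (fun=> f).

Definition sing_pro x y (m : pro x y) : fam_pro (sing_ob x) (sing_ob y) :=
  FamPro (X := sing_ob x) (Y := sing_ob y) (fp_idx := fun _ _ => (unit : finType))
    (fun _ _ _ => m).

Definition sing_cell x y x' y' (m : pro x y) (n : pro x' y')
    (f : arr x x') (g : arr y y') (a : cell m n f g) :
    fam_cell (sing_pro m) (sing_pro n) (sing_arr f) (sing_arr g) :=
  FamCell (M := sing_pro m) (N := sing_pro n) (f := sing_arr f) (g := sing_arr g)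
    (fc_idx := fun _ _ t => t) (fun _ _ _ => a).

Definition sing_laxator x y z (m : pro x y) (n : pro y z) :
    fam_cell (fam_compp (sing_pro m) (sing_pro n)) (sing_pro (m ⊙ n))
      (fam_ida (sing_ob x)) (fam_ida (sing_ob z)) :=
  FamCell (M := fam_compp (sing_pro m) (sing_pro n)) (N := sing_pro (m ⊙ n))
    (f := fam_ida (sing_ob x)) (g := fam_ida (sing_ob z))
    (fc_idx := fun _ _ _ => existT (fun _ : unit => (unit * unit)%type) tt (tt, tt))
    (fun _ _ _ => idc (m ⊙ n)).

Definition eq_idp_const (I : Type) (x : ob D) (i i' : I) (e : i = i') :
    cell (eq_idp (fun=> x) e) (idp x) (ida x) (ida x) :=
  match e as e' in _ = k return cell (eq_idp (fun=> x) e') (idp x) (ida x) (ida x)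
  with erefl => idc (idp x) end.

Definition sing_unitor x :
    fam_cell (fam_idp (sing_ob x)) (sing_pro (idp x))
      (fam_ida (sing_ob x)) (fam_ida (sing_ob x)) :=
  FamCell (M := fam_idp (sing_ob x)) (N := sing_pro (idp x))
    (f := fam_ida (sing_ob x)) (g := fam_ida (sing_ob x))
    (fc_idx := fun i j _ => exist (fun=> is_true (i == j)) tt isT)
    (fun _ _ _ => eq_idp_const x _).

Definition Sing : lax_data D FinFam := {|
  lob := sing_ob : ob D -> ob FinFam;
  larr := sing_arr; lpro := sing_pro; lcell := sing_cell;
  laxator := sing_laxator; unitor := sing_unitor;
  larr_id := fun x => erefl;
  larr_comp := fun x y z g f => erefl
|}.

End FiniteFamilies.

Arguments fidx {D} X : rename.
Arguments fob {D} X i : rename.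
Arguments fa_idx {D X Y} f j.
Arguments fa_arr {D X Y} f j.
Arguments fp_idx {D X Y} M i j : rename.
Arguments fp_pro {D X Y} M {i j} a : rename.
Arguments fc_idx {D X Y X' Y' M N f g} c {k l} b : rename.
Arguments fc_cell {D X Y X' Y' M N f g} c {k l} b : rename.

Record adjunction (D E : dbl) (L : lax_data D E) (R : lax_data E D) := Adjunction {
  adj_unit : nat_trans (lax_id D) (lax_comp R L);
  adj_counit : nat_trans (lax_comp L R) (lax_id E);
  adj_triL_ob : forall x : ob D,
    tob adj_counit (L x) ∘ larr L (tob adj_unit x) = ida (L x);
  adj_triL_pro : forall (x y : ob D) (m : pro x y),
    tpro adj_counit (lpro L m) • lcell L (tpro adj_unit m) ≡ idc (lpro L m);
  adj_triR_ob : forall x : ob E,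
    larr R (tob adj_counit x) ∘ tob adj_unit (R x) = ida (R x);
  adj_triR_pro : forall (x y : ob E) (m : pro x y),
    lcell R (tpro adj_counit m) • tpro adj_unit (lpro R m) ≡ idc (lpro R m)
}.

Record lax_finite_products (D : dbl) := LaxFiniteProducts {
  Prod : lax_data (FinFam D) D;
  Prod_lax : is_lax_functor Prod;
  Prod_adj : adjunction (Sing D) Prod
}.

Record strong_finite_products (D : dbl) := StrongFiniteProducts {
  strong_lax :> lax_finite_products D;
  strong_pseudo : is_pseudo_functor (Prod strong_lax)
}.

Section Products.
Variables (D : dbl) (P : lax_finite_products D).

Definition prod_ob (X : fam D) : ob D := Prod P X.

Definition prod_pro (X Y : fam D) (M : fam_pro X Y) : pro (prod_ob X) (prod_ob Y) :=
  lpro (Prod P) (M : @pro (FinFam D) X Y).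

Definition proj (X : fam D) (i : fidx X) : arr (prod_ob X) (X i) :=
  fa_arr (tob (adj_counit (Prod_adj P)) X : fam_arr _ X) i.

Definition proj_cell (X Y : fam D) (M : fam_pro X Y) (i : fidx X) (j : fidx Y)
    (a : fp_idx M i j) : cell (prod_pro M) (fp_pro M a) (proj i) (proj j) :=
  fc_cell (tpro (adj_counit (Prod_adj P)) (M : @pro (FinFam D) X Y)
             : fam_cell _ M _ _) a.

(* The transposes under the adjunction of Δz -> X and of Δm -> M. *)
Definition tuple_arr (z : ob D) (X : fam D) (h : forall i, arr z (X i)) :
    arr z (prod_ob X) :=
  larr (Prod P)
    (FamArr (X := sing_ob z) (fa_idx := fun=> tt) h : @arr (FinFam D) (sing_ob z) X)
  ∘ tob (adj_unit (Prod_adj P)) z.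

Definition tuple_cell (z w : ob D) (m : pro z w) (X Y : fam D) (M : fam_pro X Y)
    (h : forall i, arr z (X i)) (k : forall j, arr w (Y j))
    (c : forall i j (a : fp_idx M i j), cell m (fp_pro M a) (h i) (k j)) :
    cell m (prod_pro M) (tuple_arr h) (tuple_arr k) :=
  lcell (Prod P)
    (FamCell (M := sing_pro m)
       (f := FamArr (X := sing_ob z) (fa_idx := fun=> tt) h)
       (g := FamArr (X := sing_ob w) (fa_idx := fun=> tt) k)
       (fc_idx := fun _ _ _ => tt) c
     : @cell (FinFam D) (sing_ob z) (sing_ob w) X Y (sing_pro m) M _ _)
  • tpro (adj_unit (Prod_adj P)) m.

End Products.

Section Preservation.
Variables (D E : dbl) (PD : lax_finite_products D) (PE : lax_finite_products E).

Definition map_fam (F : lax_data D E) (X : fam D) : fam E := Fam (fun i => F (X i)).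

Definition map_fam_pro (F : lax_data D E) (X Y : fam D) (M : fam_pro X Y) :
    fam_pro (map_fam F X) (map_fam F Y) :=
  FamPro (X := map_fam F X) (Y := map_fam F Y) (fp_idx := fp_idx M)
    (fun i j a => lpro F (fp_pro M a)).

Definition comparison (F : lax_data D E) (X : fam D) :
    arr (F (prod_ob PD X)) (prod_ob PE (map_fam F X)) :=
  tuple_arr PE (X := map_fam F X) (fun i => larr F (proj PD i)).

Definition comparison_cell (F : lax_data D E) (X Y : fam D) (M : fam_pro X Y) :
    cell (lpro F (prod_pro PD M)) (prod_pro PE (map_fam_pro F M))
      (comparison F X) (comparison F Y) :=
  tuple_cell PE (M := map_fam_pro F M) (fun i j a => lcell F (proj_cell PD a)).

Definition preserves_products (F : lax_data D E) : Prop :=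
  (forall X : fam D, iso_arr (comparison F X)) /\
  (forall (X Y : fam D) (M : fam_pro X Y), iso_cell (comparison_cell F M)).

Definition lax_trans_preserves (F G : lax_data D E) (a : lax_trans F G) : Prop :=
  forall (X : fam D) (i : fidx X),
    larr G (proj PD i) ∘ tob a (prod_ob PD X) = tob a (X i) ∘ larr F (proj PD i) /\
    lt_cmp a (proj PD i) ≡ unitor G (X i) • idpc (tob a (X i) ∘ larr F (proj PD i)).

Definition oplax_trans_preserves (F G : lax_data D E) (a : oplax_trans F G) : Prop :=
  forall (X : fam D) (i : fidx X),
    larr G (proj PD i) ∘ tob a (prod_ob PD X) = tob a (X i) ∘ larr F (proj PD i) /\
    ot_cmp a (proj PD i) ≡ unitor G (X i) • idpc (tob a (X i) ∘ larr F (proj PD i)).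

End Preservation.

(* A lax functor D × {0 -|-> 1} -> E that restricts to F and to G, with the
   parts that are not already in F and G spelled out. *)
Record module (D E : dbl) (F G : lax_data D E) := Module {
  mpro : forall x y : ob D, pro x y -> pro (F x) (G y);
  mcell : forall (x y x' y' : ob D) (m : pro x y) (n : pro x' y')
      (f : arr x x') (g : arr y y'),
    cell m n f g -> cell (mpro m) (mpro n) (larr F f) (larr G g);
  actl : forall (x y z : ob D) (m : pro x y) (n : pro y z),
    cell (lpro F m ⊙ mpro n) (mpro (m ⊙ n)) (ida (F x)) (ida (G z));
  actr : forall (x y z : ob D) (m : pro x y) (n : pro y z),
    cell (mpro m ⊙ lpro G n) (mpro (m ⊙ n)) (ida (F x)) (ida (G z));
  mcell_id : forall (x y : ob D) (m : pro x y), mcell (idc m) ≡ idc (mpro m);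
  mcell_comp : forall (x y x' y' x'' y'' : ob D)
      (m : pro x y) (n : pro x' y') (p : pro x'' y'')
      (f : arr x x') (g : arr y y') (f' : arr x' x'') (g' : arr y' y'')
      (b : cell n p f' g') (a : cell m n f g),
    mcell (b • a) ≡ mcell b • mcell a;
  actl_nat : forall (x y z x' y' z' : ob D)
      (m : pro x y) (n : pro y z) (m' : pro x' y') (n' : pro y' z')
      (f : arr x x') (g : arr y y') (h : arr z z')
      (a : cell m m' f g) (b : cell n n' g h),
    actl m' n' • (lcell F a ⊛ mcell b) ≡ mcell (a ⊛ b) • actl m n;
  actr_nat : forall (x y z x' y' z' : ob D)
      (m : pro x y) (n : pro y z) (m' : pro x' y') (n' : pro y' z')
      (f : arr x x') (g : arr y y') (h : arr z z')
      (a : cell m m' f g) (b : cell n n' g h),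
    actr m' n' • (mcell a ⊛ lcell G b) ≡ mcell (a ⊛ b) • actr m n;
  actl_assoc : forall (x y z w : ob D) (m : pro x y) (n : pro y z) (p : pro z w),
    mcell (assoc m n p) • (actl (m ⊙ n) p • (laxator F m n ⊛ idc (mpro p)))
      ≡ actl m (n ⊙ p) •
          ((idc (lpro F m) ⊛ actl n p) • assoc (lpro F m) (lpro F n) (mpro p));
  actlr_assoc : forall (x y z w : ob D) (m : pro x y) (n : pro y z) (p : pro z w),
    mcell (assoc m n p) • (actr (m ⊙ n) p • (actl m n ⊛ idc (lpro G p)))
      ≡ actl m (n ⊙ p) •
          ((idc (lpro F m) ⊛ actr n p) • assoc (lpro F m) (mpro n) (lpro G p));
  actr_assoc : forall (x y z w : ob D) (m : pro x y) (n : pro y z) (p : pro z w),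
    mcell (assoc m n p) • (actr (m ⊙ n) p • (actr m n ⊛ idc (lpro G p)))
      ≡ actr m (n ⊙ p) •
          ((idc (mpro m) ⊛ laxator G n p) • assoc (mpro m) (lpro G n) (lpro G p));
  actl_unit : forall (x y : ob D) (m : pro x y),
    mcell (lun m) • (actl (idp x) m • (unitor F x ⊛ idc (mpro m))) ≡ lun (mpro m);
  actr_unit : forall (x y : ob D) (m : pro x y),
    mcell (run m) • (actr m (idp y) • (idc (mpro m) ⊛ unitor G y)) ≡ run (mpro m)
}.

Arguments mpro {D E F G} M {x y} m : rename.
Arguments mcell {D E F G} M {x y x' y' m n f g} a : rename.
Arguments actl {D E F G} M {x y z} m n : rename.
Arguments actr {D E F G} M {x y z} m n : rename.

Section ModulePreservation.
Variables (D E : dbl) (PD : lax_finite_products D) (PE : lax_finite_products E).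
Variables (F G : lax_data D E) (M : module F G).

Definition map_fam_mod (X Y : fam D) (m : fam_pro X Y) :
    fam_pro (map_fam F X) (map_fam G Y) :=
  FamPro (X := map_fam F X) (Y := map_fam G Y) (fp_idx := fp_idx m)
    (fun i j a => mpro M (fp_pro m a)).

Definition module_comparison (X Y : fam D) (m : fam_pro X Y) :
    cell (mpro M (prod_pro PD m)) (prod_pro PE (map_fam_mod m))
      (comparison PD PE F X) (comparison PD PE G Y) :=
  tuple_cell PE (M := map_fam_mod m) (fun i j a => mcell M (proj_cell PD a)).

Definition module_preserves : Prop :=
  forall (X Y : fam D) (m : fam_pro X Y), iso_cell (module_comparison m).

End ModulePreservation.

Section Paths.
Variables (O : Type) (P : O -> O -> Type).

Inductive path : O -> O -> Type :=
| pnil F : path F F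
| pcons F G H : P F G -> path G H -> path F H.

Fixpoint papp F G H (s : path F G) : path G H -> path F H :=
  match s with
  | pnil _ => fun t => t
  | pcons _ _ _ M s' => fun t => pcons M (papp s' t)
  end.

Lemma papp_nil F G (s : path F G) : papp s (pnil G) = s.
Proof. by elim: s => //= F1 G1 H1 M s ->. Qed.

Lemma papp_assoc F G H K (s : path F G) (t : path G H) (u : path H K) :
  papp (papp s t) u = papp s (papp t u).
Proof. by elim: s t => //= F1 G1 H1 M s IHs t; rewrite IHs. Qed.

End Paths.

Arguments pnil {O P} F.
Arguments pcons {O P F G H} M s : rename.
Arguments papp {O P F G H} s t.

(* [vcell s N f g] is the type of multicells s -> N with left side f and
   right side g. *)
Record vgraph := VGraph {
  vob : Type;
  varr : vob -> vob -> Type;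
  vpro : vob -> vob -> Type;
  vcell : forall F F' G G' : vob,
    path vpro F F' -> vpro G G' -> varr F G -> varr F' G' -> Type
}.

Arguments varr {v} F G : rename.
Arguments vpro {v} F G : rename.
Arguments vcell {v F F' G G'} s N f g : rename.

Section VirtualDoubleCategories.
Variable V : vgraph.
Implicit Types F G H K : vob V.

(* Equality of multicells with the same source and target whose sides are
   equal, but perhaps not convertible. *)
Inductive vceq F F' G G' (s : path vpro F F') (N : vpro G G')
    (f : varr F G) (f' : varr F' G') (m : vcell s N f f') :
    forall (g : varr F G) (g' : varr F' G'), vcell s N g g' -> Prop :=
  vceq_refl : vceq m m.

(* [cells s t f g]: a composable sequence of multicells, with sides f and g at
   its ends, whose targets form the path t and whose sources together form the
   path s. *)
Inductive cells : forall F F' G G' : vob V,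
    path vpro F F' -> path vpro G G' -> varr F G -> varr F' G' -> Type :=
| cnil F G (f : varr F G) : cells (pnil F) (pnil G) f f
| ccons F F' F'' G G' G'' (s1 : path vpro F F') (s2 : path vpro F' F'')
    (s : path vpro F F'') (e : papp s1 s2 = s)
    (N : vpro G G') (t : path vpro G' G'')
    (f : varr F G) (f' : varr F' G') (f'' : varr F'' G'') :
    vcell s1 N f f' -> cells s2 t f' f'' -> cells s (pcons N t) f f''.

Fixpoint cells_app F F' G G' (s : path vpro F F') (t : path vpro G G')
    (f : varr F G) (f' : varr F' G') (c : cells s t f f') :
    forall F'' G'' (s' : path vpro F' F'') (t' : path vpro G' G'')
      (f'' : varr F'' G''),
    cells s' t' f' f'' -> cells (papp s s') (papp t t') f f'' :=
  match c with
  | cnil _ _ _ => fun _ _ _ _ _ c' => c'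
  | ccons _ _ _ _ _ _ s1 s2 s e N t _ _ _ m c1 => fun _ _ s' _ _ c' =>
      ccons (etrans (esym (papp_assoc s1 s2 s')) (congr1 (fun r => papp r s') e))
        m (cells_app c1 c')
  end.

Record vdc := Vdc {
  vid : forall F, varr F F;
  vcomp : forall F G H, varr G H -> varr F G -> varr F H;
  vcompA : forall F G H K (h : varr H K) (g : varr G H) (f : varr F G),
    vcomp h (vcomp g f) = vcomp (vcomp h g) f;
  vcomp1f : forall F G (f : varr F G), vcomp (vid G) f = f;
  vcompf1 : forall F G (f : varr F G), vcomp f (vid F) = f;
  vidc : forall F G (M : vpro F G),
    vcell (pcons M (pnil G)) M (vid F) (vid G);
  vcompc : forall F F' G G' H H' (s : path vpro F F') (t : path vpro G G')
      (P : vpro H H') (f : varr F G) (f' : varr F' G')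
      (g : varr G H) (g' : varr G' H'),
    cells s t f f' -> vcell t P g g' -> vcell s P (vcomp g f) (vcomp g' f')
}.

Section Laws.
Variable W : vdc.

Fixpoint id_cells F G (s : path vpro F G) : cells s s (vid W F) (vid W G) :=
  match s in path _ F G return cells s s (vid W F) (vid W G) with
  | pnil F => cnil (vid W F)
  | pcons _ _ _ M s' => ccons erefl (vidc W M) (id_cells s')
  end.

(* [cells2 s t u f f' g g']: a sequence of pairs, each made of a multicell and
   of a sequence of multicells onto its source. *)
Inductive cells2 : forall F F' G G' H H' : vob V,
    path vpro F F' -> path vpro G G' -> path vpro H H' ->
    varr F G -> varr F' G' -> varr G H -> varr G' H' -> Type :=
| c2nil F G H (f : varr F G) (g : varr G H) :
    cells2 (pnil F) (pnil G) (pnil H) f f g g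
| c2cons F F' F'' G G' G'' H H' H''
    (s : path vpro F F') (s' : path vpro F' F'')
    (t : path vpro G G') (t' : path vpro G' G'')
    (N : vpro H H') (u : path vpro H' H'')
    (f : varr F G) (f' : varr F' G') (f'' : varr F'' G'')
    (g : varr G H) (g' : varr G' H') (g'' : varr G'' H'') :
    cells s t f f' -> vcell t N g g' -> cells2 s' t' u f' f'' g' g'' ->
    cells2 (papp s s') (papp t t') (pcons N u) f f'' g g''.

Fixpoint inner_cells F F' G G' H H' (s : path vpro F F') (t : path vpro G G')
    (u : path vpro H H') (f : varr F G) (f' : varr F' G')
    (g : varr G H) (g' : varr G' H') (c : cells2 s t u f f' g g') :
    cells s t f f' :=
  match c with
  | c2nil _ _ _ f _ => cnil f
  | c2cons _ _ _ _ _ _ _ _ _ _ _ _ _ _ _ _ _ _ _ _ _ c1 n c2 =>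
      cells_app c1 (inner_cells c2)
  end.

Fixpoint outer_cells F F' G G' H H' (s : path vpro F F') (t : path vpro G G')
    (u : path vpro H H') (f : varr F G) (f' : varr F' G')
    (g : varr G H) (g' : varr G' H') (c : cells2 s t u f f' g g') :
    cells t u g g' :=
  match c with
  | c2nil _ _ _ _ g => cnil g
  | c2cons _ _ _ _ _ _ _ _ _ _ _ _ _ _ _ _ _ _ _ _ _ c1 n c2 =>
      ccons erefl n (outer_cells c2)
  end.

Fixpoint comp_cells F F' G G' H H' (s : path vpro F F') (t : path vpro G G')
    (u : path vpro H H') (f : varr F G) (f' : varr F' G')
    (g : varr G H) (g' : varr G' H') (c : cells2 s t u f f' g g') :
    cells s u (vcomp W g f) (vcomp W g' f') :=
  match c with
  | c2nil _ _ _ f g => cnil (vcomp W g f)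
  | c2cons _ _ _ _ _ _ _ _ _ _ _ _ _ _ _ _ _ _ _ _ _ c1 n c2 =>
      ccons erefl (vcompc W c1 n) (comp_cells c2)
  end.

Record is_vdc : Prop := IsVdc {
  vcompc_idl : forall F F' G G' (s : path vpro F F') (N : vpro G G')
      (f : varr F G) (f' : varr F' G') (m : vcell s N f f'),
    vceq (vcompc W (ccons (papp_nil s) m (cnil f')) (vidc W N)) m;
  vcompc_idr : forall F F' G G' (s : path vpro F F') (N : vpro G G')
      (f : varr F G) (f' : varr F' G') (m : vcell s N f f'),
    vceq (vcompc W (id_cells s) m) m;
  vcompc_assoc : forall F F' G G' H H' K K'
      (s : path vpro F F') (t : path vpro G G') (u : path vpro H H') (P : vpro K K')
      (f : varr F G) (f' : varr F' G') (g : varr G H) (g' : varr G' H')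
      (h : varr H K) (h' : varr H' K')
      (c : cells2 s t u f f' g g') (p : vcell u P h h'),
    vceq (vcompc W (inner_cells c) (vcompc W (outer_cells c) p))
         (vcompc W (comp_cells c) p)
}.

Definition insert_nullary F G H (s1 : path vpro F G) (s2 : path vpro G H)
    (U : vpro G G) (eta : vcell (pnil G) U (vid W G) (vid W G)) :
    cells (papp s1 s2) (papp s1 (pcons U s2)) (vid W F) (vid W H) :=
  cells_app (id_cells s1)
    (ccons (erefl : papp (pnil G) s2 = s2) eta (id_cells s2)).

Definition has_units : Prop :=
  forall G, exists (U : vpro G G) (eta : vcell (pnil G) U (vid W G) (vid W G)),
    forall F H K L (s1 : path vpro F G) (s2 : path vpro G H) (N : vpro K L)
      (f : varr F K) (g : varr H L),
    bijective (fun m : vcell (papp s1 (pcons U s2)) N f g =>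
                 vcompc W (insert_nullary s1 s2 eta) m).

End Laws.
End VirtualDoubleCategories.

Arguments cnil {V F G} f.
Arguments vceq {V F F' G G' s N f f'} m {g g'} n : rename.

Inductive map_kind := Strict | Pseudo | Lax | Oplax.

Section Models.
Variables (D E : dbl) (PD : lax_finite_products D) (PE : lax_finite_products E).

Record model := Model {
  model_functor :> lax_data D E;
  model_lax : is_lax_functor model_functor;
  model_preserves : preserves_products PD PE model_functor
}.

Record fp_module (F G : model) := FPModule {
  fp_module_module :> module F G;
  fp_module_preserves : module_preserves PD PE fp_module_module
}.

Definition model_map (k : map_kind) (F G : model) : Type :=
  match k with
  | Strict => {a : lax_trans F G | is_strict_trans a}
  | Pseudo => {a : lax_trans F G | is_pseudo_trans a /\ lax_trans_preserves PD a}
  | Lax => {a : lax_trans F G | lax_trans_preserves PD a}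
  | Oplax => {a : oplax_trans F G | oplax_trans_preserves PD a}
  end.

Definition map_trans (k : map_kind) (F G : model) : model_map k F G -> pretrans F G :=
  match k with
  | Strict => fun a => sval a
  | Pseudo => fun a => sval a
  | Lax => fun a => sval a
  | Oplax => fun a => sval a
  end.

Local Notation mpath := (path fp_module).

(* A path of proarrows of D of the same shape as a path of modules. *)
Inductive tpath : forall F G : model, mpath F G -> ob D -> ob D -> Type :=
| tnil (F : model) (x : ob D) : tpath (pnil F) x x
| tcons (F G H : model) (M : fp_module F G) (s : mpath G H) (x y z : ob D)
    (m : pro x y) : tpath s y z -> tpath (pcons M s) x z.
Arguments tcons {F G H} M {s x y z} m t.

(* m_1 ⊙ ... ⊙ m_k and M_1 m_1 ⊙ ... ⊙ M_k m_k, bracketed to the right and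
   ending in an external identity. *)
Fixpoint tcomp F G (s : mpath F G) x y (t : tpath s x y) : pro x y :=
  match t with
  | tnil _ x => idp x
  | tcons _ _ _ _ _ _ _ _ m t' => m ⊙ tcomp t'
  end.

Fixpoint tsrc F G (s : mpath F G) x y (t : tpath s x y) : pro (F x) (G y) :=
  match t in @tpath F G s x y return pro (F x) (G y) with
  | tnil F x => idp (F x)
  | tcons _ _ _ M _ _ _ _ m t' => mpro M m ⊙ tsrc t'
  end.

Inductive tcells : forall (F G : model) (s : mpath F G) (x y x' y' : ob D),
    tpath s x y -> tpath s x' y' -> arr x x' -> arr y y' -> Type :=
| tcnil (F : model) (x x' : ob D) (f : arr x x') :
    tcells (tnil F x) (tnil F x') f f
| tccons (F G H : model) (M : fp_module F G) (s : mpath G H)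
    (x y z x' y' z' : ob D) (m : pro x y) (n : pro x' y')
    (t : tpath s y z) (t' : tpath s y' z')
    (f : arr x x') (g : arr y y') (h : arr z z') :
    cell m n f g -> tcells t t' g h -> tcells (tcons M m t) (tcons M n t') f h.

Fixpoint tcells_comp F G (s : mpath F G) x y x' y' (t : tpath s x y)
    (t' : tpath s x' y') (f : arr x x') (g : arr y y') (c : tcells t t' f g) :
    cell (tcomp t) (tcomp t') f g :=
  match c with
  | tcnil _ _ _ f => idpc f
  | tccons _ _ _ _ _ _ _ _ _ _ _ _ _ _ _ _ _ _ a c' => a ⊛ tcells_comp c'
  end.

Fixpoint tcells_src F G (s : mpath F G) x y x' y' (t : tpath s x y)
    (t' : tpath s x' y') (f : arr x x') (g : arr y y') (c : tcells t t' f g) :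
    cell (tsrc t) (tsrc t') (larr F f) (larr G g) :=
  match c in @tcells F G s x y x' y' t t' f g
    return cell (tsrc t) (tsrc t') (larr F f) (larr G g) with
  | tcnil F _ _ f => idpc (larr F f)
  | tccons _ _ _ M _ _ _ _ _ _ _ _ _ _ _ _ _ _ a c' => mcell M a ⊛ tcells_src c'
  end.

(* A nonempty path together with a proarrow p composable with its last
   proarrow m_k. *)
Inductive tlast (y z : ob D) (p : pro y z) :
    forall F G : model, mpath F G -> ob D -> Type :=
| tl_here (F G : model) (M : fp_module F G) (x : ob D) (m : pro x y) :
    tlast p (pcons M (pnil G)) x
| tl_there (F G H : model) (M : fp_module F G) (s : mpath G H) (x x' : ob D)
    (m : pro x x') : tlast p s x' -> tlast p (pcons M s) x.

Section TLast.
Variables (y z : ob D) (p : pro y z).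

Fixpoint tl_path F G (s : mpath F G) x (t : tlast p s x) : tpath s x y :=
  match t with
  | tl_here _ G M _ m => tcons M m (tnil G y)
  | tl_there _ _ _ M _ _ _ m t' => tcons M m (tl_path t')
  end.

(* The path with m_k ⊙ p in place of m_k. *)
Fixpoint tl_absorb F G (s : mpath F G) x (t : tlast p s x) : tpath s x z :=
  match t with
  | tl_here _ G M _ m => tcons M (m ⊙ p) (tnil G z)
  | tl_there _ _ _ M _ _ _ m t' => tcons M m (tl_absorb t')
  end.

(* (M_1 m_1 ⊙ ... ⊙ M_k m_k) ⊙ F_k p -> M_1 m_1 ⊙ ... ⊙ M_k (m_k ⊙ p),
   acting at the end. *)
Fixpoint tl_act F G (s : mpath F G) x (t : tlast p s x) :
    cell (tsrc (tl_path t) ⊙ lpro G p) (tsrc (tl_absorb t)) (ida (F x)) (ida (G z)) :=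
  match t in @tlast _ _ _ F G s x return
    cell (tsrc (tl_path t) ⊙ lpro G p) (tsrc (tl_absorb t)) (ida (F x)) (ida (G z))
  with
  | tl_here _ G M _ m =>
      gcomp (runV (mpro M (m ⊙ p)))
        (gcomp (actr M m p) (run (mpro M m) ⊛ idc (lpro G p)))
  | tl_there _ H _ M _ _ _ m t' =>
      gcomp (idc (mpro M m) ⊛ tl_act t') (assoc (mpro M m) (tsrc (tl_path t')) _)
  end.

(* The coherence cell (m_1 ⊙ ... ⊙ m_k) ⊙ p -> m_1 ⊙ ... ⊙ (m_k ⊙ p). *)
Fixpoint tl_coh F G (s : mpath F G) x (t : tlast p s x) :
    cell (tcomp (tl_path t) ⊙ p) (tcomp (tl_absorb t)) (ida x) (ida z) :=
  match t in @tlast _ _ _ F G s x return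
    cell (tcomp (tl_path t) ⊙ p) (tcomp (tl_absorb t)) (ida x) (ida z)
  with
  | tl_here _ _ _ _ m => gcomp (runV (m ⊙ p)) (run m ⊛ idc p)
  | tl_there _ _ _ _ _ _ _ m t' =>
      gcomp (idc m ⊛ tl_coh t') (assoc m (tcomp (tl_path t')) p)
  end.

End TLast.

(* A path of length at least 2 together with a proarrow p composable between
   two adjacent proarrows m_i and m_{i+1}. *)
Inductive tmid : forall F G : model, mpath F G -> ob D -> ob D -> Type :=
| tm_here (F G H K : model) (M : fp_module F G) (N : fp_module G H) (s : mpath H K)
    (x y z w v : ob D) (m : pro x y) (p : pro y z) (n : pro z w) :
    tpath s w v -> tmid (pcons M (pcons N s)) x v
| tm_there (F G H : model) (M : fp_module F G) (s : mpath G H) (x y z : ob D)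
    (m : pro x y) : tmid s y z -> tmid (pcons M s) x z.

(* The paths with m_i ⊙ p in place of m_i, and with p ⊙ m_{i+1} in place of
   m_{i+1}. *)
Fixpoint tm_left F G (s : mpath F G) x y (t : tmid s x y) : tpath s x y :=
  match t with
  | tm_here _ _ _ _ M N _ _ _ _ _ _ m p n t' => tcons M (m ⊙ p) (tcons N n t')
  | tm_there _ _ _ M _ _ _ _ m t' => tcons M m (tm_left t')
  end.

Fixpoint tm_right F G (s : mpath F G) x y (t : tmid s x y) : tpath s x y :=
  match t with
  | tm_here _ _ _ _ M N _ _ _ _ _ _ m p n t' => tcons M m (tcons N (p ⊙ n) t')
  | tm_there _ _ _ M _ _ _ _ m t' => tcons M m (tm_right t')
  end.

(* M_1 m_1 ⊙ ... ⊙ M_i m_i ⊙ F_i p ⊙ M_{i+1} m_{i+1} ⊙ ... *)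
Fixpoint tm_src F G (s : mpath F G) x y (t : tmid s x y) : pro (F x) (G y) :=
  match t in @tmid F G s x y return pro (F x) (G y) with
  | tm_here _ G _ _ M N _ _ _ _ _ _ m p n t' =>
      mpro M m ⊙ (lpro G p ⊙ (mpro N n ⊙ tsrc t'))
  | tm_there _ _ _ M _ _ _ _ m t' => mpro M m ⊙ tm_src t'
  end.

Fixpoint tm_actr F G (s : mpath F G) x y (t : tmid s x y) :
    cell (tm_src t) (tsrc (tm_left t)) (ida (F x)) (ida (G y)) :=
  match t in @tmid F G s x y return
    cell (tm_src t) (tsrc (tm_left t)) (ida (F x)) (ida (G y))
  with
  | tm_here _ G _ _ M N _ _ _ _ _ _ m p n t' =>
      gcomp (actr M m p ⊛ idc (mpro N n ⊙ tsrc t'))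
        (assocV (mpro M m) (lpro G p) (mpro N n ⊙ tsrc t'))
  | tm_there _ _ _ M _ _ _ _ m t' => idc (mpro M m) ⊛ tm_actr t'
  end.

Fixpoint tm_actl F G (s : mpath F G) x y (t : tmid s x y) :
    cell (tm_src t) (tsrc (tm_right t)) (ida (F x)) (ida (G y)) :=
  match t in @tmid F G s x y return
    cell (tm_src t) (tsrc (tm_right t)) (ida (F x)) (ida (G y))
  with
  | tm_here _ G _ _ M N _ _ _ _ _ _ m p n t' =>
      idc (mpro M m) ⊛
        gcomp (actl N p n ⊛ idc (tsrc t')) (assocV (lpro G p) (mpro N n) (tsrc t'))
  | tm_there _ _ _ M _ _ _ _ m t' => idc (mpro M m) ⊛ tm_actl t'
  end.

(* The coherence cell
   ... ⊙ (m_i ⊙ p) ⊙ m_{i+1} ⊙ ... -> ... ⊙ m_i ⊙ (p ⊙ m_{i+1}) ⊙ ... *)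
Fixpoint tm_coh F G (s : mpath F G) x y (t : tmid s x y) :
    cell (tcomp (tm_left t)) (tcomp (tm_right t)) (ida x) (ida y) :=
  match t in @tmid F G s x y return
    cell (tcomp (tm_left t)) (tcomp (tm_right t)) (ida x) (ida y)
  with
  | tm_here _ _ _ _ _ _ _ _ _ _ _ _ m p n t' =>
      gcomp (idc m ⊛ assocV p n (tcomp t')) (assoc m p (n ⊙ tcomp t'))
  | tm_there _ _ _ _ _ _ _ _ m t' => idc m ⊛ tm_coh t'
  end.

Section Multimodulations.
Variables (F F' G G' : model) (s : mpath F F') (N : fp_module G G').

Definition components (a : pretrans F G) (b : pretrans F' G') : Type :=
  forall (x y : ob D) (t : tpath s x y),
    cell (tsrc t) (mpro N (tcomp t)) (tob a x) (tob b y).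

Definition lax_naturality (a : lax_trans F G) (b : lax_trans F' G')
    (mu : components a b) : Prop :=
  forall (x y x' y' : ob D) (t : tpath s x y) (t' : tpath s x' y')
    (f : arr x x') (g : arr y y') (c : tcells t t' f g),
  mcell N (run (tcomp t')) • (actr N (tcomp t') (idp y') •
      (((mcell N (tcells_comp c) • mu x y t) ⊛ lt_cmp b g) • runV (tsrc t)))
    ≡ mcell N (lun (tcomp t')) • (actl N (idp x') (tcomp t') •
      ((lt_cmp a f ⊛ (mu x' y' t' • tcells_src c)) • lunV (tsrc t))).

Definition oplax_naturality (a : oplax_trans F G) (b : oplax_trans F' G')
    (mu : components a b) : Prop :=
  forall (x y x' y' : ob D) (t : tpath s x y) (t' : tpath s x' y')
    (f : arr x x') (g : arr y y') (c : tcells t t' f g),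
  mcell N (lun (tcomp t')) • (actl N (idp x') (tcomp t') •
      ((ot_cmp a f ⊛ (mcell N (tcells_comp c) • mu x y t)) • lunV (tsrc t)))
    ≡ mcell N (run (tcomp t')) • (actr N (tcomp t') (idp y') •
      (((mu x' y' t' • tcells_src c) ⊛ ot_cmp b g) • runV (tsrc t))).

Definition naturality (k : map_kind) :
    forall (a : model_map k F G) (b : model_map k F' G'),
      components (map_trans a) (map_trans b) -> Prop :=
  match k return forall (a : model_map k F G) (b : model_map k F' G'),
      components (map_trans a) (map_trans b) -> Prop with
  | Strict => fun a b mu => lax_naturality (a := sval a) (b := sval b) mu
  | Pseudo => fun a b mu => lax_naturality (a := sval a) (b := sval b) mu
  | Lax => fun a b mu => lax_naturality (a := sval a) (b := sval b) mu
  | Oplax => fun a b mu => oplax_naturality (a := sval a) (b := sval b) mu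
  end.

End Multimodulations.

Definition left_equivariance (F F1 F' G G' : model) (M : fp_module F F1)
    (s : mpath F1 F') (N : fp_module G G') (a : pretrans F G) (b : pretrans F' G')
    (mu : components (pcons M s) N a b) : Prop :=
  forall (w x y z : ob D) (p : pro w x) (m : pro x y) (t : tpath s y z),
    mcell N (assoc p m (tcomp t)) • (mu w z (tcons M (p ⊙ m) t) •
        ((actl M p m ⊛ idc (tsrc t)) • assocV (lpro F p) (mpro M m) (tsrc t)))
      ≡ actl N p (m ⊙ tcomp t) • (tpro a p ⊛ mu x z (tcons M m t)).

Definition right_equivariance (F F' G G' : model) (s : mpath F F')
    (N : fp_module G G') (a : pretrans F G) (b : pretrans F' G')
    (mu : components s N a b) : Prop :=
  forall (x y z : ob D) (p : pro y z) (t : tlast p s x),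
    mu x z (tl_absorb t) • tl_act t
      ≡ mcell N (tl_coh t) • (actr N (tcomp (tl_path t)) p •
          (mu x y (tl_path t) ⊛ tpro b p)).

Definition inner_equivariance (F F' G G' : model) (s : mpath F F')
    (N : fp_module G G') (a : pretrans F G) (b : pretrans F' G')
    (mu : components s N a b) : Prop :=
  forall (x y : ob D) (t : tmid s x y),
    mcell N (tm_coh t) • (mu x y (tm_left t) • tm_actr t)
      ≡ mu x y (tm_right t) • tm_actl t.

Definition nullary_equivariance (F G G' : model) (N : fp_module G G')
    (a : pretrans F G) (b : pretrans F G')
    (mu : components (pnil F) N a b) : Prop :=
  forall (x y : ob D) (p : pro x y),
    mcell N (run p) • (actl N p (idp y) •
        ((tpro a p ⊛ mu y y (tnil F y)) • runV (lpro F p)))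
      ≡ mcell N (lun p) • (actr N (idp x) p •
        ((mu x x (tnil F x) ⊛ tpro b p) • lunV (lpro F p))).

Definition end_equivariance (F F' G G' : model) (s : mpath F F')
    (N : fp_module G G') :
    forall (a : pretrans F G) (b : pretrans F' G'), components s N a b -> Prop :=
  match s in path _ F F' return
    forall (a : pretrans F G) (b : pretrans F' G'), components s N a b -> Prop
  with
  | pnil F => fun a b mu => nullary_equivariance mu
  | pcons _ _ _ M s' => fun a b mu => left_equivariance mu
  end.

Record multimodulation (k : map_kind) (F F' G G' : model) (s : mpath F F')
    (N : fp_module G G') (a : model_map k F G) (b : model_map k F' G') :=
  Multimodulation {
    mm_cell : components s N (map_trans a) (map_trans b);
    mm_natural : naturality mm_cell;
    mm_end : end_equivariance mm_cell;
    mm_right : right_equivariance mm_cell;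
    mm_inner : inner_equivariance mm_cell
  }.

Definition model_graph (k : map_kind) : vgraph := {|
  vob := model; varr := model_map k; vpro := fp_module;
  vcell := @multimodulation k
|}.

(* (βα)_f for lax transformations α : F => G and β : G => H, up to
   associativity of the sides. *)
Definition is_lax_comp (F G H : lax_data D E) (b : lax_trans G H)
    (a : lax_trans F G) (c : lax_trans F H) : Prop :=
  [/\ forall x, tob c x = tob b x ∘ tob a x,
      forall (x y : ob D) (m : pro x y), tpro c m ≡ tpro b m • tpro a m
    & forall (x y : ob D) (f : arr x y),
        lt_cmp c f ≡ paste (esym (compaA _ _ _))
          (lt_cmp b f • idpc (tob a x)) (tpro b (idp y) • lt_cmp a f)].

Definition is_oplax_comp (F G H : lax_data D E) (b : oplax_trans G H)
    (a : oplax_trans F G) (c : oplax_trans F H) : Prop :=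
  [/\ forall x, tob c x = tob b x ∘ tob a x,
      forall (x y : ob D) (m : pro x y), tpro c m ≡ tpro b m • tpro a m
    & forall (x y : ob D) (f : arr x y),
        ot_cmp c f ≡ paste (compaA _ _ _)
          (tpro b (idp y) • ot_cmp a f) (ot_cmp b f • idpc (tob a x))].

Definition is_map_comp (k : map_kind) (F G H : model) :
    model_map k G H -> model_map k F G -> model_map k F H -> Prop :=
  match k return model_map k G H -> model_map k F G -> model_map k F H -> Prop with
  | Strict => fun b a c => is_lax_comp (sval b) (sval a) (sval c)
  | Pseudo => fun b a c => is_lax_comp (sval b) (sval a) (sval c)
  | Lax => fun b a c => is_lax_comp (sval b) (sval a) (sval c)
  | Oplax => fun b a c => is_oplax_comp (sval b) (sval a) (sval c)
  end.

Fixpoint tapp F G H (s1 : mpath F G) (s2 : mpath G H) x y z (t1 : tpath s1 x y) :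
    tpath s2 y z -> tpath (papp s1 s2) x z :=
  match t1 in @tpath F G s1 x y return
    forall s2 : mpath G H, tpath s2 y z -> tpath (papp s1 s2) x z
  with
  | tnil _ _ => fun _ t2 => t2
  | tcons _ _ _ M _ _ _ _ m t1' => fun _ t2 => tcons M m (tapp t1' t2)
  end s2.

(* m_1 ⊙ ... ⊙ m_k -> (m_1 ⊙ ... ⊙ m_j) ⊙ (m_{j+1} ⊙ ... ⊙ m_k) *)
Fixpoint tapp_coh F G H (s1 : mpath F G) (s2 : mpath G H) x y z
    (t1 : tpath s1 x y) : forall t2 : tpath s2 y z,
    cell (tcomp (tapp t1 t2)) (tcomp t1 ⊙ tcomp t2) (ida x) (ida z) :=
  match t1 in @tpath F G s1 x y return
    forall (s2 : mpath G H) (t2 : tpath s2 y z),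
    cell (tcomp (tapp t1 t2)) (tcomp t1 ⊙ tcomp t2) (ida x) (ida z)
  with
  | tnil _ _ => fun _ t2 => lunV (tcomp t2)
  | tcons _ _ _ _ _ _ _ _ m t1' => fun _ t2 =>
      gcomp (assocV m (tcomp t1') (tcomp t2)) (idc m ⊛ tapp_coh t1' t2)
  end s2.

Fixpoint tapp_src F G H (s1 : mpath F G) (s2 : mpath G H) x y z
    (t1 : tpath s1 x y) : forall t2 : tpath s2 y z,
    cell (tsrc (tapp t1 t2)) (tsrc t1 ⊙ tsrc t2) (ida (F x)) (ida (H z)) :=
  match t1 in @tpath F G s1 x y return
    forall (s2 : mpath G H) (t2 : tpath s2 y z),
    cell (tsrc (tapp t1 t2)) (tsrc t1 ⊙ tsrc t2) (ida (F x)) (ida (H z))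
  with
  | tnil _ _ => fun _ t2 => lunV (tsrc t2)
  | tcons _ _ _ M _ _ _ _ m t1' => fun _ t2 =>
      gcomp (assocV (mpro M m) (tsrc t1') (tsrc t2)) (idc (mpro M m) ⊛ tapp_src t1' t2)
  end s2.

Section Pasting.
Variable k : map_kind.
Local Notation V := (model_graph k).

(* For multimodulations μ_1, ..., μ_l in a row, a path of proarrows of D that
   is cut into blocks, one for each μ_i. *)
Inductive blocks : forall (F F' G G' : vob V) (s : path vpro F F')
    (t : path vpro G G') (a : varr F G) (a' : varr F' G'),
    cells s t a a' -> ob D -> ob D -> Type :=
| bnil (F G : vob V) (a : varr F G) (x : ob D) : blocks (cnil a) x x
| bcons (F F' F'' G G' G'' : vob V) (s1 : path vpro F F') (s2 : path vpro F' F'')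
    (s : path vpro F F'') (e : papp s1 s2 = s) (N : vpro G G') (t : path vpro G' G'')
    (a : varr F G) (a' : varr F' G') (a'' : varr F'' G'')
    (mu : vcell s1 N a a') (c : cells s2 t a' a'') (x y z : ob D)
    (t1 : tpath s1 x y) : blocks c y z -> blocks (ccons e mu c) x z.

Definition tcast (F G : model) (s s' : mpath F G) (e : s = s') x y
    (t : tpath s x y) : tpath s' x y :=
  match e in _ = s' return tpath s' x y with erefl => t end.

Fixpoint bpath (F F' G G' : vob V) (s : path vpro F F') (t : path vpro G G')
    (a : varr F G) (a' : varr F' G') (c : cells s t a a') x y (b : blocks c x y) :
    tpath s x y :=
  match b in @blocks F F' _ _ s _ _ _ _ x y return @tpath F F' s x y with
  | bnil F _ _ x => tnil F x
  | bcons _ _ _ _ _ _ _ _ _ e _ _ _ _ _ _ _ _ _ _ t1 b' => tcast e (tapp t1 (bpath b'))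
  end.

Fixpoint bcomps (F F' G G' : vob V) (s : path vpro F F') (t : path vpro G G')
    (a : varr F G) (a' : varr F' G') (c : cells s t a a') x y (b : blocks c x y) :
    tpath t x y :=
  match b in @blocks _ _ G G' _ t _ _ _ x y return @tpath G G' t x y with
  | bnil _ G _ x => tnil G x
  | bcons _ _ _ _ _ _ _ _ _ _ N _ _ _ _ _ _ _ _ _ t1 b' =>
      @tcons _ _ _ N _ _ _ _ (tcomp t1) (bcomps b')
  end.

Fixpoint bcoh (F F' G G' : vob V) (s : path vpro F F') (t : path vpro G G')
    (a : varr F G) (a' : varr F' G') (c : cells s t a a') x y (b : blocks c x y) :
    cell (tcomp (bpath b)) (tcomp (bcomps b)) (ida x) (ida y) :=
  match b in blocks _ x y return
    cell (tcomp (bpath b)) (tcomp (bcomps b)) (ida x) (ida y)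
  with
  | bnil _ _ _ x => idc (idp x)
  | bcons _ _ _ _ _ _ _ _ _ e _ _ _ _ _ _ _ x _ z t1 b' =>
      match e in _ = s' return
        cell (tcomp (tcast e (tapp t1 (bpath b'))))
          (tcomp t1 ⊙ tcomp (bcomps b')) (ida x) (ida z)
      with
      | erefl => gcomp (idc (tcomp t1) ⊛ bcoh b') (tapp_coh t1 (bpath b'))
      end
  end.

(* The external composite of the components of the μ_i at their blocks. *)
Fixpoint bcell (F F' G G' : vob V) (s : path vpro F F') (t : path vpro G G')
    (a : varr F G) (a' : varr F' G') (c : cells s t a a') x y (b : blocks c x y) :
    cell (tsrc (bpath b)) (tsrc (bcomps b)) (tob (map_trans a) x) (tob (map_trans a') y) :=
  match b in @blocks _ _ _ _ _ _ a a' _ x y return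
    cell (tsrc (bpath b)) (tsrc (bcomps b)) (tob (map_trans a) x) (tob (map_trans a') y)
  with
  | bnil _ _ a x => idpc (tob (map_trans a) x)
  | bcons _ _ _ _ _ _ _ _ _ e N _ a _ a'' mu _ x _ z t1 b' =>
      match e in _ = s' return
        cell (tsrc (tcast e (tapp t1 (bpath b'))))
          (mpro N (tcomp t1) ⊙ tsrc (bcomps b'))
          (tob (map_trans a) x) (tob (map_trans a'') z)
      with
      | erefl => preglob (mm_cell mu t1 ⊛ bcell b') (tapp_src t1 (bpath b'))
      end
  end.

Definition standard_composition (W : vdc V) : Prop :=
  (forall (F G H : model) (b : model_map k G H) (a : model_map k F G),
     is_map_comp b a (vcomp W b a)) /\
  (forall (F F' G G' H H' : vob V) (s : path vpro F F') (t : path vpro G G')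
      (P : vpro H H') (a : varr F G) (a' : varr F' G')
      (b : varr G H) (b' : varr G' H')
      (c : cells s t a a') (nu : vcell t P b b') (x y : ob D) (q : blocks c x y),
     mcell (P : fp_module H H') (bcoh q) • mm_cell (vcompc W c nu) (bpath q)
       ≡ mm_cell nu (bcomps q) • bcell q).

End Pasting.
End Models.

Record span (X Y : SET) := Span_ {
  apex : SET;
  legl : apex -> X;
  legr : apex -> Y
}.
Arguments legl {X Y} s a : rename.
Arguments legr {X Y} s a : rename.

Record span_cell (X Y X' Y' : SET) (m : span X Y) (n : span X' Y')
    (f : X -> X') (g : Y -> Y') := SpanCell {
  sc_fun :> apex m -> apex n;
  sc_l : forall a, legl n (sc_fun a) = f (legl m a);
  sc_r : forall a, legr n (sc_fun a) = g (legr m a)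
}.

Definition span_idc X Y (m : span X Y) : span_cell m m id id :=
  @SpanCell _ _ _ _ m m id id id (fun=> erefl) (fun=> erefl).

Definition span_compc X Y X' Y' X'' Y''
    (m : span X Y) (n : span X' Y') (p : span X'' Y'')
    (f : X -> X') (g : Y -> Y') (f' : X' -> X'') (g' : Y' -> Y'')
    (b : span_cell n p f' g') (a : span_cell m n f g) :
    span_cell m p (fun x => f' (f x)) (fun y => g' (g y)) :=
  @SpanCell _ _ _ _ m p (fun x => f' (f x)) (fun y => g' (g y)) (fun s => b (a s))
    (fun s => etrans (sc_l b (a s)) (congr1 f' (sc_l a s)))
    (fun s => etrans (sc_r b (a s)) (congr1 g' (sc_r a s))).

Definition span_idp (X : SET) : span X X := @Span_ X X X id id.

Definition span_compp X Y Z (m : span X Y) (n : span Y Z) : span X Z :=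
  @Span_ X Z {s : apex m * apex n | legr m s.1 = legl n s.2}
    (fun s => legl m (sval s).1) (fun s => legr n (sval s).2).

Definition span_idpc X Y (f : X -> Y) : span_cell (span_idp X) (span_idp Y) f f :=
  @SpanCell _ _ _ _ (span_idp X) (span_idp Y) f f f (fun=> erefl) (fun=> erefl).

Definition span_hcomp X Y Z X' Y' Z'
    (m : span X Y) (n : span Y Z) (m' : span X' Y') (n' : span Y' Z')
    (f : X -> X') (g : Y -> Y') (h : Z -> Z')
    (a : span_cell m m' f g) (b : span_cell n n' g h) :
    span_cell (span_compp m n) (span_compp m' n') f h :=
  @SpanCell _ _ _ _ (span_compp m n) (span_compp m' n') f h
    (fun s => exist (fun s => legr m' s.1 = legl n' s.2) (a (sval s).1, b (sval s).2)
       (etrans (sc_r a _) (etrans (congr1 g (proj2_sig s)) (esym (sc_l b _)))))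
    (fun s => sc_l a _) (fun s => sc_r b _).

Section SpanCoherence.
Variables (X Y Z W : SET) (m : span X Y) (n : span Y Z) (p : span Z W).
Local Notation mn := (span_compp m n).
Local Notation np := (span_compp n p).

Definition span_assoc : span_cell (span_compp mn p) (span_compp m np) id id :=
  @SpanCell _ _ _ _ (span_compp mn p) (span_compp m np) id id
    (fun s : apex (span_compp mn p) =>
       exist (fun s => legr m s.1 = legl np s.2)
         ((sval (sval s).1).1,
          exist (fun s => legr n s.1 = legl p s.2)
            ((sval (sval s).1).2, (sval s).2) (proj2_sig s))
         (proj2_sig (sval s).1))
    (fun=> erefl) (fun=> erefl).

Definition span_assocV : span_cell (span_compp m np) (span_compp mn p) id id :=
  @SpanCell _ _ _ _ (span_compp m np) (span_compp mn p) id id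
    (fun s : apex (span_compp m np) =>
       exist (fun s => legr mn s.1 = legl p s.2)
         (exist (fun s => legr m s.1 = legl n s.2)
            ((sval s).1, (sval (sval s).2).1) (proj2_sig s),
          (sval (sval s).2).2)
         (proj2_sig (sval s).2))
    (fun=> erefl) (fun=> erefl).

Definition span_lun : span_cell (span_compp (span_idp X) m) m id id :=
  @SpanCell _ _ _ _ (span_compp (span_idp X) m) m id id
    (fun s => (sval s).2) (fun s => esym (proj2_sig s)) (fun=> erefl).

Definition span_lunV : span_cell m (span_compp (span_idp X) m) id id :=
  @SpanCell _ _ _ _ m (span_compp (span_idp X) m) id id
    (fun s => exist (fun s : X * apex m => s.1 = legl m s.2) (legl m s, s) erefl)
    (fun=> erefl) (fun=> erefl).

Definition span_run : span_cell (span_compp m (span_idp Y)) m id id :=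
  @SpanCell _ _ _ _ (span_compp m (span_idp Y)) m id id
    (fun s => (sval s).1) (fun=> erefl) (fun s => proj2_sig s).

Definition span_runV : span_cell m (span_compp m (span_idp Y)) id id :=
  @SpanCell _ _ _ _ m (span_compp m (span_idp Y)) id id
    (fun s => exist (fun s : apex m * Y => legr m s.1 = s.2) (s, legr m s) erefl)
    (fun=> erefl) (fun=> erefl).

End SpanCoherence.

Definition Span : dbl := {|
  ob := SET; arr := fun X Y => X -> Y; pro := span; cell := span_cell;
  ida := fun X x => x; compa := fun X Y Z g f x => g (f x);
  compaA := fun X Y Z W h g f => erefl;
  comp1a := fun X Y f => erefl; compa1 := fun X Y f => erefl;
  idc := span_idc; compc := span_compc;
  idp := span_idp; compp := span_compp; idpc := span_idpc; hcomp := span_hcomp;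
  assoc := span_assoc; assocV := span_assocV;
  lun := span_lun; lunV := span_lunV; run := span_run; runV := span_runV
|}.

Lemma span_ceq (X Y X' Y' : ob Span) (m : pro X Y) (n : pro X' Y')
    (f f' : arr X X') (g g' : arr Y Y') (a : cell m n f g) (b : cell m n f' g') :
  f = f' -> g = g' -> (forall s, (a : span_cell _ _ _ _) s = (b : span_cell _ _ _ _) s) ->
  a ≡ b.
Proof.
move=> ef eg; case: _ / ef b => b; case: _ / eg b => b.
case: a b => a al ar [b bl br] /= /functional_extensionality e.
case: _ / e bl br => bl br.
by rewrite (proof_irrelevance _ bl al) (proof_irrelevance _ br ar).
Qed.

Lemma span_eq (X Y X' Y' : ob Span) (m : pro X Y) (n : pro X' Y')
    (f : arr X X') (g : arr Y Y') (a b : cell m n f g) :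
  (forall s, (a : span_cell _ _ _ _) s = (b : span_cell _ _ _ _) s) -> a = b.
Proof.
case: a b => a al ar [b bl br] /= /functional_extensionality e.
case: _ / e bl br => bl br.
by rewrite (proof_irrelevance _ bl al) (proof_irrelevance _ br ar).
Qed.

Lemma sig_eq (A : Type) (P : A -> Prop) (s t : {a | P a}) : sval s = sval t -> s = t.
Proof.
by case: s t => [a p] [b q] /= e; case: _ / e q => q; rewrite (proof_irrelevance _ p q).
Qed.

Lemma Span_is_double_category : is_double_category Span.
Proof.
split.
- by move=> *; apply: span_ceq.
- by move=> *; apply: span_ceq.
- by move=> *; apply: span_ceq.
- by move=> *; apply: span_eq.
- by move=> *; apply: span_eq.
- by move=> *; apply: span_eq => s; apply: sig_eq.
- by move=> *; apply: span_eq => -[[s t] e]; apply: sig_eq.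
- by move=> *; apply: span_ceq => // -[[[[s t] e] u] e']; do !apply: sig_eq => /=; congr (_, _); apply: sig_eq.
- by move=> *; apply: span_ceq => // -[[s [[t u] e]] e']; apply: sig_eq => /=; congr (_, _); apply: sig_eq.
- by move=> *; apply: span_ceq => // -[[s t] e]; apply: sig_eq => /=; congr (_, _); exact: esym e.
- by move=> *; apply: span_ceq.
- by move=> *; apply: span_ceq => // -[[s t] e]; apply: sig_eq => /=; congr (_, _); exact: e.
- by move=> *; apply: span_ceq.
- by move=> *; apply: span_ceq => // s; apply: sig_eq => /=; congr (_, _); apply: sig_eq.
- by move=> *; apply: span_ceq.
- by move=> *; apply: span_ceq.
- by move=> *; apply: span_ceq => // s; apply: sig_eq => /=; congr (_, _); apply: sig_eq => /=; congr (_, _); apply: sig_eq.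
- by move=> *; apply: span_ceq => // s; apply: sig_eq.
Qed.

Record span_prod_apex (X Y : fam Span) (M : fam_pro X Y) : SET := SpanProdApex {
  sp_l : forall i, X i;
  sp_r : forall j, Y j;
  sp_e : forall i j (a : fp_idx M i j), apex (fp_pro M a);
  sp_el : forall i j (a : fp_idx M i j), legl (fp_pro M a) (sp_e a) = sp_l i;
  sp_er : forall i j (a : fp_idx M i j), legr (fp_pro M a) (sp_e a) = sp_r j
}.
Arguments sp_l {X Y M} s i.
Arguments sp_r {X Y M} s j.
Arguments sp_e {X Y M} s {i j} a.
Arguments sp_el {X Y M} s {i j} a.
Arguments sp_er {X Y M} s {i j} a.

Lemma span_prod_apex_eq X Y (M : fam_pro X Y) (s t : span_prod_apex M) :
  sp_l s = sp_l t -> sp_r s = sp_r t ->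
  (forall i j (a : fp_idx M i j), sp_e s a = sp_e t a) -> s = t.
Proof.
case: s t => l r e el er [l' r' e' el' er'] /= El Er.
case: _ / El el' => el'; case: _ / Er er' => er' Ee.
have {}Ee : e = e' by do 3!apply: functional_extensionality_dep => ?; apply: Ee.
case: _ / Ee el' er' => el' er'.
by rewrite (proof_irrelevance _ el' el) (proof_irrelevance _ er' er).
Qed.

Definition span_prod_ob (X : fam Span) : SET := forall i, X i.

Definition span_prod_pro (X Y : fam Span) (M : fam_pro X Y) :
    span (span_prod_ob X) (span_prod_ob Y) :=
  Span_ (@sp_l X Y M) (@sp_r X Y M).

Definition span_prod_arr (X Y : fam Span) (f : fam_arr X Y) :
    span_prod_ob X -> span_prod_ob Y := fun u j => fa_arr f j (u (fa_idx f j)).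

Definition span_prod_cell (X Y X' Y' : fam Span) (M : fam_pro X Y) (N : fam_pro X' Y')
    (f : fam_arr X X') (g : fam_arr Y Y') (c : fam_cell M N f g) :
    span_cell (span_prod_pro M) (span_prod_pro N) (span_prod_arr f) (span_prod_arr g) :=
  @SpanCell _ _ _ _ (span_prod_pro M) (span_prod_pro N) _ _
    (fun s : span_prod_apex M =>
       @SpanProdApex X' Y' N (span_prod_arr f (sp_l s)) (span_prod_arr g (sp_r s))
         (fun i j b => sc_fun (fc_cell c b) (sp_e s (fc_idx c b)))
         (fun i j b => etrans (sc_l (fc_cell c b) _) (congr1 _ (sp_el s _)))
         (fun i j b => etrans (sc_r (fc_cell c b) _) (congr1 _ (sp_er s _))))
    (fun=> erefl) (fun=> erefl).

Definition span_prod_laxator (X Y Z : fam Span) (M : fam_pro X Y) (N : fam_pro Y Z) :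
    span_cell (span_compp (span_prod_pro M) (span_prod_pro N))
      (span_prod_pro (fam_compp M N)) id id :=
  @SpanCell _ _ _ _ (span_compp (span_prod_pro M) (span_prod_pro N))
    (span_prod_pro (fam_compp M N)) id id
    (fun s : apex (span_compp (span_prod_pro M) (span_prod_pro N)) =>
       @SpanProdApex X Z (fam_compp M N) (sp_l (sval s).1) (sp_r (sval s).2)
         (fun i k (t : fp_idx (fam_compp M N) i k) =>
            exist (fun r => legr (fp_pro M (tagged t).1) r.1 =
                            legl (fp_pro N (tagged t).2) r.2)
              (sp_e (sval s).1 (tagged t).1, sp_e (sval s).2 (tagged t).2)
              (etrans (sp_er _ _)
                 (etrans (congr1 (fun u => u (tag t)) (proj2_sig s)) (esym (sp_el _ _)))))
         (fun i k t => sp_el _ _) (fun i k t => sp_er _ _))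
    (fun=> erefl) (fun=> erefl).

Definition eq_idp_elt (I : Type) (X : I -> ob Span) (x : forall i, X i) (i i' : I)
    (e : i = i') : apex (eq_idp X e) :=
  match e with erefl => x i end.

Lemma eq_idp_eltl I (X : I -> ob Span) (x : forall i, X i) i i' (e : i = i') :
  legl (eq_idp X e) (eq_idp_elt x e) = x i.
Proof. by case: _ / e. Qed.

Lemma eq_idp_eltr I (X : I -> ob Span) (x : forall i, X i) i i' (e : i = i') :
  legr (eq_idp X e) (eq_idp_elt x e) = x i'.
Proof. by case: _ / e. Qed.

Definition span_prod_unitor (X : fam Span) :
    span_cell (span_idp (span_prod_ob X)) (span_prod_pro (fam_idp X)) id id :=
  @SpanCell _ _ _ _ (span_idp (span_prod_ob X)) (span_prod_pro (fam_idp X)) id id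
    (fun x : span_prod_ob X =>
       @SpanProdApex X X (fam_idp X) x x
         (fun i i' (t : fp_idx (fam_idp X) i i') => eq_idp_elt x (eqP (proj2_sig t)))
         (fun i i' t => eq_idp_eltl x _) (fun i i' t => eq_idp_eltr x _))
    (fun=> erefl) (fun=> erefl).

Definition Span_prod : lax_data (FinFam Span) Span :=
  @LaxData (FinFam Span) Span span_prod_ob span_prod_arr span_prod_pro span_prod_cell
    span_prod_laxator span_prod_unitor (fun=> erefl) (fun _ _ _ _ _ => erefl).

Lemma eq_idpc_elt (I J : eqType) (X : I -> ob Span) (Y : J -> ob Span) (f0 : J -> I)
    (f : forall j, arr (X (f0 j)) (Y j)) (k l : J) (e : k = l) (e' : f0 k = f0 l)
    (x : forall i, X i) :
  eq_idp_elt (fun j => f j (x (f0 j))) e =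
  (eq_idpc f e e' : span_cell _ _ _ _) (eq_idp_elt x e').
Proof.
by case: l / e e' => e'; rewrite /eq_idpc; case: _ / (eq_irrelevance _ e').
Qed.

Lemma Span_prod_lax : is_lax_functor Span_prod.
Proof.
split.
- by move=> *; apply: span_ceq => // s; apply: span_prod_apex_eq.
- by move=> *; apply: span_ceq => // s; apply: span_prod_apex_eq.
- move=> *; apply: span_ceq => // s; apply: span_prod_apex_eq => // i j t.
  exact: sig_eq.
- move=> X Y f; apply: span_ceq => // x; apply: span_prod_apex_eq => // k l [t b].
  exact: (eq_idpc_elt (X := X) (Y := Y)).
- move=> *; apply: span_ceq => // s; apply: span_prod_apex_eq => // i j t.
  by apply: sig_eq => /=; congr (_, _); apply: sig_eq.
- move=> X Y M; apply: span_ceq => // -[[x s] e]; apply: span_prod_apex_eq => //.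
  move=> i j a /=; by case: _ / (eq_irrelevance _ _).
- move=> X Y M; apply: span_ceq => // -[[s x] e]; apply: span_prod_apex_eq => //.
  move=> i j a /=; by case: _ / (eq_irrelevance _ _).
Qed.

Local Notation inj_pair2 := ProofIrrelevanceTheory.EqdepTheory.inj_pair2.

(* Equality of components of cells of families, whose sources may be different
   members of one family. *)
Inductive fceq (D : dbl) (X Y : fam D) (M : fam_pro X Y) (x y : ob D) (n : pro x y)
    (i : fidx X) (j : fidx Y) (a : fp_idx M i j) (f : arr (X i) x) (g : arr (Y j) y)
    (c : cell (fp_pro M a) n f g) :
    forall i' j' (a' : fp_idx M i' j') (f' : arr (X i') x) (g' : arr (Y j') y),
      cell (fp_pro M a') n f' g' -> Prop :=
  fceq_refl : fceq c c.

Lemma fceq_inv (D : dbl) (X Y : fam D) (M : fam_pro X Y) (x y : ob D) (n : pro x y)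
    (i : fidx X) (j : fidx Y) (a a' : fp_idx M i j) (f : arr (X i) x) (g : arr (Y j) y)
    (c : cell (fp_pro M a) n f g) (c' : cell (fp_pro M a') n f g) :
  fceq c c' ->
  existT (fun a => cell (fp_pro M a) n f g) a c = existT _ a' c'.
Proof.
pose T := {i & {j & {a : fp_idx M i j & {f : arr (X i) x & {g : arr (Y j) y &
            cell (fp_pro M a) n f g}}}}}.
pose pack i j (a : fp_idx M i j) f g (c : cell (fp_pro M a) n f g) : T :=
  existT _ i (existT _ j (existT _ a (existT _ f (existT _ g c)))).
have packE i' j' (a1 : fp_idx M i' j') f1 g1 (c1 : cell (fp_pro M a1) n f1 g1) :
  fceq c c1 -> pack _ _ _ _ _ c = pack _ _ _ _ _ c1 by case.
move=> h; have e := inj_pair2 _ _ _ _ _ (inj_pair2 _ _ _ _ _ (packE _ _ _ _ _ _ h)).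
have ea : a = a' by exact: (congr1 (@projT1 _ _) e).
case: _ / ea c' h e => c' _ e.
by rewrite (inj_pair2 _ _ _ _ _ (inj_pair2 _ _ _ _ _ (inj_pair2 _ _ _ _ _ e))).
Qed.

Lemma fam_ceq (D : dbl) (X Y X' Y' : ob (FinFam D)) (M : pro X Y) (N : pro X' Y')
    (f f' : arr X X') (g g' : arr Y Y') (a : cell M N f g) (b : cell M N f' g') :
  f = f' -> g = g' ->
  (forall k l (t : fp_idx N k l),
     fceq (fc_cell (a : fam_cell _ _ _ _) t) (fc_cell (b : fam_cell _ _ _ _) t)) ->
  a ≡ b.
Proof.
move=> ef eg; case: _ / ef b => b; case: _ / eg b => b h.
have {}h k l (t : fp_idx N k l) := fceq_inv (h k l t).
suff -> : a = b by [].
case: a b h => a0 a1 [b0 b1] /= h.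
have e : a0 = b0.
  do 3!apply: functional_extensionality_dep => ?.
  exact: (congr1 (@projT1 _ _) (h _ _ _)).
case: _ / e b1 h => b1 h; congr FamCell.
do 3!apply: functional_extensionality_dep => ?.
exact: inj_pair2 (h _ _ _).
Qed.

Lemma ceq_fceq (D : dbl) (X Y : fam D) (M : fam_pro X Y) (x y : ob D) (n : pro x y)
    (i : fidx X) (j : fidx Y) (a : fp_idx M i j)
    (f f' : arr (X i) x) (g g' : arr (Y j) y)
    (c : cell (fp_pro M a) n f g) (c' : cell (fp_pro M a) n f' g') :
  c ≡ c' -> fceq c c'.
Proof. by case. Qed.

Definition span_unit_cell (X Y : SET) (m : span X Y) :
    span_cell m (span_prod_pro (sing_pro (D := Span) m : fam_pro _ _))
      (fun x _ => x) (fun y _ => y) :=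
  @SpanCell _ _ _ _ m (span_prod_pro (sing_pro (D := Span) m)) (fun x _ => x) (fun y _ => y)
    (fun s : apex m =>
       @SpanProdApex (sing_ob (D := Span) X) (sing_ob (D := Span) Y) (sing_pro (D := Span) m)
         (fun=> legl m s) (fun=> legr m s) (fun _ _ _ => s)
         (fun _ _ _ => erefl) (fun _ _ _ => erefl))
    (fun=> erefl) (fun=> erefl).

Definition Span_unit_pre : pretrans (lax_id Span) (lax_comp Span_prod (Sing Span)).
Proof.
exists (fun (X : SET) (x : X) _ => x) (fun X Y (m : span X Y) => span_unit_cell m).
- move=> X Y Z m n; apply: span_ceq => // s; apply: span_prod_apex_eq => //= i k [].
  by apply: sig_eq; case: s => -[].
- move=> X; apply: span_ceq => // x; apply: span_prod_apex_eq => //= i j [] /=.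
  rewrite /eq_idp_const; by move: (eqP _) => e; case: _ / e.
Defined.

Definition Span_unit : nat_trans (lax_id Span) (lax_comp Span_prod (Sing Span)).
Proof.
exists Span_unit_pre.
- by [].
- move=> X Y X' Y' m n f g c; apply: span_ceq => // s; apply: span_prod_apex_eq => //.
  + by apply: functional_extensionality => u; apply: esym (sc_l (c : span_cell _ _ _ _) s).
  + by apply: functional_extensionality => u; apply: esym (sc_r (c : span_cell _ _ _ _) s).
Defined.

Definition span_counit_arr (X : fam Span) : fam_arr (sing_ob (span_prod_ob X : ob Span)) X :=
  @FamArr Span (sing_ob (span_prod_ob X : ob Span)) X (fun=> tt) (fun i x => x i).

Definition span_counit_cell (X Y : fam Span) (M : fam_pro X Y) :
    fam_cell (sing_pro (span_prod_pro M : @pro Span _ _)) M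
      (span_counit_arr X) (span_counit_arr Y) :=
  @FamCell Span _ _ X Y (sing_pro (span_prod_pro M : @pro Span _ _)) M
    (span_counit_arr X) (span_counit_arr Y) (fun _ _ _ => tt)
    (fun i j a => @SpanCell _ _ _ _ (span_prod_pro M) (fp_pro M a)
       (fun x => x i) (fun y => y j) (fun s : span_prod_apex M => sp_e s a)
       (fun s => sp_el s a) (fun s => sp_er s a)).

Definition Span_counit_pre : pretrans (lax_comp (Sing Span) Span_prod) (lax_id (FinFam Span)).
Proof.
exists span_counit_arr span_counit_cell.
- move=> X Y Z M N.
  apply: (ceq_trans (compc_ceq (ceq_refl _) (recast_ceq _ _ _))).
  apply: (ceq_trans (compc_ceq (ceq_refl _) (compc_ceq (recast_ceq _ _ _) (ceq_refl _)))).
  apply: fam_ceq => // i k t; apply: ceq_fceq; apply: span_ceq => // s.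
- move=> X.
  apply: (ceq_trans (compc_ceq (ceq_refl _) (recast_ceq _ _ _))).
  apply: (ceq_trans (compc_ceq (ceq_refl _) (compc_ceq (recast_ceq _ _ _) (ceq_refl _)))).
  apply: fam_ceq => // i k [[] t] /=.
  move: (fam_idpc_idx _ t) => e'; rewrite (proof_irrelevance _ e' isT).
  apply: ceq_fceq; apply: span_ceq => //= s.
  move: (@eqP _ tt tt isT) s => e0; move: (eqP t) => {e' t} e; case: k / e => s.
  rewrite /eq_idpc; case: _ / (eq_irrelevance _ e0) s => s //.
Defined.

Definition Span_counit : nat_trans (lax_comp (Sing Span) Span_prod) (lax_id (FinFam Span)).
Proof.
exists Span_counit_pre.
- by [].
- move=> *; apply: fam_ceq => // k l t; exact: fceq_refl.
Defined.

Lemma span_triangle (X : SET) :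
  fam_compa (span_counit_arr (sing_ob (X : ob Span)))
    (sing_arr ((fun x _ => x) : @arr Span X (span_prod_ob (sing_ob (X : ob Span)))))
  = fam_ida (sing_ob (X : ob Span)).
Proof.
have e : (fun=> tt) = (fun u : unit => u) by apply: functional_extensionality; case.
exact: (congr1 (fun u0 => @FamArr Span (sing_ob (X : ob Span)) (sing_ob (X : ob Span)) u0
                            (fun _ x => x)) e).
Qed.

Definition Span_prod_adj : adjunction (Sing Span) Span_prod.
Proof.
exists Span_unit Span_counit.
- exact: span_triangle.
- move=> X Y m; apply: fam_ceq => [||k l []]; [exact: span_triangle..|].
  by case: k l => -[]; apply: ceq_fceq; apply: span_ceq.
- by [].
- by move=> X Y M; apply: span_ceq => // s; apply: span_prod_apex_eq.
Defined.

Definition Span_finite_products : lax_finite_products Span :=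
  LaxFiniteProducts Span_prod_lax Span_prod_adj.

Record fp_double_theory := FPDoubleTheory {
  th_dbl :> dbl;
  th_double : is_double_category th_dbl;
  th_strict : is_strict th_dbl;
  th_small : is_small th_dbl;
  th_products : strong_finite_products th_dbl
}.

Definition models (T : fp_double_theory) (k : map_kind) : vgraph :=
  model_graph (th_products T) Span_finite_products k.

(* Main.v *)
Require Import Defs.
From mathcomp Require Import all_boot.
From Stdlib Require Import FunctionalExtensionality ProofIrrelevance.
From Stdlib Require Import Relation_Operators.

Set Implicit Arguments.
Unset Strict Implicit.
Unset Printing Implicit Defensive.
Local Open Scope dbl_scope.
Local Notation inj_pair2 := ProofIrrelevanceTheory.EqdepTheory.inj_pair2.
Local Notation lft := (legl _).
Local Notation rgt := (legr _).

(** A lax functor [F] from a strict double category [D] to spans amounts to a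
    double category of elements: its objects are the points of the sets [F x],
    its proarrows are the elements of the spans [F m], composed by the
    laxators.  Since [D] is strict and composites of spans consist of matching
    pairs, this composition is strictly associative and unital.  In the same
    way a module from [F] to [G] is a family of heteromorphisms, on which the
    elements of [F] and of [G] act from the two sides by strict laws, and the
    cells of [D] act vertically.  On elements all coherence cells disappear:
    those of [D] are equality cells, which do not move an element that is
    packed together with its proarrow ([mcell_eqcell]), and those of [Span] only
    rebracket pairs.

    A multimodulation from [M_1, ..., M_k] to [N] is then a function on
    composable sequences of heteromorphisms that does not change when an
    element of an intermediate model is moved from one factor to the next.  Its
    equivariance laws have special forms at the two ends and for [k = 0].  They
    become uniform on chains [a_0 m_1 a_1 ... m_k a_k], where elements [a_i] of
    the models are interposed; the chains for [k = 0] are the elements of one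
    model.  A multimodulation is the same as a function on chains that is
    invariant under sliding and equivariant at both ends ([cmod], [of_mm],
    [to_mm], [to_mmK]).

    A sequence of multimodulations acts on chains ([cells_map]): cut the chain
    into blocks and replace every block by its value.  An element at a cut may
    go to either side, but this changes the result only by a slide.
    Composition of multimodulations is composition of functions, and the unit
    and associativity laws reduce to cutting a chain repeatedly
    ([models_idl], [models_idr], [cells_map_comp]).  Naturality of a composite
    holds because the comparison elements of the maps on the two sides can be
    slid through the chain, one block at a time ([commx_cons]).  Lax and oplax
    comparisons are elements in opposite directions, and a boolean
    orientation treats both at once; strict and pseudo maps are lax maps with
    a property that is stable under composition, and so is preservation of
    products, which says that the comparisons at projections are identities
    ([strict_at_comp]).

    The unit at a model [G] is [G] itself as a module, which preserves products
    because [G] does.  A chain with an additional entry in this module can be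
    shortened by multiplying that entry with its neighbours, and a chain can be
    lengthened by an identity.  The two constructions are inverse up to slides
    ([collapse_insert], [insert_collapse]), which multimodulations do not see;
    this is the universal property of the unit. *)

(** * Strict double categories *)

Lemma ceq_eq (D : dbl) (x y x' y' : ob D) (m : pro x y) (n : pro x' y')
    (f : arr x x') (g : arr y y') (a b : cell m n f g) : a ≡ b -> a = b.
Proof.
pose pack f g (c : cell m n f g) :
  {f : arr x x' & {g : arr y y' & cell m n f g}} := existT _ f (existT _ g c).
have packE f' g' (c : cell m n f' g') : a ≡ c -> pack _ _ a = pack _ _ c by case.
by move/packE => e; apply: (inj_pair2 _ _ _ _ _ (inj_pair2 _ _ _ _ _ e)).
Qed.

Record strict_dbl := StrictDbl {
  sdc :> dbl;
  sdc_double : is_double_category sdc;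
  sdc_strict : is_strict sdc
}.

Section Strict.
Variable D : strict_dbl.
Local Notation HD := (sdc_double D).
Local Notation SD := (sdc_strict D).

(** The form of every coherence cell of a strict double category.  The equation
    between its ends need not hold by computation. *)
Definition is_eqcell (x y : ob D) (m n : pro x y) (a : cell m n (ida x) (ida y)) :=
  exists e : m = n, a = eqcell e.

Lemma is_eqcell_idc (x y : ob D) (m : pro x y) : is_eqcell (idc m).
Proof. by exists (erefl m). Qed.

Lemma is_eqcell_gcomp (x y : ob D) (m n p : pro x y)
    (b : cell n p (ida x) (ida y)) (a : cell m n (ida x) (ida y)) :
  is_eqcell b -> is_eqcell a -> is_eqcell (gcomp b a).
Proof.
case=> e' -> [e ->]; case: _ / e'; case: _ / e; exists erefl.
by apply: ceq_eq; apply: (ceq_trans (recast_ceq _ _ _)); apply: (comp1c HD).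
Qed.

Lemma is_eqcell_hcomp (x y z : ob D) (m m' : pro x y) (n n' : pro y z)
    (a : cell m m' (ida x) (ida y)) (b : cell n n' (ida y) (ida z)) :
  is_eqcell a -> is_eqcell b -> is_eqcell (a ⊛ b).
Proof.
case=> e -> [e' ->]; case: _ / e; case: _ / e'; exists erefl; exact: (hcomp_id HD).
Qed.

(** The inverse associators and unitors are separate data, tied to the
    associators and unitors only by the cancellation laws. *)
Lemma is_eqcell_inverse (x y : ob D) (m n : pro x y)
    (a : cell m n (ida x) (ida y)) (b : cell n m (ida x) (ida y)) :
  is_eqcell a -> b • a ≡ idc m -> is_eqcell b.
Proof.
case=> e ->; case: _ / e b => b h; exists erefl; apply: ceq_eq.
exact: ceq_trans (ceq_sym (compc1 HD b)) h.
Qed.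

Lemma is_eqcell_assoc (x y z w : ob D) (m : pro x y) (n : pro y z) (p : pro z w) :
  is_eqcell (assoc m n p).
Proof. by case: SD => h _ _; apply: h. Qed.

Lemma is_eqcell_lun (x y : ob D) (m : pro x y) : is_eqcell (lun m).
Proof. by case: SD => _ h _; apply: h. Qed.

Lemma is_eqcell_run (x y : ob D) (m : pro x y) : is_eqcell (run m).
Proof. by case: SD => _ _ h; apply: h. Qed.

Lemma is_eqcell_assocV (x y z w : ob D) (m : pro x y) (n : pro y z) (p : pro z w) :
  is_eqcell (assocV m n p).
Proof. exact: is_eqcell_inverse (is_eqcell_assoc m n p) (assocK HD m n p). Qed.

Lemma is_eqcell_lunV (x y : ob D) (m : pro x y) : is_eqcell (lunV m).
Proof. exact: is_eqcell_inverse (is_eqcell_lun m) (lunK HD m). Qed.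

Lemma is_eqcell_runV (x y : ob D) (m : pro x y) : is_eqcell (runV m).
Proof. exact: is_eqcell_inverse (is_eqcell_run m) (runK HD m). Qed.

Lemma comppA (x y z w : ob D) (m : pro x y) (n : pro y z) (p : pro z w) :
  (m ⊙ n) ⊙ p = m ⊙ (n ⊙ p).
Proof. by case: (is_eqcell_assoc m n p). Qed.

Lemma comp1p (x y : ob D) (m : pro x y) : idp x ⊙ m = m.
Proof. by case: (is_eqcell_lun m). Qed.

(** With its source and target proarrows packed in, a cell can be compared to one
    whose proarrows agree only up to an equation, so that external composition
    satisfies its laws on the nose ([hpasteA], [hpaste1l]). *)
Record hcell (x y x' y' : ob D) (f : arr x x') (g : arr y y') := HCell {
  hsrc : pro x y;
  htgt : pro x' y';
  hbody : cell hsrc htgt f g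
}.

Definition hpaste (x y z x' y' z' : ob D) (f : arr x x') (g : arr y y') (h : arr z z')
    (A : hcell f g) (B : hcell g h) : hcell f h := HCell (hbody A ⊛ hbody B).

(** Naturality with respect to equality cells says that two cells differ by a
    transport only. *)
Lemma hc_eq (x y x' y' : ob D) (f : arr x x') (g : arr y y')
    (m m1 : pro x y) (n n1 : pro x' y') (a : cell m n f g) (b : cell m1 n1 f g)
    (u : cell n n1 (ida x') (ida y')) (v : cell m m1 (ida x) (ida y)) :
  is_eqcell u -> is_eqcell v -> u • a ≡ b • v -> HCell a = HCell b.
Proof.
case=> e' -> [e ->]; case: _ / e b => b; case: _ / e' b => b /= h.
have -> // : a = b.
apply: ceq_eq; apply: ceq_trans (ceq_sym (comp1c HD a)) _.
exact: ceq_trans h (compc1 HD b).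
Qed.

Lemma hpasteA (x y z w x' y' z' w' : ob D) (f : arr x x') (g : arr y y')
    (h : arr z z') (k : arr w w') (A : hcell f g) (B : hcell g h) (C : hcell h k) :
  hpaste (hpaste A B) C = hpaste A (hpaste B C).
Proof.
exact: hc_eq (is_eqcell_assoc _ _ _) (is_eqcell_assoc _ _ _)
  (assoc_nat HD (hbody A) (hbody B) (hbody C)).
Qed.

Lemma hpaste1l (x y x' y' : ob D) (f : arr x x') (g : arr y y') (A : hcell f g) :
  hpaste (HCell (idpc f)) A = A.
Proof.
case: A => m n a.
exact: hc_eq (is_eqcell_lun _) (is_eqcell_lun _) (lun_nat HD a).
Qed.

End Strict.

(** * Cells of spans as functions *)


Definition ap (X Y X' Y' : ob Span) (m : pro X Y) (n : pro X' Y')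
    (f : arr X X') (g : arr Y Y') (c : cell m n f g) : apex m -> apex n :=
  sc_fun (c : span_cell m n f g).

Definition pr (X Y Z : ob Span) (m : pro X Y) (n : pro Y Z) (s : apex m) (t : apex n)
    (h : rgt s = lft t) : apex (m ⊙ n : pro X Z) :=
  exist (fun s : apex m * apex n => rgt s.1 = lft s.2) (s, t) h.

Lemma ap_legl (X Y X' Y' : ob Span) (m : pro X Y) (n : pro X' Y')
    (f : arr X X') (g : arr Y Y') (c : cell m n f g) s :
  lft (ap c s) = f (lft s).
Proof. exact: (sc_l (c : span_cell _ _ _ _)). Qed.

Lemma ap_legr (X Y X' Y' : ob Span) (m : pro X Y) (n : pro X' Y')
    (f : arr X X') (g : arr Y Y') (c : cell m n f g) s :
  rgt (ap c s) = g (rgt s).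
Proof. exact: (sc_r (c : span_cell _ _ _ _)). Qed.

Lemma ap_ceq (X Y X' Y' : ob Span) (m : pro X Y) (n : pro X' Y')
    (f f' : arr X X') (g g' : arr Y Y') (a : cell m n f g) (b : cell m n f' g') :
  a ≡ b -> forall s, ap a s = ap b s.
Proof. by case. Qed.

Lemma ap_recast (X Y X' Y' : ob Span) (m : pro X Y) (n : pro X' Y')
    (f f' : arr X X') (g g' : arr Y Y') (ef : f = f') (eg : g = g')
    (a : cell m n f g) s : ap (recast ef eg a) s = ap a s.
Proof. by case: _ / ef; case: _ / eg. Qed.

Lemma ap_ceqP (X Y X' Y' : ob Span) (m : pro X Y) (n : pro X' Y')
    (f f' : arr X X') (g g' : arr Y Y') (a : cell m n f g) (b : cell m n f' g') :
  f = f' -> g = g' -> (forall s, ap a s = ap b s) -> a ≡ b.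
Proof. exact: span_ceq. Qed.

Lemma ap_gcomp (X Y : ob Span) (m n p : pro X Y)
    (b : cell n p (ida X) (ida Y)) (a : cell m n (ida X) (ida Y)) s :
  ap (gcomp b a) s = ap b (ap a s).
Proof. by rewrite /gcomp ap_recast. Qed.

(** * Elements of models and of modules *)

Section Elements.
Variable D : strict_dbl.
Variables (PD : lax_finite_products D) (PE : lax_finite_products Span).
Local Notation model := (model PD PE).

Section UnitModule.
Variable F : model.

Let HF := model_lax F.

Definition unit_module : module F F :=
  @Module (sdc D) Span F F (fun x y m => lpro F m) (fun _ _ _ _ _ _ _ _ c => lcell F c)
    (fun _ _ _ m n => laxator F m n) (fun _ _ _ m n => laxator F m n)
    (lcell_id HF) (lcell_comp HF) (laxator_nat HF) (laxator_nat HF)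
    (laxator_assoc HF) (laxator_assoc HF) (laxator_assoc HF)
    (laxator_lun HF) (laxator_run HF).

(** The unit proarrow at [F].  Its elements are the proarrows of the double
    category of elements of [F]. *)
Definition hom : fp_module F F :=
  @FPModule _ _ _ _ F F unit_module (model_preserves F).2.

End UnitModule.

(** An object of the double category of elements.  By eta for primitive
    projections, a map of points that keeps [po] fixed leaves the type of the
    proarrow of an element unchanged up to conversion. *)
#[projections(primitive)] Record pt (F : model) := Pt { po : ob D; pe : (F po : SET) }.
Arguments Pt {F} po pe.

Section El.
Variables (F G : model) (M : fp_module F G).

(** A heteromorphism from [u] to [v].  The proarrow is a field and not an index,
    so that composites in different bracketings are equal and not merely
    isomorphic. *)
#[projections(primitive)] Record el (u : pt F) (v : pt G) := El {
  em : pro (po u) (po v);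
  es : apex (mpro M em);
  el_l : lft es = pe u;
  el_r : rgt es = pe v
}.

(** Elements whose end points are equal but not convertible are compared through
    this pair, which determines the end points ([tot_legs]). *)
Definition tot (u : pt F) (v : pt G) (e : el u v) :
    {m : pro (po u) (po v) & apex (mpro M m)} := existT _ (em e) (es e).

Lemma el_eq u v (e e' : el u v) : tot e = tot e' -> e = e'.
Proof.
case: e e' => m s l r [m' s' l' r'] /= h.
rewrite /tot /= in h; have e : m = m' := congr1 (@projT1 _ _) h.
case: _ / e s' l' r' h => s' l' r' h.
have e : s = s' by exact: inj_pair2 h.
case: _ / e l' r' {h} => l' r'.
by rewrite (proof_irrelevance _ l' l) (proof_irrelevance _ r' r).
Qed.

Lemma es_eq (x : ob D) (y : ob D) (m : pro x y) (s s' : apex (mpro M m)) :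
  existT (fun m => apex (mpro M m)) m s = existT _ m s' -> s = s'.
Proof. exact: inj_pair2. Qed.

End El.
Arguments El {F G} M {u v} em es el_l el_r.

Lemma em_comp (F G H : model) (M : fp_module F G) (N : fp_module G H) u v w
  (a : el M u v) (b : el N v w) : rgt (es a) = lft (es b).
Proof. exact: etrans (el_r a) (esym (el_l b)). Qed.

Definition lact (F G : model) (M : fp_module F G) (u v : pt F) (w : pt G)
    (a : el (hom F) u v) (e : el M v w) : el M u w :=
  @El F G M u w (em a ⊙ em e) (ap (actl M (em a) (em e)) (pr (em_comp a e)))
    (etrans (ap_legl _ _) (el_l a)) (etrans (ap_legr _ _) (el_r e)).

Definition ract (F G : model) (M : fp_module F G) (u : pt F) (v w : pt G)
    (e : el M u v) (a : el (hom G) v w) : el M u w :=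
  @El F G M u w (em e ⊙ em a) (ap (actr M (em e) (em a)) (pr (em_comp e a)))
    (etrans (ap_legl _ _) (el_l e)) (etrans (ap_legr _ _) (el_r a)).

Definition uid (F : model) (u : pt F) : el (hom F) u u :=
  @El F F (hom F) u u (idp (po u)) (ap (unitor F (po u)) (pe u))
    (ap_legl (unitor F (po u)) _) (ap_legr (unitor F (po u)) _).

Definition hmul (F : model) (u v w : pt F) (a : el (hom F) u v) (b : el (hom F) v w) :
    el (hom F) u w := lact a b.

Lemma ract_hom (F : model) (u v w : pt F) (a : el (hom F) u v) (b : el (hom F) v w) :
  ract a b = hmul a b.
Proof. by []. Qed.

Section Triv.
Variables (F G : model) (M : fp_module F G).

(** Coherence cells of [D] are invisible on elements packed with their proarrow.
    Every law below is freed from them by rewriting with this lemma. *)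
Lemma mcell_eqcell (x y : ob D) (m n : pro x y) (c : cell m n (ida x) (ida y)) s :
  is_eqcell c ->
  existT (fun m => apex (mpro M m)) n (ap (mcell M c) s) = existT _ m s.
Proof. by case=> e ->; case: _ / e => /=; rewrite (ap_ceq (mcell_id M m)). Qed.

End Triv.

(** The associator of [D] is an equality cell and that of [Span] rebrackets pairs;
    what remains of the associativity of the action is a plain equation. *)
Lemma lact_hmul (F G : model) (M : fp_module F G) u v w z
    (a : el (hom F) u v) (b : el (hom F) v w) (e : el M w z) :
  lact (hmul a b) e = lact a (lact b e).
Proof.
apply: el_eq; rewrite -[LHS](mcell_eqcell _ (is_eqcell_assoc (em a) (em b) (em e))).
congr existT.
have h : rgt (pr (em_comp a b)) = lft (es e) by exact: em_comp.
have := ap_ceq (actl_assoc M (em a) (em b) (em e)) (pr h).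
move=> /= E; etransitivity; last etransitivity; [|exact: E|].
- congr (ap _ (ap _ _)); exact: sig_eq.
- congr (ap _ _); apply: sig_eq => /=; congr (_, _); congr (ap _ _); exact: sig_eq.
Qed.

Lemma lact_ract (F G : model) (M : fp_module F G) u v w z
    (a : el (hom F) u v) (e : el M v w) (b : el (hom G) w z) :
  ract (lact a e) b = lact a (ract e b).
Proof.
apply: el_eq; rewrite -[LHS](mcell_eqcell _ (is_eqcell_assoc (em a) (em e) (em b))).
congr existT.
have h : rgt (pr (em_comp a e)) = lft (es b) by exact: em_comp.
have := ap_ceq (actlr_assoc M (em a) (em e) (em b)) (pr h).
move=> /= E; etransitivity; last etransitivity; [|exact: E|].
- congr (ap _ (ap _ _)); exact: sig_eq.
- congr (ap _ _); apply: sig_eq => /=; congr (_, _); congr (ap _ _); exact: sig_eq.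
Qed.

Lemma ract_hmul (F G : model) (M : fp_module F G) u v w z
    (e : el M u v) (a : el (hom G) v w) (b : el (hom G) w z) :
  ract (ract e a) b = ract e (hmul a b).
Proof.
apply: el_eq; rewrite -[LHS](mcell_eqcell _ (is_eqcell_assoc (em e) (em a) (em b))).
congr existT.
have h : rgt (pr (em_comp e a)) = lft (es b) by exact: em_comp.
have := ap_ceq (actr_assoc M (em e) (em a) (em b)) (pr h).
move=> /= E; etransitivity; last etransitivity; [|exact: E|].
- congr (ap _ (ap _ _)); exact: sig_eq.
- congr (ap _ _); apply: sig_eq => /=; congr (_, _); congr (ap _ _); exact: sig_eq.
Qed.

Lemma lact1 (F G : model) (M : fp_module F G) u v (e : el M u v) : lact (uid u) e = e.
Proof.
apply: el_eq; rewrite -[LHS](mcell_eqcell _ (is_eqcell_lun (em e))).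
congr existT.
have h : rgt (pe u : apex (idp (F (po u)))) = lft (es e) by exact: (esym (el_l e)).
have := ap_ceq (actl_unit M (em e)) (pr h).
move=> /= E; etransitivity; last etransitivity; [|exact: E|by []].
congr (ap _ (ap _ _)); exact: sig_eq.
Qed.

Lemma ract1 (F G : model) (M : fp_module F G) u v (e : el M u v) : ract e (uid v) = e.
Proof.
apply: el_eq; rewrite -[LHS](mcell_eqcell _ (is_eqcell_run (em e))).
congr existT.
have h : rgt (es e) = lft (pe v : apex (idp (G (po v)))) by exact: (el_r e).
have := ap_ceq (actr_unit M (em e)) (pr h).
move=> /= E; etransitivity; last etransitivity; [|exact: E|by []].
congr (ap _ (ap _ _)); exact: sig_eq.
Qed.

Lemma hmulA (F : model) (u v w z : pt F) (a : el (hom F) u v) (b : el (hom F) v w)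
    (c : el (hom F) w z) : hmul (hmul a b) c = hmul a (hmul b c).
Proof. exact: lact_hmul. Qed.

Lemma hmul1l (F : model) (u v : pt F) (a : el (hom F) u v) : hmul (uid u) a = a.
Proof. exact: lact1. Qed.

Lemma hmul1r (F : model) (u v : pt F) (a : el (hom F) u v) : hmul a (uid v) = a.
Proof. exact: (ract1 a). Qed.

Definition ptmap (F : model) (u : pt F) (y : ob D) (f : arr (po u) y) : pt F :=
  Pt y (larr F f (pe u)).

Arguments ptmap {F} u {y} f.

Section Vertical.
Variables (F G : model) (M : fp_module F G).

(** [r] is the image of [e] under [C].  It is a relation because the source of
    [C] is the proarrow of [e] only up to an equation. *)
Definition vrel (u : pt F) (v : pt G) x y (f : arr (po u) x) (g : arr (po v) y)
    (C : hcell f g) (e : el M u v) (r : el M (ptmap u f) (ptmap v g)) : Prop :=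
  exists s : apex (mpro M (hsrc C)),
    tot e = existT _ (hsrc C) s /\ tot r = existT _ (htgt C) (ap (mcell M (hbody C)) s).

Variables (u : pt F) (v : pt G) (x y : ob D) (f : arr (po u) x) (g : arr (po v) y).

Lemma vrel_fun (C : hcell f g) (e : el M u v) (r r' : el M (ptmap u f) (ptmap v g)) :
  vrel C e r -> vrel C e r' -> r = r'.
Proof.
case=> s [h1 h2] [s' [h1' h2']]; apply: el_eq; rewrite h2 h2'.
by rewrite (inj_pair2 _ _ _ _ _ (etrans (esym h1) h1')).
Qed.

Lemma vrel_ex (C : hcell f g) (e : el M u v) :
  hsrc C = em e -> exists r : el M (ptmap u f) (ptmap v g), vrel C e r.
Proof.
case: C e => m n c [m' s l r] /= h; case: _ / h s l r => s l r.
have hl : lft (ap (mcell M c) s) = larr F f (pe u) by rewrite ap_legl l.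
have hr : rgt (ap (mcell M c) s) = larr G g (pe v) by rewrite ap_legr r.
by exists (@El F G M (ptmap u f) (ptmap v g) n (ap (mcell M c) s) hl hr), s.
Qed.

End Vertical.

Lemma vrel_uid (F : model) (u : pt F) x (f : arr (po u) x) :
  vrel (HCell (idpc f)) (uid u) (uid (ptmap u f)).
Proof.
exists (es (uid u)); split=> //=; congr existT.
exact: (ap_ceq (unitor_nat (model_lax F) f) (pe u)).
Qed.

Lemma tot_inv (F G : model) (M : fp_module F G) u v (e : el M u v) m s :
  tot e = existT _ m s -> exists l r, e = El M m s l r.
Proof.
case: e => m' s' l r /= h.
rewrite /tot /= in h; have e : m' = m := congr1 (@projT1 _ _) h.
case: _ / e s h => s h; have e : s' = s by exact: inj_pair2 h.
by case: _ / e {h}; exists l, r.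
Qed.

Lemma vrel_lact (F G : model) (M : fp_module F G) (u v : pt F) (w : pt G) x y z
    (f : arr (po u) x) (g : arr (po v) y) (h : arr (po w) z)
    (A : hcell f g) (B : hcell g h) (a : el (hom F) u v) (e : el M v w)
    (a' : el (hom F) (ptmap u f) (ptmap v g)) (e' : el M (ptmap v g) (ptmap w h)) :
  vrel A a a' -> vrel B e e' -> vrel (hpaste A B) (lact a e) (lact a' e').
Proof.
case=> s [/tot_inv[l [r ->]] /tot_inv[l' [r' ->]]] [t [/tot_inv[k [q ->]] /tot_inv[k' [q' ->]]]].
eexists; split; first by [].
rewrite /lact /tot /=; congr existT.
rewrite -[RHS](ap_ceq (actl_nat M (hbody A) (hbody B))).
congr (ap _ _); exact: sig_eq.
Qed.

Lemma vrel_ract (F G : model) (M : fp_module F G) (u : pt F) (v w : pt G) x y z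
    (f : arr (po u) x) (g : arr (po v) y) (h : arr (po w) z)
    (A : hcell f g) (B : hcell g h) (e : el M u v) (a : el (hom G) v w)
    (e' : el M (ptmap u f) (ptmap v g)) (a' : el (hom G) (ptmap v g) (ptmap w h)) :
  vrel A e e' -> vrel B a a' -> vrel (hpaste A B) (ract e a) (ract e' a').
Proof.
case=> s [/tot_inv[l [r ->]] /tot_inv[l' [r' ->]]] [t [/tot_inv[k [q ->]] /tot_inv[k' [q' ->]]]].
eexists; split; first by [].
rewrite /ract /tot /=; congr existT.
rewrite -[RHS](ap_ceq (actr_nat M (hbody A) (hbody B))).
congr (ap _ _); exact: sig_eq.
Qed.

End Elements.

Arguments ptmap {D PD PE F} u {y} f.
Arguments Pt {D PD PE F} po pe.
Arguments El {D PD PE F G M u v} em es el_l el_r.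

(** * Chains of elements *)

Section Chains.
Variable D : strict_dbl.
Variables (PD : lax_finite_products D) (PE : lax_finite_products Span).
Local Notation model := (model PD PE).
Local Notation mpath := (Defs.path (@fp_module (sdc D) Span PD PE)).

(** One step of a chain: an element of the left model, then a heteromorphism; [Q]
    is the type of the rest. *)
Record link (F G : model) (M : fp_module F G) (Q : pt G -> Type) (u : pt F) := Link {
  link_w : pt F;
  link_w' : pt G;
  link_a : el (hom F) u link_w;
  link_m : el M link_w link_w';
  link_t : Q link_w'
}.
Arguments Link {F G M Q u link_w link_w'} link_a link_m link_t.

(** The interposed elements make a chain for the empty path an element of one
    model.  Plain composable sequences would instead need an equation between
    the two end points there. *)
Fixpoint chain (F F' : model) (s : mpath F F') : pt F -> pt F' -> Type :=
  match s in Defs.path _ F F' return pt F -> pt F' -> Type with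
  | pnil F => fun u v => el (hom F) u v
  | pcons F G H M s' => fun u v => link M (fun w => chain s' w v) u
  end.

Definition clact (F F' : model) (s : mpath F F') :
    forall u u' v, el (hom F) u u' -> chain s u' v -> chain s u v :=
  match s in Defs.path _ F F'
    return forall u u' v, el (hom F) u u' -> chain s u' v -> chain s u v with
  | pnil F => fun u u' v b x => hmul b x
  | pcons F G H M s' => fun u u' v b x => Link (hmul b (link_a x)) (link_m x) (link_t x)
  end.

Fixpoint cract (F F' : model) (s : mpath F F') :
    forall u v v', chain s u v -> el (hom F') v v' -> chain s u v' :=
  match s in Defs.path _ F F'
    return forall u v v', chain s u v -> el (hom F') v v' -> chain s u v' with
  | pnil F => fun u v v' x b => hmul x b
  | pcons F G H M s' => fun u v v' x b => Link (link_a x) (link_m x) (cract (link_t x) b)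
  end.

Fixpoint chain_pro (F F' : model) (s : mpath F F') :
    forall u v, chain s u v -> pro (po u) (po v) :=
  match s in Defs.path _ F F' return forall u v, chain s u v -> pro (po u) (po v) with
  | pnil F => fun u v x => em x
  | pcons F G H M s' => fun u v x => em (link_a x) ⊙ em (link_m x) ⊙ chain_pro (link_t x)
  end.

(** An interposed element can act on the factor to its right or on the factor to
    its left.  Up to this relation, chains are the elements of the composite of
    the modules over the categories between them. *)
Variant chain_step_cons (F G : model) (M : fp_module F G) (Q : pt G -> Type)
    (lQ : forall w w', el (hom G) w w' -> Q w' -> Q w)
    (R : forall w, Q w -> Q w -> Prop) (u : pt F) : link M Q u -> link M Q u -> Prop :=
| chain_step_l w1 w2 w3 (a : el (hom F) u w1) (b : el (hom F) w1 w2) (m : el M w2 w3) x :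
    chain_step_cons lQ R (Link (hmul a b) m x) (Link a (lact b m) x)
| chain_step_r w1 w2 w3 (a : el (hom F) u w1) (m : el M w1 w2) (b : el (hom G) w2 w3) x :
    chain_step_cons lQ R (Link a (ract m b) x) (Link a m (lQ w2 w3 b x))
| chain_step_in w1 w2 (a : el (hom F) u w1) (m : el M w1 w2) x x' :
    R w2 x x' -> chain_step_cons lQ R (Link a m x) (Link a m x').

Fixpoint chain_step (F F' : model) (s : mpath F F') :
    forall u v, chain s u v -> chain s u v -> Prop :=
  match s in Defs.path _ F F' return forall u v, chain s u v -> chain s u v -> Prop with
  | pnil F => fun _ _ _ _ => False
  | pcons F G H M s' => fun u v =>
      @chain_step_cons F G M (fun w => chain s' w v) (fun w w' => @clact G H s' w w' v)
        (fun w => @chain_step G H s' w v) u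
  end.

Definition chain_eq (F F' : model) (s : mpath F F') u v : chain s u v -> chain s u v -> Prop :=
  clos_refl_sym_trans _ (@chain_step F F' s u v).

Lemma chain_eq_refl (F F' : model) (s : mpath F F') u v (x : chain s u v) : chain_eq x x.
Proof. exact: rst_refl. Qed.

Lemma chain_eq_sym (F F' : model) (s : mpath F F') u v (x y : chain s u v) : chain_eq x y -> chain_eq y x.
Proof. exact: rst_sym. Qed.

Lemma chain_eq_trans (F F' : model) (s : mpath F F') u v (x y z : chain s u v) :
  chain_eq x y -> chain_eq y z -> chain_eq x z.
Proof. exact: rst_trans. Qed.

Lemma clos_map (A B : Type) (R : A -> A -> Prop) (R' : B -> B -> Prop) (f : A -> B) :
  (forall x y, R x y -> clos_refl_sym_trans _ R' (f x) (f y)) ->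
  forall x y, clos_refl_sym_trans _ R x y -> clos_refl_sym_trans _ R' (f x) (f y).
Proof.
move=> h x y; elim=> {x y} [x y /h //|x|x y _|x y z _ h1 _].
- exact: rst_refl.
- exact: rst_sym.
- exact: rst_trans.
Qed.

Lemma clos_eq (A B : Type) (R : A -> A -> Prop) (f : A -> B) :
  (forall x y, R x y -> f x = f y) ->
  forall x y, clos_refl_sym_trans _ R x y -> f x = f y.
Proof. by move=> h x y; elim=> {x y} [x y /h //||x y _ ->|x y z _ -> _]. Qed.

Lemma clact_hmul (F F' : model) (s : mpath F F') u u' u'' v
    (a : el (hom F) u u') (b : el (hom F) u' u'') (x : chain s u'' v) :
  clact (hmul a b) x = clact a (clact b x).
Proof. by case: s u u' u'' v a b x => [G|G H K M s] u u' u'' v a b x /=; rewrite hmulA. Qed.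

Lemma clact1 (F F' : model) (s : mpath F F') u v (x : chain s u v) : clact (uid u) x = x.
Proof.
case: s u v x => [G|G H K M s] u v x /=; rewrite hmul1l //.
by case: x.
Qed.

Lemma cract1 (F F' : model) (s : mpath F F') u v (x : chain s u v) : cract x (uid v) = x.
Proof.
elim: s u v x => [G|G H K M s IH] u v x /=; first by rewrite hmul1r.
by rewrite IH; case: x.
Qed.

Lemma clact_cract (F F' : model) (s : mpath F F') u u' v v'
    (a : el (hom F) u u') (x : chain s u' v) (b : el (hom F') v v') :
  clact a (cract x b) = cract (clact a x) b.
Proof. by case: s u u' v v' a x b => [G|G H K M s] u u' v v' a x b //=; rewrite hmulA. Qed.

Lemma chain_eq_in (F G H : model) (M : fp_module F G) (s : mpath G H) u w w' v
    (a : el (hom F) u w) (m : el M w w') (x x' : chain s w' v) :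
  chain_eq x x' ->
  chain_eq (Link a m x : chain (pcons M s) u v) (Link a m x' : chain (pcons M s) u v).
Proof.
apply: (clos_map (f := fun x => Link a m x : chain (pcons M s) u v)) => y y' h.
by apply: rst_step; apply: chain_step_in.
Qed.

Lemma chain_eq_slidel (F G H : model) (M : fp_module F G) (s : mpath G H) u w w' w'' v
    (a : el (hom F) u w) (b : el (hom F) w w') (m : el M w' w'') (x : chain s w'' v) :
  chain_eq (Link (hmul a b) m x : chain (pcons M s) u v)
      (Link a (lact b m) x : chain (pcons M s) u v).
Proof. by apply: rst_step; apply: chain_step_l. Qed.

Lemma chain_eq_slider (F G H : model) (M : fp_module F G) (s : mpath G H) u w w' w'' v
    (a : el (hom F) u w) (m : el M w w') (b : el (hom G) w' w'') (x : chain s w'' v) :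
  chain_eq (Link a (ract m b) x : chain (pcons M s) u v)
      (Link a m (clact b x) : chain (pcons M s) u v).
Proof. by apply: rst_step; apply: (chain_step_r (M := M)). Qed.

Lemma chain_eq_clact (F F' : model) (s : mpath F F') u u' v (b : el (hom F) u u')
    (x x' : chain s u' v) : chain_eq x x' -> chain_eq (clact b x) (clact b x').
Proof.
apply: clos_map => {x x'} y y'; case: s u u' v b y y' => [//|G H K M s] u u' v b y y'.
case=> [w1 w2 w3 a c m x|w1 w2 w3 a m c x|w1 w2 a m x x' h] /=.
- rewrite -hmulA; exact: (@chain_eq_slidel _ _ _ M s).
- exact: (@chain_eq_slider _ _ _ M s).
- by apply: (@chain_eq_in _ _ _ M s); apply: rst_step.
Qed.

Lemma chain_pro_clact (F F' : model) (s : mpath F F') u u' v (b : el (hom F) u u')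
    (x : chain s u' v) : chain_pro (clact b x) = em b ⊙ chain_pro x.
Proof. by case: s u u' v b x => [G|G H K M s] u u' v b x //=; rewrite (comppA). Qed.

Variant cvrel_cons (F G : model) (M : fp_module F G) (Q Q' : pt G -> Type)
    (u : pt F) (x y y' : ob D) (f : arr (po u) x) (g : arr y y')
    (R : forall (w : pt G) z (h : arr (po w) z), hcell h g -> Q w -> Q' (ptmap w h) -> Prop) :
    hcell f g -> link M Q u -> link M Q' (ptmap u f) -> Prop :=
| Cvrel w w' z z' (h : arr (po w) z) (h' : arr (po w') z')
    (A : hcell f h) (B : hcell h h') (C : hcell h' g)
    (a : el (hom F) u w) (m : el M w w') (t : Q w')
    (a' : el (hom F) (ptmap u f) (ptmap w h)) (m' : el M (ptmap w h) (ptmap w' h'))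
    (t' : Q' (ptmap w' h')) :
    vrel A a a' -> vrel B m m' -> R w' z' h' C t t' ->
    cvrel_cons R (hpaste A (hpaste B C)) (Link a m t) (Link a' m' t').

(** The vertical action of cells of [D] on chains, factor by factor. *)
Fixpoint cvrel (F F' : model) (s : mpath F F') :
    forall (u : pt F) (v : pt F') x y (f : arr (po u) x) (g : arr (po v) y),
    hcell f g -> chain s u v -> chain s (ptmap u f) (ptmap v g) -> Prop :=
  match s in Defs.path _ F F' return
    forall (u : pt F) (v : pt F') x y (f : arr (po u) x) (g : arr (po v) y),
    hcell f g -> chain s u v -> chain s (ptmap u f) (ptmap v g) -> Prop with
  | pnil F => fun u v x y f g C a a' => vrel (M := hom F) C a a'
  | pcons F G H M s' => fun u v x y f g =>
      @cvrel_cons F G M (fun w => chain s' w v) (fun w => chain s' w (ptmap v g)) u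
        x (po v) y f g (fun w z h => @cvrel G H s' w v z y h g)
  end.

Lemma cvrel_clact (F F' : model) (s : mpath F F') u u' v x x' y
    (f : arr (po u) x) (f' : arr (po u') x') (g : arr (po v) y)
    (A : hcell f f') (C : hcell f' g) (b : el (hom F) u u') b'
    (t : chain s u' v) (t' : chain s (ptmap u' f') (ptmap v g)) :
  vrel A b b' -> cvrel C t t' -> cvrel (hpaste A C) (clact b t) (clact b' t').
Proof.
case: s u u' v x x' y f f' g A C b b' t t' => [G|G H K M s] u u' v x x' y f f' g A C b b' t t' hA.
  exact: vrel_lact.
case=> w w' z z' h h' A' B {}C a m {}t a' m' {}t' hA' hB hC /=.
by rewrite -hpasteA; apply: Cvrel => //; apply: vrel_lact.
Qed.

(** ** Cutting chains *)

Fixpoint cjoin (F G H : model) (s1 : mpath F G) (s2 : mpath G H) :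
    forall u w v, chain s1 u w -> chain s2 w v -> chain (papp s1 s2) u v :=
  match s1 in Defs.path _ F G return forall s2 : mpath G H,
    forall u w v, chain s1 u w -> chain s2 w v -> chain (papp s1 s2) u v with
  | pnil F => fun s2 u w v a x => clact a x
  | pcons F G K M s => fun s2 u w v x y => Link (link_a x) (link_m x) (cjoin (link_t x) y)
  end s2.

Record cut (F G H : model) (s1 : mpath F G) (s2 : mpath G H) u v := Cut {
  cw : pt G;
  c1 : chain s1 u cw;
  c2 : chain s2 cw v
}.
Arguments Cut {F G H s1 s2 u v cw} c1 c2.

Definition cut_in (F G H K : model) (M : fp_module F G) (s1 : mpath G H) (s2 : mpath H K)
    u w w' v (a : el (hom F) u w) (m : el M w w') (k : cut s1 s2 w' v) :
    cut (pcons M s1) s2 u v :=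
  Cut (Link a m (c1 k) : chain (pcons M s1) _ _) (c2 k).

Definition cut_clact (F G H : model) (s1 : mpath F G) (s2 : mpath G H) u u' v
    (b : el (hom F) u u') (k : cut s1 s2 u' v) : cut s1 s2 u v :=
  Cut (clact b (c1 k)) (c2 k).

Definition cut_cract (F G H : model) (s1 : mpath F G) (s2 : mpath G H) u v v'
    (k : cut s1 s2 u v) (b : el (hom H) v v') : cut s1 s2 u v' :=
  Cut (c1 k) (cract (c2 k) b).

(** The interposed element at the cut goes to the second part, and the first part
    is closed by an identity. *)
Fixpoint csplit (F G H : model) (s1 : mpath F G) (s2 : mpath G H) :
    forall u v, chain (papp s1 s2) u v -> cut s1 s2 u v :=
  match s1 in Defs.path _ F G return forall (s2 : mpath G H) u v,
    chain (papp s1 s2) u v -> cut s1 s2 u v with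
  | pnil F => fun s2 u v x => @Cut F F H (pnil F) s2 u v u (uid u) x
  | pcons F G K M s => fun s2 u v x => cut_in (link_a x) (link_m x) (csplit (link_t x))
  end s2.

(** Cuts that differ by sliding an element inside one of the parts or across the
    cut. *)
Variant cstep (F G H : model) (s1 : mpath F G) (s2 : mpath G H) u v :
    cut s1 s2 u v -> cut s1 s2 u v -> Prop :=
| cstep1 w (x x' : chain s1 u w) (y : chain s2 w v) :
    chain_step x x' -> cstep (Cut x y) (Cut x' y)
| cstep2 w (x : chain s1 u w) (y y' : chain s2 w v) :
    chain_step y y' -> cstep (Cut x y) (Cut x y')
| cstepb w w' (x : chain s1 u w) (b : el (hom G) w w') (y : chain s2 w' v) :
    cstep (Cut (cract x b) y) (Cut x (clact b y)).

Definition cuteq (F G H : model) (s1 : mpath F G) (s2 : mpath G H) u v :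
    cut s1 s2 u v -> cut s1 s2 u v -> Prop :=
  clos_refl_sym_trans _ (@cstep F G H s1 s2 u v).

Lemma cuteq_1 (F G H : model) (s1 : mpath F G) (s2 : mpath G H) u w v
    (x x' : chain s1 u w) (y : chain s2 w v) :
  chain_eq x x' -> cuteq (Cut x y) (Cut x' y).
Proof. by apply: (clos_map (f := fun x => Cut x y)) => z z' h; apply: rst_step; apply: cstep1. Qed.

Lemma cuteq_2 (F G H : model) (s1 : mpath F G) (s2 : mpath G H) u w v
    (x : chain s1 u w) (y y' : chain s2 w v) :
  chain_eq y y' -> cuteq (Cut x y) (Cut x y').
Proof. by apply: (clos_map (f := fun y => Cut x y)) => z z' h; apply: rst_step; apply: cstep2. Qed.

Lemma cuteq_b (F G H : model) (s1 : mpath F G) (s2 : mpath G H) u w w' v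
    (x : chain s1 u w) (b : el (hom G) w w') (y : chain s2 w' v) :
  cuteq (Cut (cract x b) y) (Cut x (clact b y)).
Proof. by apply: rst_step; apply: cstepb. Qed.

Lemma cuteq_in (F G H K : model) (M : fp_module F G) (s1 : mpath G H) (s2 : mpath H K)
    u w w' v (a : el (hom F) u w) (m : el M w w') (k k' : cut s1 s2 w' v) :
  cuteq k k' -> cuteq (cut_in a m k) (cut_in a m k').
Proof.
apply: clos_map => {}k {}k' [z x x' y h|z x y y' h|z z' x b y].
- by apply: rst_step; apply: (@cstep1 _ _ _ (pcons M s1)); apply: chain_step_in.
- by apply: rst_step; apply: (@cstep2 _ _ _ (pcons M s1)).
- exact: (@cuteq_b _ _ _ (pcons M s1) s2 _ _ _ _ (Link a m x) b y).
Qed.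

(** When the first part is empty, [b] is absorbed by the second part and has to be
    moved across the cut. *)
Lemma csplit_clact (F G H : model) (s1 : mpath F G) (s2 : mpath G H) u u' v
    (b : el (hom F) u u') (x : chain (papp s1 s2) u' v) :
  cuteq (csplit (clact b x)) (cut_clact b (csplit x)).
Proof.
case: s1 s2 u u' v b x => [K|K L N M s] s2 u u' v b x /=; last exact: rst_refl.
apply: rst_sym; rewrite /cut_clact /= hmul1r -[X in Cut X _](hmul1l b).
exact: (@cuteq_b _ _ _ (pnil K) s2 _ _ _ _ (uid u) b x).
Qed.

Lemma csplit_cract (F G H : model) (s1 : mpath F G) (s2 : mpath G H) u v v'
    (x : chain (papp s1 s2) u v) (b : el (hom H) v v') :
  csplit (cract x b) = cut_cract (csplit x) b.
Proof. by elim: s1 s2 u v v' x b => [//|K L N M s IH] s2 u v v' x b /=; rewrite IH. Qed.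

(** Joining multiplies the two elements at the seam, so that the cut of the result
    is the original one only up to moving an element across. *)
Lemma csplit_join (F G H : model) (s1 : mpath F G) (s2 : mpath G H) u w v
    (x : chain s1 u w) (y : chain s2 w v) : cuteq (csplit (cjoin x y)) (Cut x y).
Proof.
elim: s1 s2 u w v x y => [K|K L N M s IH] s2 u w v x y /=.
  by apply: rst_trans (csplit_clact (s1 := pnil K) _ _) _; rewrite /cut_clact /= hmul1r; apply: rst_refl.
case: x => z z' a m x; exact: cuteq_in (IH _ _ _ _ x y).
Qed.

Lemma csplit_eq (F G H : model) (s1 : mpath F G) (s2 : mpath G H) u v
    (x x' : chain (papp s1 s2) u v) : chain_eq x x' -> cuteq (csplit x) (csplit x').
Proof.
elim: s1 s2 u v x x' => [K|K L N M s IH] s2 u v x x'.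
  by move=> h; apply: (@cuteq_2 _ _ _ (pnil K)).
apply: clos_map => {}x {}x'.
case=> [w1 w2 w3 a c m z|w1 w2 w3 a m c z|w1 w2 a m z z' h] /=.
- by apply: (@cuteq_1 _ _ _ (pcons M s)); apply: chain_eq_slidel.
- apply: rst_trans (cuteq_in a m (rst_sym _ _ _ _ (csplit_clact c z))).
  by apply: (@cuteq_1 _ _ _ (pcons M s)); apply: chain_eq_slider.
- by apply: cuteq_in; apply: IH; apply: rst_step.
Qed.

Lemma chain_pro_split (F G H : model) (s1 : mpath F G) (s2 : mpath G H) u v
    (x : chain (papp s1 s2) u v) :
  chain_pro x = chain_pro (c1 (csplit x)) ⊙ chain_pro (c2 (csplit x)).
Proof.
elim: s1 s2 u v x => [K|K L N M s IH] s2 u v x /=; first by rewrite (comp1p).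
by rewrite IH !(comppA).
Qed.

Variant vcut (F G H : model) (s1 : mpath F G) (s2 : mpath G H) (u : pt F) (v : pt H)
    x y (f : arr (po u) x) (g : arr (po v) y) : hcell f g -> cut s1 s2 u v ->
    cut s1 s2 (ptmap u f) (ptmap v g) -> Prop :=
| VCut w z (h : arr (po w) z) (A : hcell f h) (B : hcell h g)
    (t1 : chain s1 u w) (t2 : chain s2 w v) (t1' : chain s1 (ptmap u f) (ptmap w h))
    (t2' : chain s2 (ptmap w h) (ptmap v g)) :
  cvrel A t1 t1' -> cvrel B t2 t2' -> vcut (hpaste A B) (Cut t1 t2) (Cut t1' t2').

Lemma cvrel_split (F G H : model) (s1 : mpath F G) (s2 : mpath G H) u v x y
    (f : arr (po u) x) (g : arr (po v) y) (C : hcell f g)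
    (t : chain (papp s1 s2) u v) (t' : chain (papp s1 s2) (ptmap u f) (ptmap v g)) :
  cvrel C t t' -> vcut C (csplit t) (csplit t').
Proof.
elim: s1 s2 u v x y f g C t t' => [K|K L N M s IH] s2 u v x y f g C t t' /=.
  move=> h; rewrite -[C]hpaste1l.
  by apply: (@VCut _ _ _ (pnil K) s2 _ _ _ _ _ _ _ _ f) => //; apply: vrel_uid.
case=> w w' z z' h h' A B {}C a m {}t a' m' {}t' hA hB /IH /=.
case=> {C} p q k C C' t1 t2 t1' t2' h1 h2; rewrite -hpasteA -hpasteA (hpasteA A).
by apply: (@VCut _ _ _ (pcons M s) s2); rewrite //; apply: Cvrel.
Qed.

End Chains.

Arguments Link {D PD PE F G M Q u link_w link_w'} link_a link_m link_t.
Arguments Cut {D PD PE F G H s1 s2 u v cw} c1 c2.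

(** * Maps of models *)

Section Maps.
Variable D : strict_dbl.
Variables (PD : lax_finite_products D) (PE : lax_finite_products Span).
Local Notation model := (model PD PE).
Implicit Types F G H : model.

Lemma tot_lact F G (M : fp_module F G) x y z
    (u u' : (F x : SET)) (v v' : (F y : SET)) (w w' : (G z : SET))
    (a : el (hom F) (Pt x u) (Pt y v)) (a' : el (hom F) (Pt x u') (Pt y v'))
    (e : el M (Pt y v) (Pt z w)) (e' : el M (Pt y v') (Pt z w')) :
  tot a = tot a' -> tot e = tot e' -> tot (lact a e) = tot (lact a' e').
Proof.
move=> /tot_inv[l [r ->]] /tot_inv[l' [r' ->]]; rewrite /tot /lact /=.
by congr existT; congr (ap _ _); apply: sig_eq.
Qed.

Lemma tot_legs F G (M : fp_module F G) x y
    (u u' : (F x : SET)) (v v' : (G y : SET))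
    (e : el M (Pt x u) (Pt y v)) (e' : el M (Pt x u') (Pt y v')) :
  tot e = tot e' -> u = u' /\ v = v'.
Proof.
case/tot_inv=> l [r _]; split.
- exact: etrans (esym l) (el_l e').
- exact: etrans (esym r) (el_r e').
Qed.

Section Pretrans.
Variables (F G : model) (a : pretrans F G).

Definition tpt (u : pt F) : pt G := Pt (po u) (tob a (po u) (pe u)).

Definition tpe (u v : pt F) (e : el (hom F) u v) : el (hom G) (tpt u) (tpt v) :=
  @El _ _ _ G G (hom G) (tpt u) (tpt v) (em e) (ap (tpro a (em e)) (es e))
    (etrans (ap_legl _ _) (congr1 _ (el_l e))) (etrans (ap_legr _ _) (congr1 _ (el_r e))).

Lemma tpe_hmul (u v w : pt F) (e : el (hom F) u v) (e' : el (hom F) v w) :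
  tpe (hmul e e') = hmul (tpe e) (tpe e').
Proof.
apply: el_eq; rewrite /tot /=; congr existT.
rewrite -[LHS]/(ap (tpro a _ • laxator F _ _) (pr (em_comp e e'))) (ap_ceq (tpro_comp a _ _)).
congr (ap (laxator G _ _) _); exact: sig_eq.
Qed.

Lemma tpe_uid (u : pt F) : tpe (uid u) = uid (tpt u).
Proof. apply: el_eq; rewrite /tot /=; congr existT; exact: (ap_ceq (tpro_id a (po u)) (pe u)). Qed.

End Pretrans.

Lemma tot_tpe F G (a : pretrans F G) x y (u u' : (F x : SET)) (v v' : (F y : SET))
    (e : el (hom F) (Pt x u) (Pt y v)) (e' : el (hom F) (Pt x u') (Pt y v')) :
  tot e = tot e' -> tot (tpe a e) = tot (tpe a e').
Proof. by move=> /tot_inv[l [r ->]]. Qed.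

Lemma pretrans_eq F G (a b : pretrans F G) :
  tob a = tob b -> (forall x y (m : pro x y) s, ap (tpro a m) s = ap (tpro b m) s) -> a = b.
Proof.
case: a b => a1 a2 a3 a4 [b1 b2 b3 b4] /= e; case: _ / e b2 b3 b4 => b2 b3 b4 e.
have {}e : a2 = b2.
  do 3!apply: functional_extensionality_dep => ?; apply: span_eq; exact: e.
case: _ / e b3 b4 => b3 b4.
by rewrite (proof_irrelevance _ b3 a3) (proof_irrelevance _ b4 a4).
Qed.

Definition pre_id F : pretrans F F.
Proof.
exists (fun x => ida (F x)) (fun x y m => idc (lpro F m)).
- by move=> x y z m n; apply: ap_ceqP => // -[s h]; congr (ap (laxator F m n) _); apply: sig_eq; case: s h.
- by move=> x; apply: ap_ceqP.
Defined.

Definition pre_comp F G H (b : pretrans G H) (a : pretrans F G) : pretrans F H.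
Proof.
exists (fun x => tob b x ∘ tob a x) (fun x y m => tpro b m • tpro a m).
- move=> x y z m n; apply: ap_ceqP => // s.
  transitivity (ap (tpro b (m ⊙ n)) (ap (tpro a (m ⊙ n) • laxator F m n) s)); first by [].
  rewrite (ap_ceq (tpro_comp a m n)).
  transitivity (ap (tpro b (m ⊙ n) • laxator G m n) (ap (tpro a m ⊛ tpro a n) s)); first by [].
  rewrite (ap_ceq (tpro_comp b m n)).
  by congr (ap (laxator H m n) _); apply: sig_eq.
- move=> x; apply: ap_ceqP => // s.
  transitivity (ap (tpro b (idp x)) (ap (tpro a (idp x) • unitor F x) s)); first by [].
  rewrite (ap_ceq (tpro_id a x)).
  exact: (ap_ceq (tpro_id b x) (tob a x s)).
Defined.

(** Comparison cells of lax ([o = false]) and oplax ([o = true]) transformations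
    are elements between the same points in opposite directions. *)
Definition side (o : bool) F (u v : pt F) := if o then el (hom F) v u else el (hom F) u v.

Section Side.
Variable o : bool.

Definition smul F (u v w : pt F) : side o u v -> side o v w -> side o u w :=
  match o return side o u v -> side o v w -> side o u w with
  | false => fun j k => hmul j k
  | true => fun j k => hmul k j
  end.

Definition suid F (u : pt F) : side o u u :=
  match o return side o u u with false => uid u | true => uid u end.

Definition stpe F G (a : pretrans F G) (u v : pt F) :
    side o u v -> side o (tpt a u) (tpt a v) :=
  match o return side o u v -> side o (tpt a u) (tpt a v) with
  | false => fun j => tpe a j
  | true => fun j => tpe a j
  end.

(** Comparison through [tot], for end points that agree only propositionally. *)
Definition side_eq F x y (u u' : (F x : SET)) (v v' : (F y : SET)) :
    side o (Pt x u) (Pt y v) -> side o (Pt x u') (Pt y v') -> Prop :=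
  match o return side o (Pt x u) (Pt y v) -> side o (Pt x u') (Pt y v') -> Prop with
  | false => fun j k => tot j = tot k
  | true => fun j k => tot j = tot k
  end.

Definition side_glob F x (u v : (F x : SET)) : side o (Pt x u) (Pt x v) -> Prop :=
  match o return side o (Pt x u) (Pt x v) -> Prop with
  | false => fun j => em j = idp x
  | true => fun j => em j = idp x
  end.

(** The action of the identity cell on [g], to which the composition law for
    comparisons refers. *)
Definition svrel F x y (g : arr x y) (u v : (F x : SET)) :
    side o (Pt x u) (Pt x v) -> side o (ptmap (Pt x u) g) (ptmap (Pt x v) g) -> Prop :=
  match o return side o (Pt x u) (Pt x v) ->
    side o (ptmap (Pt x u) g) (ptmap (Pt x v) g) -> Prop with
  | false => fun j r => @vrel _ _ _ F F (hom F) (Pt x u) (Pt x v) y y g g (HCell (idpc g)) j r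
  | true => fun j r => @vrel _ _ _ F F (hom F) (Pt x v) (Pt x u) y y g g (HCell (idpc g)) j r
  end.

Definition comm F G (M : fp_module F G) (U U' : pt F) (V V' : pt G)
    (r : el M U V) (e : el M U' V') : side o U U' -> side o V V' -> Prop :=
  match o return side o U U' -> side o V V' -> Prop with
  | false => fun j k => ract r k = lact j e
  | true => fun j k => lact j r = ract e k
  end.

(** The common form of all naturality laws: the image of [e] under [C] and [e']
    are linked by the comparison elements [j] and [k]. *)
Definition square F G (M : fp_module F G) (U : pt F) (V : pt G) x y
    (f : arr (po U) x) (g : arr (po V) y) (C : hcell f g) (U' : pt F) (V' : pt G)
    (e : el M U V) (e' : el M U' V')
    (j : side o (ptmap U f) U') (k : side o (ptmap V g) V') : Prop :=
  exists2 r, vrel C e r & comm r e' j k.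

Lemma smulA F (u v w z : pt F) (i : side o u v) (j : side o v w) (k : side o w z) :
  smul (smul i j) k = smul i (smul j k).
Proof. by move: i j k; rewrite /smul; case: o => i j k; rewrite hmulA. Qed.

Lemma smul1l F (u v : pt F) (j : side o u v) : smul (suid u) j = j.
Proof. by move: j; rewrite /smul /suid; case: o => j; rewrite (hmul1l, hmul1r). Qed.

Lemma smul1r F (u v : pt F) (j : side o u v) : smul j (suid v) = j.
Proof. by move: j; rewrite /smul /suid; case: o => j; rewrite (hmul1l, hmul1r). Qed.

Lemma stpe_smul F G (a : pretrans F G) (u v w : pt F) (j : side o u v) (k : side o v w) :
  stpe a (smul j k) = smul (stpe a j) (stpe a k).
Proof. by move: j k; rewrite /smul /stpe; case: o => j k; rewrite tpe_hmul. Qed.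

Lemma stpe_suid F G (a : pretrans F G) (u : pt F) : stpe a (suid u) = suid (tpt a u).
Proof. by rewrite /suid /stpe; case: o; rewrite tpe_uid. Qed.

Lemma side_eqP F (u v : pt F) (j k : side o u v) :
  @side_eq F (po u) (po v) (pe u) (pe u) (pe v) (pe v) j k -> j = k.
Proof. by move: j k; rewrite /side_eq; case: o => j k /el_eq. Qed.

Lemma side_eq_refl F x y (u : (F x : SET)) (v : (F y : SET))
    (j : side o (Pt x u) (Pt y v)) : side_eq j j.
Proof. by move: j; rewrite /side_eq; case: o. Qed.

Lemma side_eq_smul F x y z (u u' : (F x : SET)) (v v' : (F y : SET)) (w w' : (F z : SET))
    (j : side o (Pt x u) (Pt y v)) (j' : side o (Pt x u') (Pt y v'))
    (k : side o (Pt y v) (Pt z w)) (k' : side o (Pt y v') (Pt z w')) :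
  side_eq j j' -> side_eq k k' -> side_eq (smul j k) (smul j' k').
Proof.
move: j j' k k'; rewrite /side_eq /smul; case: o => j j' k k' e e'; exact: tot_lact.
Qed.

Lemma side_eq_stpe F G (a : pretrans F G) x y (u u' : (F x : SET)) (v v' : (F y : SET))
    (j : side o (Pt x u) (Pt y v)) (k : side o (Pt x u') (Pt y v')) :
  side_eq j k -> side_eq (stpe a j) (stpe a k).
Proof. move: j k; rewrite /side_eq /stpe; case: o => j k; exact: tot_tpe. Qed.

Lemma side_glob_suid F (u : pt F) : @side_glob F (po u) (pe u) (pe u) (suid u).
Proof. by rewrite /side_glob /suid; case: o. Qed.

Lemma side_glob_smul F x (u v w : (F x : SET)) (j : side o (Pt x u) (Pt x v))
    (k : side o (Pt x v) (Pt x w)) :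
  side_glob j -> side_glob k -> side_glob (smul j k).
Proof.
by move: j k; rewrite /side_glob /smul; case: o => j k /= -> ->; rewrite comp1p.
Qed.

Lemma side_glob_stpe F G (a : pretrans F G) x (u v : (F x : SET))
    (j : side o (Pt x u) (Pt x v)) : side_glob j -> side_glob (stpe a j).
Proof. by move: j; rewrite /side_glob /stpe; case: o. Qed.

Lemma svrel_ex F x y (g : arr x y) (u v : (F x : SET)) (j : side o (Pt x u) (Pt x v)) :
  side_glob j -> exists r, svrel (g := g) j r.
Proof. by move: j; rewrite /side_glob /svrel; case: o => j h; apply: vrel_ex. Qed.

Lemma svrel_fun F x y (g : arr x y) (u v : (F x : SET)) (j : side o (Pt x u) (Pt x v)) r r' :
  svrel (g := g) j r -> svrel j r' -> r = r'.
Proof. move: j r r'; rewrite /svrel; case: o => j r r'; exact: vrel_fun. Qed.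

Lemma svrel_smul F x y (g : arr x y) (u v w : (F x : SET)) (j : side o (Pt x u) (Pt x v))
    (k : side o (Pt x v) (Pt x w)) r q :
  svrel (g := g) j r -> svrel k q -> svrel (smul j k) (smul r q).
Proof.
move: j k r q; rewrite /svrel /smul; case: o => j k r q h h'.
- rewrite -(hpaste1l (HCell (idpc g))); exact: vrel_lact h' h.
- rewrite -(hpaste1l (HCell (idpc g))); exact: vrel_lact h h'.
Qed.

Lemma svrel_suid F (u : pt F) y (g : arr (po u) y) :
  @svrel F (po u) y g (pe u) (pe u) (suid u) (suid (ptmap u g)).
Proof. by rewrite /svrel /suid; case: o; apply: vrel_uid. Qed.

End Side.

(** A transformation with its comparison cells given by their elements, in
    either orientation. *)
Record etr (o : bool) F G := Etr {
  epre :> pretrans F G;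
  ecmp : forall (u : pt F) y (f : arr (po u) y),
    side o (ptmap (tpt epre u) f) (tpt epre (ptmap u f))
}.

Arguments ecmp {o F G} a u {y} f : rename.

(** The laws of lax and of oplax transformations at once; see [lax_etrP] and
    [oplax_etrP]. *)
Record is_etr o F G (a : etr o F G) : Prop := IsEtr {
  etr_glob : forall (u : pt F) y (f : arr (po u) y),
    @side_glob o G y (pe (ptmap (tpt a u) f)) (pe (tpt a (ptmap u f))) (ecmp a u f);
  etr_id : forall u : pt F,
    @side_eq o G (po u) (po u) _ _ _ _ (ecmp a u (ida (po u))) (suid o (tpt a u));
  etr_comp2 : forall (u : pt F) y z (f : arr (po u) y) (g : arr y z) r,
    @svrel o G y z g (pe (ptmap (tpt a u) f)) (pe (tpt a (ptmap u f))) (ecmp a u f) r ->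
    @side_eq o G z z _ _ _ _ (ecmp a u (g ∘ f)) (smul r (ecmp a (ptmap u f) g));
  etr_nat : forall (u v : pt F) x y (f : arr (po u) x) (g : arr (po v) y)
      (C : hcell f g) (e : el (hom F) u v) e',
    vrel C e e' -> @square o G G (hom G) (tpt a u) (tpt a v) x y f g C _ _
                     (tpe a e) (tpe a e') (ecmp a u f) (ecmp a v g)
}.

Definition etr_one o F : etr o F F := @Etr o F F (pre_id F) (fun u y f => suid o (ptmap u f)).

(** In the lax case the comparison is first the one of [b] and then the image of
    the one of [a]; [smul] reverses the order in the oplax case. *)
Definition etr_comp o F G H (b : etr o G H) (a : etr o F G) : etr o F H :=
  @Etr o F H (pre_comp b a) (fun u y f =>
    smul (ecmp b (tpt a u) f) (stpe b (ecmp a u f))).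

Lemma tpe_one F (u v : pt F) (e : el (hom F) u v) : tpe (pre_id F) e = e.
Proof. exact: el_eq. Qed.

Lemma tpe_comp F G H (b : pretrans G H) (a : pretrans F G) (u v : pt F)
    (e : el (hom F) u v) : tpe (pre_comp b a) e = tpe b (tpe a e).
Proof. exact: el_eq. Qed.

Lemma is_etr_one o F : is_etr (etr_one o F).
Proof.
split.
- by move=> u y f; apply: (side_glob_suid o (ptmap u f)).
- move=> u; rewrite /= /ptmap larr_id; exact: side_eq_refl.
- move=> u y z f g r h.
  have -> : r = suid o (ptmap (ptmap u f) g).
    have h' := @svrel_suid o F (ptmap u f) z g; exact: (svrel_fun h h').
  rewrite /= smul1l /ptmap /= larr_comp; exact: side_eq_refl.
- move=> u v x y f g C e e' h; exists e'; first by rewrite tpe_one.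
  rewrite /= tpe_one /comm /suid; case: o => /=; rewrite lact1 ract1 //.
Qed.

(** The square of comparisons of [b] is pasted to the image under [b] of the
    given square. *)
Lemma comm_stpe o G H (b : pretrans G H) (U U' V V' : pt G) (W : pt H) (Z : pt H)
    (q : el (hom H) W Z) (r : el (hom G) U V) (e : el (hom G) U' V')
    (p : side o W (tpt b U)) (p' : side o Z (tpt b V)) (j : side o U U') (k : side o V V') :
  comm q (tpe b r) p p' -> comm r e j k ->
  comm q (tpe b e) (smul p (stpe b j)) (smul p' (stpe b k)).
Proof.
move: p p' j k; rewrite /comm /smul /stpe; case: o => p p' j k h h'.
- change (hmul p q = hmul (tpe b r) p') in h; change (hmul j r = hmul e k) in h'.
  change (hmul (hmul (tpe b j) p) q = hmul (tpe b e) (hmul (tpe b k) p')).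
  by rewrite hmulA h -hmulA -tpe_hmul h' tpe_hmul hmulA.
- change (hmul q p' = hmul p (tpe b r)) in h; change (hmul r k = hmul j e) in h'.
  change (hmul q (hmul p' (tpe b k)) = hmul (hmul p (tpe b j)) (tpe b e)).
  by rewrite -hmulA h hmulA -tpe_hmul h' tpe_hmul hmulA.
Qed.

(** Naturality of [b] at the identity cell on [g] and at the element [j].  It lets
    the comparisons of two transformations pass each other in a composite. *)
Lemma etr_exchange o G H (b : etr o G H) y z (g : arr y z) (u v : (G y : SET))
    (j : side o (Pt y u) (Pt y v)) r r' :
  is_etr b -> svrel (g := g) j r ->
  @svrel o H y z g (pe (tpt b (Pt y u))) (pe (tpt b (Pt y v))) (stpe b j) r' ->
  smul r' (ecmp b (Pt y v) g) = smul (ecmp b (Pt y u) g) (stpe b r).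
Proof.
case: o b j r r' => b j r r' hb h h'; have [q hq hc] := etr_nat hb h;
  have e := vrel_fun hq h'; subst q.
- exact: hc.
- exact: hc.
Qed.

Lemma is_etr_comp o F G H (b : etr o G H) (a : etr o F G) :
  is_etr b -> is_etr a -> is_etr (etr_comp b a).
Proof.
move=> hb ha; split.
- move=> u y f.
  have h1 := etr_glob hb (u := tpt a u) f; have h2 := side_glob_stpe b (etr_glob ha f).
  exact: (side_glob_smul h1 h2).
- move=> u; have h1 := etr_id hb (tpt a u); have h2 := side_eq_stpe b (etr_id ha u).
  have := side_eq_smul h1 h2; rewrite stpe_suid smul1l; exact.
- move=> u y z f g r h /=.
  have [ra hra] := svrel_ex g (etr_glob ha f).
  have [rb hrb] := svrel_ex g (etr_glob hb (u := tpt a u) f).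
  have [r' hr'] := svrel_ex g (side_glob_stpe b (etr_glob ha f)).
  have -> : r = smul rb r' by apply: svrel_fun h _; apply: svrel_smul.
  rewrite (smulA rb).
  have -> : smul r' (ecmp (etr_comp b a) (ptmap u f) g) =
    smul (smul (ecmp b (ptmap (tpt a u) f) g) (stpe b ra)) (stpe b (ecmp a (ptmap u f) g)).
    rewrite -(etr_exchange hb hra hr') smulA.
    by [].
  rewrite smulA -stpe_smul -smulA.
  apply: side_eq_smul; first exact: (etr_comp2 hb hrb).
  apply: side_eq_stpe; exact: (etr_comp2 ha hra).
- move=> u v x y f g C e e' h; rewrite /square !tpe_comp.
  have [r hr hc] := etr_nat ha h.
  have [q hq hc'] := etr_nat hb hr.
  by exists q => //; apply: comm_stpe hc' hc.
Qed.

End Maps.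

Arguments ecmp {D PD PE o F G} a u {y} f : rename.

(** * Comparison cells as elements *)

Section MapLaws.
Variable D : strict_dbl.
Variables (PD : lax_finite_products D) (PE : lax_finite_products Span).
Local Notation model := (model PD PE).
Implicit Types F G H : model.

Section Comparison.
Variables (G : model) (X : ob Span) (w : ob D).

Definition ecell (f g : arr X (G w)) (c : cell (idp X) (lpro G (idp w)) f g) (s : (X : SET)) :
    el (hom G) (Pt w (f s)) (Pt w (g s)) :=
  @El _ _ _ G G (hom G) (Pt w (f s)) (Pt w (g s)) (idp w) (ap c s)
    (ap_legl c s) (ap_legr c s).

(** Pasting of comparison cells is multiplication of their elements, since the
    unitors are invisible on elements. *)
Lemma ecell_paste (f g h : arr X (G w)) (e : g = g)
    (a : cell (idp X) (lpro G (idp w)) f g) (b : cell (idp X) (lpro G (idp w)) g h) s :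
  ecell (paste e a b) s = hmul (ecell a s) (ecell b s).
Proof.
rewrite (proof_irrelevance _ e erefl); apply: el_eq.
rewrite -[RHS](mcell_eqcell (M := hom G) _ (is_eqcell_lun (idp w))).
rewrite /tot /=; congr existT; apply: etrans (ap_recast _ _ _ _) _.
by congr (ap _ (ap _ _)); apply: sig_eq.
Qed.

End Comparison.

Lemma ecell_idpc (G : model) (X Y : ob Span) (w : ob D) (f g : arr X (G w))
    (c : cell (idp X) (lpro G (idp w)) f g) (h : arr Y X) s :
  ecell (c • idpc h) s = ecell c (h s).
Proof. exact: el_eq. Qed.

Section CellElements.
Variables (F G : model) (p : pretrans F G).
Variables (x y w z : ob D) (m : pro x y) (n : pro w z) (f : arr x w) (g : arr y z).
Variables (c : cell m n f g) (s : apex (lpro F m)).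

Definition elem : el (hom F) (Pt x (lft s)) (Pt y (rgt s)) :=
  @El _ _ _ F F (hom F) (Pt x (lft s)) (Pt y (rgt s)) m s erefl erefl.

Definition elem_map : el (hom F) (ptmap (Pt x (lft s)) f) (ptmap (Pt y (rgt s)) g) :=
  @El _ _ _ F F (hom F) (ptmap (Pt x (lft s)) f) (ptmap (Pt y (rgt s)) g)
    n (ap (lcell F c) s) (ap_legl (lcell F c) s) (ap_legr (lcell F c) s).

Definition map_elem : el (hom G) (ptmap (tpt p (Pt x (lft s))) f)
    (ptmap (tpt p (Pt y (rgt s))) g) :=
  @El _ _ _ G G (hom G) (ptmap (tpt p (Pt x (lft s))) f) (ptmap (tpt p (Pt y (rgt s))) g)
    n (ap (lcell G c • tpro p m) s) (ap_legl (lcell G c • tpro p m) s)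
    (ap_legr (lcell G c • tpro p m) s).

Lemma vrel_elem : @vrel _ _ _ F F (hom F) (Pt x (lft s)) (Pt y (rgt s)) w z f g
  (HCell c) elem elem_map.
Proof. by exists s. Qed.

Lemma vrel_map_elem : @vrel _ _ _ G G (hom G) (tpt p (Pt x (lft s)))
  (tpt p (Pt y (rgt s))) w z f g (HCell c) (tpe p elem) map_elem.
Proof. by exists (ap (tpro p m) s). Qed.

End CellElements.

Section Lax.
Variables (F G : model) (p : pretrans F G).
Variable cmp : forall (x y : ob D) (f : arr x y),
  cell (idp (F x)) (lpro G (idp y)) (larr G f ∘ tob p x) (tob p y ∘ larr F f).

Definition lax_laws : Prop :=
  [/\ forall x : ob D, cmp (ida x) ≡ unitor G x • idpc (tob p x),
      forall (x y z : ob D) (g : arr y z) (f : arr x y),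
        cmp (g ∘ f) ≡ paste (compaA _ _ _)
          (lcell G (idpc g) • cmp f) (cmp g • idpc (larr F f))
    & forall (x y w z : ob D) (m : pro x y) (n : pro w z)
        (f : arr x w) (g : arr y z) (c : cell m n f g),
      lcell G (run n) • (laxator G n (idp z) •
          (((lcell G c • tpro p m) ⊛ cmp g) • runV (lpro F m)))
        ≡ lcell G (lun n) • (laxator G (idp w) n •
          ((cmp f ⊛ (tpro p n • lcell F c)) • lunV (lpro F m)))].

Definition lax_etr : etr false F G :=
  @Etr _ _ _ false F G p (fun u y f => ecell (cmp f) (pe u)).

Section LaxCell.
Variables (x y w z : ob D) (m : pro x y) (n : pro w z) (f : arr x w) (g : arr y z).
Variables (c : cell m n f g) (s : apex (lpro F m)).

Lemma lax_cell_left : tot (ract (map_elem p c s) (ecmp lax_etr (Pt y (rgt s)) g)) =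
  existT _ n (ap (lcell G (run n) • (laxator G n (idp z) •
        (((lcell G c • tpro p m) ⊛ cmp g) • runV (lpro F m)))) s).
Proof.
rewrite -[LHS](mcell_eqcell (M := hom G) _ (is_eqcell_run n)) /tot; congr existT.
by congr (ap (lcell G (run n)) (ap _ _)); apply: sig_eq.
Qed.

Lemma lax_cell_right : tot (lact (ecmp lax_etr (Pt x (lft s)) f) (tpe p (elem_map c s))) =
  existT _ n (ap (lcell G (lun n) • (laxator G (idp w) n •
        ((cmp f ⊛ (tpro p n • lcell F c)) • lunV (lpro F m)))) s).
Proof.
rewrite -[LHS](mcell_eqcell (M := hom G) _ (is_eqcell_lun n)) /tot; congr existT.
by congr (ap (lcell G (lun n)) (ap _ _)); apply: sig_eq.
Qed.

End LaxCell.

(** Each law is an equation between cells of spans, and holds when it holds at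
    every element of their source. *)
Lemma lax_etrP : is_etr lax_etr <-> lax_laws.
Proof.
split=> [h|[h1 h2 h3]].
- split.
  + move=> x; apply: ap_ceqP => [||s].
    * by rewrite larr_id.
    * by rewrite larr_id.
    * apply: (@es_eq _ _ _ _ _ (hom G)); exact: (etr_id h (Pt x s)).
  + move=> x y z g f; apply: ap_ceqP => [||s].
    * by rewrite larr_comp.
    * by rewrite larr_comp.
    * apply: (@es_eq _ _ _ _ _ (hom G)).
      have hr : svrel (ecmp lax_etr (Pt x s) f) (ecell (lcell G (idpc g) • cmp f) s).
        by exists (ap (cmp f) s).
      apply: etrans (etr_comp2 h hr) _.
      have E := @ecell_paste G (F x) z _ _ _ (compaA (larr G g) (tob p y) (larr F f))
        (lcell G (idpc g) • cmp f) (cmp g • idpc (larr F f)) s.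
      have {}E := etrans E (congr1 (hmul _) (ecell_idpc (cmp g) (larr F f) s)).
      exact: esym (congr1 (fun e => tot e) E).
  + move=> x y w z m n f g c; apply: ap_ceqP => // s.
    apply: (@es_eq _ _ _ _ _ (hom G)); rewrite -lax_cell_left -lax_cell_right.
    have [r hr hc] := etr_nat h (vrel_elem c s).
    by rewrite (vrel_fun (vrel_map_elem p c s) hr) hc.
- split.
  + by [].
  + by move=> u; rewrite /tot /=; congr existT; exact: (ap_ceq (h1 _) (pe u)).
  + move=> u y z f g r hr.
    have hr' : svrel (ecmp lax_etr u f) (ecell (lcell G (idpc g) • cmp f) (pe u)).
      by exists (ap (cmp f) (pe u)).
    rewrite (svrel_fun hr hr').
    have E := @ecell_paste G (F (po u)) z _ _ _ (compaA (larr G g) (tob p y) (larr F f))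
        (lcell G (idpc g) • cmp f) (cmp g • idpc (larr F f)) (pe u).
    have {}E := etrans E (congr1 (hmul _) (ecell_idpc (cmp g) (larr F f) (pe u))).
    apply: etrans (congr1 (fun e => tot e) E).
    by rewrite /tot /=; congr existT; exact: (ap_ceq (h2 _ _ _ _ _) (pe u)).
  + move=> [x u] [y v] w z /= f g [m n c] e e' h.
    change (pro x y) in (type of m).
    have [s [he _]] := h; have [l [r ee]] := tot_inv he.
    change (apex (lpro F m)) in s; change (@legl _ _ (lpro F m) s = u) in l.
    change (@legr _ _ (lpro F m) s = v) in r; clear he; subst u v e.
    rewrite (vrel_fun h (vrel_elem c s)).
    exists (map_elem p c s); first exact: vrel_map_elem.
    apply: el_eq; rewrite lax_cell_left lax_cell_right; congr existT.
    exact: (ap_ceq (h3 _ _ _ _ _ _ _ _ c) s).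
Qed.

End Lax.

Section Oplax.
Variables (F G : model) (p : pretrans F G).
Variable cmp : forall (x y : ob D) (f : arr x y),
  cell (idp (F x)) (lpro G (idp y)) (tob p y ∘ larr F f) (larr G f ∘ tob p x).

Definition oplax_laws : Prop :=
  [/\ forall x : ob D, cmp (ida x) ≡ unitor G x • idpc (tob p x),
      forall (x y z : ob D) (g : arr y z) (f : arr x y),
        cmp (g ∘ f) ≡ paste (esym (compaA _ _ _))
          (cmp g • idpc (larr F f)) (lcell G (idpc g) • cmp f)
    & forall (x y w z : ob D) (m : pro x y) (n : pro w z)
        (f : arr x w) (g : arr y z) (c : cell m n f g),
      lcell G (lun n) • (laxator G (idp w) n •
        ((cmp f ⊛ (lcell G c • tpro p m)) • lunV (lpro F m)))
        ≡ lcell G (run n) • (laxator G n (idp z) •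
        (((tpro p n • lcell F c) ⊛ cmp g) • runV (lpro F m)))].

Definition oplax_etr : etr true F G :=
  @Etr _ _ _ true F G p (fun u y f => ecell (cmp f) (pe u)).

Section OplaxCell.
Variables (x y w z : ob D) (m : pro x y) (n : pro w z) (f : arr x w) (g : arr y z).
Variables (c : cell m n f g) (s : apex (lpro F m)).

Lemma oplax_cell_left : tot (lact (ecmp oplax_etr (Pt x (lft s)) f) (map_elem p c s)) =
  existT _ n (ap (lcell G (lun n) • (laxator G (idp w) n •
        ((cmp f ⊛ (lcell G c • tpro p m)) • lunV (lpro F m)))) s).
Proof.
rewrite -[LHS](mcell_eqcell (M := hom G) _ (is_eqcell_lun n)) /tot; congr existT.
by congr (ap (lcell G (lun n)) (ap _ _)); apply: sig_eq.
Qed.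

Lemma oplax_cell_right : tot (ract (tpe p (elem_map c s)) (ecmp oplax_etr (Pt y (rgt s)) g)) =
  existT _ n (ap (lcell G (run n) • (laxator G n (idp z) •
        (((tpro p n • lcell F c) ⊛ cmp g) • runV (lpro F m)))) s).
Proof.
rewrite -[LHS](mcell_eqcell (M := hom G) _ (is_eqcell_run n)) /tot; congr existT.
by congr (ap (lcell G (run n)) (ap _ _)); apply: sig_eq.
Qed.

End OplaxCell.

Lemma oplax_etrP : is_etr oplax_etr <-> oplax_laws.
Proof.
split=> [h|[h1 h2 h3]].
- split.
  + move=> x; apply: ap_ceqP => [||s].
    * by rewrite larr_id.
    * by rewrite larr_id.
    * apply: (@es_eq _ _ _ _ _ (hom G)); exact: (etr_id h (Pt x s)).
  + move=> x y z g f; apply: ap_ceqP => [||s].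
    * by rewrite larr_comp.
    * by rewrite larr_comp.
    * apply: (@es_eq _ _ _ _ _ (hom G)).
      have hr : svrel (ecmp oplax_etr (Pt x s) f) (ecell (lcell G (idpc g) • cmp f) s).
        by exists (ap (cmp f) s).
      apply: etrans (etr_comp2 h hr) _.
      have E := @ecell_paste G (F x) z _ _ _ (esym (compaA (larr G g) (tob p y) (larr F f)))
        (cmp g • idpc (larr F f)) (lcell G (idpc g) • cmp f) s.
      have {}E := etrans E (congr1 (fun e => hmul e _) (ecell_idpc (cmp g) (larr F f) s)).
      exact: esym (congr1 (fun e => tot e) E).
  + move=> x y w z m n f g c; apply: ap_ceqP => // s.
    apply: (@es_eq _ _ _ _ _ (hom G)); rewrite -oplax_cell_left -oplax_cell_right.
    have [r hr hc] := etr_nat h (vrel_elem c s).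
    by rewrite (vrel_fun (vrel_map_elem p c s) hr) hc.
- split.
  + by [].
  + by move=> u; rewrite /tot /=; congr existT; exact: (ap_ceq (h1 _) (pe u)).
  + move=> u y z f g r hr.
    have hr' : svrel (ecmp oplax_etr u f) (ecell (lcell G (idpc g) • cmp f) (pe u)).
      by exists (ap (cmp f) (pe u)).
    rewrite (svrel_fun hr hr').
    have E := @ecell_paste G (F (po u)) z _ _ _ (esym (compaA (larr G g) (tob p y) (larr F f)))
        (cmp g • idpc (larr F f)) (lcell G (idpc g) • cmp f) (pe u).
    have {}E := etrans E (congr1 (fun e => hmul e _) (ecell_idpc (cmp g) (larr F f) (pe u))).
    apply: etrans (congr1 (fun e => tot e) E).
    by rewrite /tot /=; congr existT; exact: (ap_ceq (h2 _ _ _ _ _) (pe u)).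
  + move=> [x u] [y v] w z /= f g [m n c] e e' h.
    change (pro x y) in (type of m).
    have [s [he _]] := h; have [l [r ee]] := tot_inv he.
    change (apex (lpro F m)) in s; change (@legl _ _ (lpro F m) s = u) in l.
    change (@legr _ _ (lpro F m) s = v) in r; clear he; subst u v e.
    rewrite (vrel_fun h (vrel_elem c s)).
    exists (map_elem p c s); first exact: vrel_map_elem.
    apply: el_eq; rewrite oplax_cell_left oplax_cell_right; congr existT.
    exact: (ap_ceq (h3 _ _ _ _ _ _ _ _ c) s).
Qed.

End Oplax.

End MapLaws.

(** * Identity and composite maps *)

Section ModelMaps.
Variable D : strict_dbl.
Variables (PD : lax_finite_products D) (PE : lax_finite_products Span).
Local Notation model := (model PD PE).
Implicit Types F G H : model.

Lemma etr_eq o F G (a b : etr o F G) :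
  epre a = epre b ->
  (forall (u : pt F) y (f : arr (po u) y),
     @side_eq _ _ _ o G y y _ _ _ _ (ecmp a u f) (ecmp b u f)) ->
  a = b.
Proof.
case: a b => p c [p' c'] /= e; case: _ / e c' => c' h; congr Etr.
by do 3!apply: functional_extensionality_dep => ?; apply: side_eqP; apply: h.
Qed.

(** Both strictness and preservation of products are of this form: all
    comparisons, or those at the projections, are identities. *)
Definition strict_at o F G (a : etr o F G) (x y : ob D) (f : arr x y) : Prop :=
  forall u, @side_eq _ _ _ o G y y _ _ _ _ (ecmp a (Pt x u) f)
    (suid o (tpt a (ptmap (Pt x u) f))).

Lemma strict_at_one o F (x y : ob D) (f : arr x y) : strict_at (etr_one o F) f.
Proof. by move=> u; apply: side_eq_refl. Qed.

(** The comparisons of both factors are identities at [f], hence so is their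
    product; the end points match because an identity comparison makes the
    naturality square at [f] commute. *)
Lemma strict_at_comp o F G H (b : etr o G H) (a : etr o F G) (x y : ob D) (f : arr x y) :
  strict_at b f -> strict_at a f -> strict_at (etr_comp b a) f.
Proof.
move=> hb ha u.
have l : pe (ptmap (tpt a (Pt x u)) f) = pe (tpt a (ptmap (Pt x u) f)).
  move: (ecmp a (Pt x u) f) (ha u); rewrite /side_eq /suid.
  by case: o {b hb ha} a => a c /tot_legs[].
have h1 q : pe (ptmap (tpt a (Pt x u)) f) = q ->
    @side_eq _ _ _ o H y y _ _ _ _ (ecmp b (tpt a (Pt x u)) f) (suid o (tpt b (Pt y q))).
  by case: q /; apply: hb.
have h2 := side_eq_stpe b (ha u).
by have := side_eq_smul (h1 _ l) h2; rewrite stpe_suid smul1r.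
Qed.

Lemma etr_comp_one o F G (a : etr o F G) : etr_comp a (etr_one o F) = a.
Proof.
apply: etr_eq.
  by apply: pretrans_eq.
move=> u y f; rewrite /= stpe_suid smul1r; exact: side_eq_refl.
Qed.

Lemma etr_one_comp o F G (a : etr o F G) : etr_comp (etr_one o G) a = a.
Proof.
apply: etr_eq.
  by apply: pretrans_eq.
move=> u y f; rewrite /= smul1l.
by move: (ecmp a u f); rewrite /side_eq /stpe; case: o a => a c; rewrite (tpe_one c).
Qed.

Lemma etr_compA o F G H K (c : etr o H K) (b : etr o G H) (a : etr o F G) :
  etr_comp c (etr_comp b a) = etr_comp (etr_comp c b) a.
Proof.
apply: etr_eq.
  by apply: pretrans_eq.
move=> u y f; rewrite /= stpe_smul -smulA; apply: side_eq_smul; first exact: side_eq_refl.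
move: (ecmp a u f); rewrite /side_eq /stpe.
by case: o c b a => c b a j.
Qed.

Lemma ecell_tpro G H (b : pretrans G H) (X : ob Span) (w : ob D) (f g : arr X (G w))
    (c : cell (idp X) (lpro G (idp w)) f g) s :
  ecell (tpro b (idp w) • c) s = tpe b (ecell c s).
Proof. exact: el_eq. Qed.

Lemma paste_uidP G (X : ob Span) (w : ob D) (f g : arr X (G w))
    (a : cell (idp X) (lpro G (idp w)) f g) (b : cell (idp X) (lpro G (idp w)) g f) :
  paste erefl a b ≡ unitor G w • idpc f <->
  forall s, hmul (ecell a s) (ecell b s) = uid (Pt w (f s)).
Proof.
split=> [h s|h].
- rewrite -(ecell_paste erefl); apply: el_eq; rewrite /tot; congr existT; exact: (ap_ceq h s).
- apply: ap_ceqP => // s; apply: (@es_eq _ _ _ _ _ (hom G)).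
  have := congr1 (fun e => tot e) (h s); rewrite -(ecell_paste erefl); exact.
Qed.

(** ** Lax maps *)

Definition mk_lax F G (p : pretrans F G)
    (c : forall (x y : ob D) (f : arr x y),
      cell (idp (F x)) (lpro G (idp y)) (larr G f ∘ tob p x) (tob p y ∘ larr F f))
    (h : lax_laws c) : lax_trans F G :=
  LaxTrans (let: And3 h1 _ _ := h in h1) (let: And3 _ h2 _ := h in h2)
    (let: And3 _ _ h3 := h in h3).

Definition lax_map_etr F G (a : lax_trans F G) : etr false F G := lax_etr (@lt_cmp _ _ _ _ a).

Lemma lax_map_is_etr F G (a : lax_trans F G) : is_etr (lax_map_etr a).
Proof. by apply/lax_etrP; split; [exact: lt_cmp_id | exact: lt_cmp_comp | exact: lt_cell]. Qed.

Lemma lax_map_etr_inj F G (a b : lax_trans F G) : lax_map_etr a = lax_map_etr b -> a = b.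
Proof.
case: a b => p c h1 h2 h3 [p' c' h1' h2' h3'] h.
have e : p = p' := congr1 (@epre _ _ _ _ _ _) h.
case: _ / e c' h1' h2' h3' h => c' h1' h2' h3' h.
have e : c = c'.
  do 3!apply: functional_extensionality_dep => ?; apply: span_eq => s.
  apply: (@es_eq _ _ _ _ _ (hom G)).
  pose pk (q : etr false F G) : {p : pretrans F G & forall (u : pt F) y (f : arr (po u) y),
    side false (ptmap (tpt p u) f) (tpt p (ptmap u f))} := existT _ (epre q) (@ecmp _ _ _ _ _ _ q).
  have := inj_pair2 _ _ _ _ _ (congr1 pk h).
  move/(congr1 (fun k => tot (k (Pt _ s) _ _))); exact.
case: _ / e h1' h2' h3' {h} => h1' h2' h3'.
by rewrite (proof_irrelevance _ h1' h1) (proof_irrelevance _ h2' h2) (proof_irrelevance _ h3' h3).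
Qed.

Definition lax_one_cmp F (x y : ob D) (f : arr x y) :
    cell (idp (F x)) (lpro F (idp y))
      (larr F f ∘ tob (pre_id F) x) (tob (pre_id F) y ∘ larr F f) :=
  unitor F y • idpc (larr F f).

Definition lax_comp_cmp F G H (b : lax_trans G H) (a : lax_trans F G)
    (x y : ob D) (f : arr x y) :
    cell (idp (F x)) (lpro H (idp y))
      (larr H f ∘ tob (pre_comp b a) x) (tob (pre_comp b a) y ∘ larr F f) :=
  paste (esym (compaA _ _ _)) (lt_cmp b f • idpc (tob a x)) (tpro b (idp y) • lt_cmp a f).

Lemma lax_one_etr F : lax_etr (lax_one_cmp F) = etr_one false F.
Proof. by congr Etr; do 3!apply: functional_extensionality_dep => ?; apply: el_eq. Qed.

Lemma lax_comp_etr F G H (b : lax_trans G H) (a : lax_trans F G) :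
  lax_etr (lax_comp_cmp b a) = etr_comp (lax_map_etr b) (lax_map_etr a).
Proof.
congr Etr; apply: functional_extensionality_dep => u.
apply: functional_extensionality_dep => y; apply: functional_extensionality_dep => f.
have E := @ecell_paste _ _ _ H (F (po u)) y _ _ _ (esym (compaA (tob b y) (larr G f) (tob a (po u))))
  (lt_cmp b f • idpc (tob a (po u))) (tpro b (idp y) • lt_cmp a f) (pe u).
apply: etrans E _.
refine (f_equal2 (fun j k => hmul j k) (ecell_idpc (lt_cmp b f) (tob a (po u)) (pe u)) (ecell_tpro b (lt_cmp a f) (pe u))).
Qed.

Definition lax_map_one F : lax_trans F F.
Proof.
apply: (mk_lax (c := @lax_one_cmp F)).
by apply/lax_etrP; rewrite lax_one_etr; apply: is_etr_one.
Defined.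

Definition lax_map_comp F G H (b : lax_trans G H) (a : lax_trans F G) : lax_trans F H.
Proof.
apply: (mk_lax (c := lax_comp_cmp b a)).
by apply/lax_etrP; rewrite lax_comp_etr; apply: is_etr_comp; apply: lax_map_is_etr.
Defined.

(** ** Oplax maps *)

Definition mk_oplax F G (p : pretrans F G)
    (c : forall (x y : ob D) (f : arr x y),
      cell (idp (F x)) (lpro G (idp y)) (tob p y ∘ larr F f) (larr G f ∘ tob p x))
    (h : oplax_laws c) : oplax_trans F G :=
  OplaxTrans (let: And3 h1 _ _ := h in h1) (let: And3 _ h2 _ := h in h2)
    (let: And3 _ _ h3 := h in h3).

Definition oplax_map_etr F G (a : oplax_trans F G) : etr true F G := oplax_etr (@ot_cmp _ _ _ _ a).

Lemma oplax_map_is_etr F G (a : oplax_trans F G) : is_etr (oplax_map_etr a).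
Proof. by apply/oplax_etrP; split; [exact: ot_cmp_id | exact: ot_cmp_comp | exact: ot_cell]. Qed.

Lemma oplax_map_etr_inj F G (a b : oplax_trans F G) : oplax_map_etr a = oplax_map_etr b -> a = b.
Proof.
case: a b => p c h1 h2 h3 [p' c' h1' h2' h3'] h.
have e : p = p' := congr1 (@epre _ _ _ _ _ _) h.
case: _ / e c' h1' h2' h3' h => c' h1' h2' h3' h.
have e : c = c'.
  do 3!apply: functional_extensionality_dep => ?; apply: span_eq => s.
  apply: (@es_eq _ _ _ _ _ (hom G)).
  pose pk (q : etr true F G) : {p : pretrans F G & forall (u : pt F) y (f : arr (po u) y),
    side true (ptmap (tpt p u) f) (tpt p (ptmap u f))} := existT _ (epre q) (@ecmp _ _ _ _ _ _ q).
  have := inj_pair2 _ _ _ _ _ (congr1 pk h).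
  move/(congr1 (fun k => tot (k (Pt _ s) _ _))); exact.
case: _ / e h1' h2' h3' {h} => h1' h2' h3'.
by rewrite (proof_irrelevance _ h1' h1) (proof_irrelevance _ h2' h2) (proof_irrelevance _ h3' h3).
Qed.

Definition oplax_one_cmp F (x y : ob D) (f : arr x y) :
    cell (idp (F x)) (lpro F (idp y))
      (tob (pre_id F) y ∘ larr F f) (larr F f ∘ tob (pre_id F) x) :=
  unitor F y • idpc (larr F f).

Definition oplax_comp_cmp F G H (b : oplax_trans G H) (a : oplax_trans F G)
    (x y : ob D) (f : arr x y) :
    cell (idp (F x)) (lpro H (idp y))
      (tob (pre_comp b a) y ∘ larr F f) (larr H f ∘ tob (pre_comp b a) x) :=
  paste (compaA _ _ _) (tpro b (idp y) • ot_cmp a f) (ot_cmp b f • idpc (tob a x)).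

Lemma oplax_one_etr F : oplax_etr (oplax_one_cmp F) = etr_one true F.
Proof. by congr Etr; do 3!apply: functional_extensionality_dep => ?; apply: el_eq. Qed.

Lemma oplax_comp_etr F G H (b : oplax_trans G H) (a : oplax_trans F G) :
  oplax_etr (oplax_comp_cmp b a) = etr_comp (oplax_map_etr b) (oplax_map_etr a).
Proof.
congr Etr; apply: functional_extensionality_dep => u.
apply: functional_extensionality_dep => y; apply: functional_extensionality_dep => f.
have E := @ecell_paste _ _ _ H (F (po u)) y _ _ _ (compaA (tob b y) (larr G f) (tob a (po u)))
  (tpro b (idp y) • ot_cmp a f) (ot_cmp b f • idpc (tob a (po u))) (pe u).
apply: etrans E _.
refine (f_equal2 (fun j k => hmul j k) (ecell_tpro b (ot_cmp a f) (pe u)) (ecell_idpc (ot_cmp b f) (tob a (po u)) (pe u))).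
Qed.

Definition oplax_map_one F : oplax_trans F F.
Proof.
apply: (mk_oplax (c := @oplax_one_cmp F)).
by apply/oplax_etrP; rewrite oplax_one_etr; apply: is_etr_one.
Defined.

Definition oplax_map_comp F G H (b : oplax_trans G H) (a : oplax_trans F G) : oplax_trans F H.
Proof.
apply: (mk_oplax (c := oplax_comp_cmp b a)).
by apply/oplax_etrP; rewrite oplax_comp_etr; apply: is_etr_comp; apply: oplax_map_is_etr.
Defined.

(** ** Naturality squares that are filled by identities *)

Lemma strict_lax F G (p : pretrans F G) (c : forall (x y : ob D) (f : arr x y),
      cell (idp (F x)) (lpro G (idp y)) (larr G f ∘ tob p x) (tob p y ∘ larr F f))
    (x y : ob D) (f : arr x y) :
  strict_at (lax_etr c) f <->
  larr G f ∘ tob p x = tob p y ∘ larr F f /\ c x y f ≡ unitor G y • idpc (tob p y ∘ larr F f).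
Proof.
split=> [h|[e h] u]; last first.
  by rewrite /side_eq /tot; congr existT; exact: (ap_ceq h u).
have e : larr G f ∘ tob p x = tob p y ∘ larr F f.
  by apply: functional_extensionality => u; case: (tot_legs (h u)).
by split=> //; apply: ap_ceqP => // u; apply: (@es_eq _ _ _ _ _ (hom G)); exact: (h u).
Qed.

Lemma strict_oplax F G (p : pretrans F G) (c : forall (x y : ob D) (f : arr x y),
      cell (idp (F x)) (lpro G (idp y)) (tob p y ∘ larr F f) (larr G f ∘ tob p x))
    (x y : ob D) (f : arr x y) :
  strict_at (oplax_etr c) f <->
  larr G f ∘ tob p x = tob p y ∘ larr F f /\ c x y f ≡ unitor G y • idpc (tob p y ∘ larr F f).
Proof.
split=> [h|[e h] u]; last first.
  by rewrite /side_eq /tot; congr existT; exact: (ap_ceq h u).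
have e : larr G f ∘ tob p x = tob p y ∘ larr F f.
  by apply: functional_extensionality => u; case: (tot_legs (h u)).
by split=> //; apply: ap_ceqP => // u; apply: (@es_eq _ _ _ _ _ (hom G)); exact: (h u).
Qed.

Lemma strict_trans_one F : is_strict_trans (lax_map_one F).
Proof.
move=> x y f; apply/(strict_lax (@lax_one_cmp F)).
by rewrite lax_one_etr; apply: strict_at_one.
Qed.

Lemma strict_at_map_comp F G H (b : lax_trans G H) (a : lax_trans F G) (x y : ob D)
    (f : arr x y) :
  strict_at (lax_map_etr b) f -> strict_at (lax_map_etr a) f ->
  larr H f ∘ tob (lax_map_comp b a) x = tob (lax_map_comp b a) y ∘ larr F f /\
  lt_cmp (lax_map_comp b a) f ≡ unitor H y • idpc (tob (lax_map_comp b a) y ∘ larr F f).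
Proof.
move=> hb ha; apply/(strict_lax (lax_comp_cmp b a)).
by rewrite lax_comp_etr; apply: strict_at_comp.
Qed.

Lemma strict_trans_comp F G H (b : lax_trans G H) (a : lax_trans F G) :
  is_strict_trans b -> is_strict_trans a -> is_strict_trans (lax_map_comp b a).
Proof. by move=> hb ha x y f; apply: strict_at_map_comp; apply/strict_lax. Qed.

Lemma lax_preserves_one F : lax_trans_preserves PD (lax_map_one F).
Proof. by move=> X i; apply: strict_trans_one. Qed.

Lemma lax_preserves_comp F G H (b : lax_trans G H) (a : lax_trans F G) :
  lax_trans_preserves PD b -> lax_trans_preserves PD a ->
  lax_trans_preserves PD (lax_map_comp b a).
Proof. by move=> hb ha X i; apply: strict_at_map_comp; apply/strict_lax. Qed.

Lemma oplax_preserves_one F : oplax_trans_preserves PD (oplax_map_one F).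
Proof.
move=> X i; apply/(strict_oplax (@oplax_one_cmp F)).
by rewrite oplax_one_etr; apply: strict_at_one.
Qed.

Lemma oplax_preserves_comp F G H (b : oplax_trans G H) (a : oplax_trans F G) :
  oplax_trans_preserves PD b -> oplax_trans_preserves PD a ->
  oplax_trans_preserves PD (oplax_map_comp b a).
Proof.
move=> hb ha X i; apply/(strict_oplax (oplax_comp_cmp b a)).
by rewrite oplax_comp_etr; apply: strict_at_comp; apply/strict_oplax.
Qed.

Lemma pseudo_trans_one F : is_pseudo_trans (lax_map_one F).
Proof.
move=> x y f; exists (lax_one_cmp F f).
by split; apply/paste_uidP => s; apply: etrans (hmul1l _); congr hmul; apply: el_eq.
Qed.

Lemma hmul_inverse F (u v w : pt F) (a : el (hom F) u v) (b : el (hom F) v w)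
    (c : el (hom F) w v) (d : el (hom F) v u) :
  hmul b c = uid v -> hmul a d = uid u -> hmul (hmul a b) (hmul c d) = uid u.
Proof. by move=> h h'; rewrite hmulA -(hmulA b) h hmul1l. Qed.

(** The inverse of the comparison of a composite is the image under [b] of the
    inverse for [a], followed by the inverse for [b]. *)
Lemma pseudo_trans_comp F G H (b : lax_trans G H) (a : lax_trans F G) :
  is_pseudo_trans b -> is_pseudo_trans a -> is_pseudo_trans (lax_map_comp b a).
Proof.
move=> hb ha x y f.
have [ib [/paste_uidP hb1 /paste_uidP hb2]] := hb x y f.
have [ia [/paste_uidP ha1 /paste_uidP ha2]] := ha x y f.
pose ic : cell (idp (F x)) (lpro H (idp y))
    (tob (pre_comp b a) y ∘ larr F f) (larr H f ∘ tob (pre_comp b a) x) :=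
  paste (compaA _ _ _) (tpro b (idp y) • ia) (ib • idpc (tob a x)).
have E s : ecell (lax_comp_cmp b a f) s =
    hmul (ecell (lt_cmp b f) (tob a x s)) (tpe b (ecell (lt_cmp a f) s)).
  apply: etrans (@ecell_paste _ _ _ H (F x) y _ _ _
    (esym (compaA (tob b y) (larr G f) (tob a x)))
    (lt_cmp b f • idpc (tob a x)) (tpro b (idp y) • lt_cmp a f) s) _.
  exact: (f_equal2 (fun j k => hmul j k) (ecell_idpc (lt_cmp b f) (tob a x) s)
    (ecell_tpro b (lt_cmp a f) s)).
have E' s : ecell ic s =
    hmul (tpe b (ecell ia s)) (ecell ib (tob a x s)).
  apply: etrans (@ecell_paste _ _ _ H (F x) y _ _ _
    (compaA (tob b y) (larr G f) (tob a x))
    (tpro b (idp y) • ia) (ib • idpc (tob a x)) s) _.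
  exact: (f_equal2 (fun j k => hmul j k) (ecell_tpro b ia s) (ecell_idpc ib (tob a x) s)).
exists ic; split; apply/paste_uidP => s.
- apply: etrans (f_equal2 (fun j k => hmul j k) (E s) (E' s)) _.
  have h : hmul (tpe b (ecell (lt_cmp a f) s)) (tpe b (ecell ia s)) = uid _.
    by apply: etrans (esym (tpe_hmul b _ _)) _; rewrite ha1; apply: tpe_uid.
  exact: (hmul_inverse h (hb1 (tob a x s))).
- apply: etrans (f_equal2 (fun j k => hmul j k) (E' s) (E s)) _.
  have h : hmul (tpe b (ecell ia s)) (tpe b (ecell (lt_cmp a f) s)) = uid _.
    by apply: etrans (esym (tpe_hmul b _ _)) _; rewrite ha2; apply: tpe_uid.
  exact: (hmul_inverse (hb2 (tob a x s)) h).
Qed.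


(** ** Maps of all four kinds *)

Definition map_flag (k : map_kind) : bool := if k is Oplax then true else false.

Definition map_cmp (k : map_kind) F G (a : model_map k F G) :
    forall (u : pt F) y (f : arr (po u) y),
    side (map_flag k) (ptmap (tpt (map_trans a) u) f) (tpt (map_trans a) (ptmap u f)) :=
  match k return forall (a : model_map k F G) (u : pt F) y (f : arr (po u) y),
    side (map_flag k) (ptmap (tpt (map_trans a) u) f) (tpt (map_trans a) (ptmap u f)) with
  | Oplax => fun a => @ecmp _ _ _ _ _ _ (oplax_map_etr (sval a))
  | Strict => fun a => @ecmp _ _ _ _ _ _ (lax_map_etr (sval a))
  | Pseudo => fun a => @ecmp _ _ _ _ _ _ (lax_map_etr (sval a))
  | Lax => fun a => @ecmp _ _ _ _ _ _ (lax_map_etr (sval a))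
  end a.

(** Keeping [map_trans a] as the underlying transformation by conversion, the
    components of a multimodulation have their sides in the expected form for
    all four kinds. *)
Definition map_etr (k : map_kind) F G (a : model_map k F G) : etr (map_flag k) F G :=
  @Etr _ _ _ (map_flag k) F G (map_trans a) (@map_cmp k F G a).

Lemma map_is_etr (k : map_kind) F G (a : model_map k F G) : is_etr (map_etr a).
Proof. by case: k a => a; [exact: lax_map_is_etr..|exact: oplax_map_is_etr]. Qed.

(** Maps differ from such data only by proofs, so that the category laws for maps
    can be checked on elements. *)
Lemma map_etr_inj (k : map_kind) F G (a b : model_map k F G) : map_etr a = map_etr b -> a = b.
Proof.
by case: k a b => a b h; apply: sig_eq; [exact: lax_map_etr_inj h..|exact: oplax_map_etr_inj h].
Qed.

Definition model_map_one (k : map_kind) F : model_map k F F :=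
  match k return model_map k F F with
  | Strict => exist _ (lax_map_one F) (strict_trans_one F)
  | Pseudo => exist _ (lax_map_one F)
                (conj (pseudo_trans_one F) (lax_preserves_one F))
  | Lax => exist _ (lax_map_one F) (lax_preserves_one F)
  | Oplax => exist _ (oplax_map_one F) (oplax_preserves_one F)
  end.

Definition model_map_comp (k : map_kind) F G H :
    model_map k G H -> model_map k F G -> model_map k F H :=
  match k return model_map k G H -> model_map k F G -> model_map k F H with
  | Strict => fun b a => exist _ (lax_map_comp (sval b) (sval a))
      (strict_trans_comp (proj2_sig b) (proj2_sig a))
  | Pseudo => fun b a => exist _ (lax_map_comp (sval b) (sval a))
      (conj (pseudo_trans_comp (proj2_sig b).1 (proj2_sig a).1)
            (lax_preserves_comp (proj2_sig b).2 (proj2_sig a).2))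
  | Lax => fun b a => exist _ (lax_map_comp (sval b) (sval a))
      (lax_preserves_comp (proj2_sig b) (proj2_sig a))
  | Oplax => fun b a => exist _ (oplax_map_comp (sval b) (sval a))
      (oplax_preserves_comp (proj2_sig b) (proj2_sig a))
  end.

Lemma map_etr_one (k : map_kind) F : map_etr (model_map_one k F) = etr_one (map_flag k) F.
Proof. by case: k; [exact: lax_one_etr..|exact: oplax_one_etr]. Qed.

Lemma map_etr_comp (k : map_kind) F G H (b : model_map k G H) (a : model_map k F G) :
  map_etr (model_map_comp b a) = etr_comp (map_etr b) (map_etr a).
Proof.
by case: k b a => b a; [exact: lax_comp_etr..|exact: oplax_comp_etr].
Qed.

Lemma model_map_compA (k : map_kind) F G H K (c : model_map k H K) (b : model_map k G H)
    (a : model_map k F G) : model_map_comp c (model_map_comp b a) = model_map_comp (model_map_comp c b) a.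
Proof. by apply: map_etr_inj; rewrite !map_etr_comp etr_compA. Qed.

Lemma model_map_one_comp (k : map_kind) F G (a : model_map k F G) : model_map_comp (model_map_one k G) a = a.
Proof. by apply: map_etr_inj; rewrite map_etr_comp map_etr_one etr_one_comp. Qed.

Lemma model_map_comp_one (k : map_kind) F G (a : model_map k F G) : model_map_comp a (model_map_one k F) = a.
Proof. by apply: map_etr_inj; rewrite map_etr_comp map_etr_one etr_comp_one. Qed.

Lemma is_map_comp_model_map (k : map_kind) F G H (b : model_map k G H)
    (a : model_map k F G) : is_map_comp b a (model_map_comp b a).
Proof. by case: k b a => b a; split=> // *; exact: ceq_refl. Qed.

End ModelMaps.

(** * Paths with an element of their source *)

Section Tels.
Variable D : strict_dbl.
Variables (PD : lax_finite_products D) (PE : lax_finite_products Span).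
Local Notation model := (model PD PE).
Local Notation mpath := (Defs.path (@fp_module (sdc D) Span PD PE)).
Implicit Types F G H K : model.

Section Tel.
Variables (F F' : model) (s : mpath F F').

(** The arguments of the components of a multimodulation, as opposed to chains. *)
#[projections(primitive)] Record tel (u : pt F) (v : pt F') := Tel {
  tt : tpath s (po u) (po v);
  ts : apex (tsrc tt);
  tel_l : lft ts = pe u;
  tel_r : rgt ts = pe v
}.

Definition ttot u v (q : tel u v) : {t : tpath s (po u) (po v) & apex (tsrc t)} :=
  existT _ (tt q) (ts q).

Lemma tel_eq u v (q q' : tel u v) : ttot q = ttot q' -> q = q'.
Proof.
case: q q' => m a l r [m' a' l' r'] /= h.
rewrite /ttot /= in h; have e : m = m' := congr1 (@projT1 _ _) h.
case: _ / e a' l' r' h => a' l' r' h.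
have e : a = a' by exact: inj_pair2 h.
case: _ / e l' r' {h} => l' r'.
by rewrite (proof_irrelevance _ l' l) (proof_irrelevance _ r' r).
Qed.

Lemma ttot_inv u v (q : tel u v) t a :
  ttot q = existT _ t a -> exists l r, q = @Tel u v t a l r.
Proof.
case: q => m' s' l r /= h.
rewrite /ttot /= in h; have e : m' = t := congr1 (@projT1 _ _) h.
case: _ / e a h => a h; have e : s' = a by exact: inj_pair2 h.
by case: _ / e {h}; exists l, r.
Qed.

End Tel.

Definition tnilE F (u : pt F) : tel (pnil F) u u :=
  @Tel F F (pnil F) u u (tnil F (po u)) (pe u) erefl erefl.

Lemma tcons_comp F G H (M : fp_module F G) (s : mpath G H) u w v
    (m : el M u w) (q : tel s w v) : rgt (es m) = lft (ts q).
Proof. exact: etrans (el_r m) (esym (tel_l q)). Qed.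

Definition tconsE F G H (M : fp_module F G) (s : mpath G H) u w v
    (m : el M u w) (q : tel s w v) : tel (pcons M s) u v :=
  @Tel F H (pcons M s) u v (tcons M (em m) (tt q)) (pr (tcons_comp m q))
    (el_l m) (tel_r q).

(** Every such tuple is built from elements of the single modules, since the
    composite of spans consists of matching pairs. *)
Lemma tel_elim (P : forall F F' (s : mpath F F') u v, tel s u v -> Prop) :
  (forall F (u : pt F), P F F (pnil F) u u (tnilE u)) ->
  (forall F G H (M : fp_module F G) (s : mpath G H) u w v (m : el M u w) (q : tel s w v),
     P G H s w v q -> P F H (pcons M s) u v (tconsE m q)) ->
  forall F F' (s : mpath F F') u v (q : tel s u v), P F F' s u v q.
Proof.
move=> h0 h1 F F' s [x u] [y v] [t a l r].
change (tpath s x y) in t; change (apex (@tsrc _ _ _ _ F F' s x y t)) in a.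
(* With the points split into their fields, the end elements are variables that
   the equations [l] and [r] eliminate. *)
change (@legl _ _ (tsrc t) a = u) in l.
change (@legr _ _ (tsrc t) a = v) in r.
elim: t a u v l r => {F F' s x y} [F x|F G H M s x y z m t IH] a u v l r.
- change (F x : SET) in a; change (a = u) in l; change (a = v) in r; subst u v.
  rewrite (_ : Tel _ _ = tnilE (Pt x a)) //; exact: tel_eq.
- case: a l r => -[a b] e l r; change (rgt a = lft b) in e.
  change (lft a = u) in l; change (rgt b = v) in r.
  have := h1 _ _ _ _ _ _ _ _ (@El _ _ _ _ _ M (Pt x u) (Pt y (lft b)) m a l e) _
    (IH b (lft b) v erefl r).
  rewrite (_ : tconsE _ _ = @Tel _ _ (pcons M s) (Pt x u) (Pt z v) (tcons M m t)
    (exist (fun s => rgt s.1 = lft s.2) (a, b) e) l r) //.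
  apply: tel_eq; rewrite /ttot /=; congr existT; exact: sig_eq.
Qed.

(** [q'] arises from [q] by letting [b] act on the last entry.  The paths are
    those occurring in the law of right equivariance only up to an equation. *)
Definition rabs F F' (s : mpath F F') (u : pt F) (w v : pt F')
    (q : tel s u w) (b : el (hom F') w v) (q' : tel s u v) : Prop :=
  exists (t : tlast (em b) s (po u)) (a : apex (tsrc (tl_path t))) (h : rgt a = lft (es b)),
    ttot q = existT _ (tl_path t) a /\
    ttot q' = existT _ (tl_absorb t) (ap (tl_act t) (pr h)).

(** The two sides of a slide at an inner position, with paths given up to an
    equation as in [rabs]. *)
Definition inn F F' (s : mpath F F') (u : pt F) (v : pt F') (q q' : tel s u v) : Prop :=
  exists (t : tmid s (po u) (po v)) (a : apex (tm_src t)),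
    ttot q = existT _ (tm_left t) (ap (tm_actr t) a) /\
    ttot q' = existT _ (tm_right t) (ap (tm_actl t) a).

(** The image of [q] under a path of cells whose composite is [C]. *)
Definition vtel F F' (s : mpath F F') (u : pt F) (v : pt F') x y
    (f : arr (po u) x) (g : arr (po v) y) (C : hcell f g)
    (q : tel s u v) (q' : tel s (ptmap u f) (ptmap v g)) : Prop :=
  exists (t : tpath s (po u) (po v)) (t' : tpath s x y) (c : tcells t t' f g) (a : apex (tsrc t)),
    [/\ ttot q = existT _ t a, ttot q' = existT _ t' (ap (tcells_src c) a)
      & C = HCell (tcells_comp c)].

Lemma rabs_here F G (M : fp_module F G) u w v (m : el M u w) (b : el (hom G) w v) :
  rabs (tconsE m (tnilE w)) b (tconsE (ract m b) (tnilE v)).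
Proof.
have h : rgt (pr (tcons_comp m (tnilE w))) = lft (es b) by exact: esym (el_l b).
exists (tl_here (em b) M (em m)), (pr (tcons_comp m (tnilE w))), h; split=> //.
congr existT; apply: etrans _ (esym (ap_gcomp _ _ _)).
apply: etrans _ (esym (congr1 (ap _) (ap_gcomp _ _ _))); apply: sig_eq => /=; congr (_, _); last by rewrite (ap_legr (actr M (em m) (em b))); exact: esym (el_r b).
congr (ap _ _); exact: sig_eq.
Qed.

Lemma rabs_there F G H (M : fp_module F G) (s : mpath G H) u w v z (m : el M u w)
    (q : tel s w v) (b : el (hom H) v z) (q' : tel s w z) :
  rabs q b q' -> rabs (tconsE m q) b (tconsE m q').
Proof.
case=> t [a [h [/ttot_inv[l [r ->]] /ttot_inv[l' [r' ->]]]]].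
exists (tl_there M (em m) t), (pr (etrans (el_r m) (esym l) : rgt (es m) = lft a)), h.
split; rewrite /ttot; congr existT; first exact: sig_eq.
apply: etrans _ (esym (ap_gcomp _ _ _)); apply: sig_eq => /=; congr (_, _); congr (ap _ _); exact: sig_eq.
Qed.

(** The recursion by which [tl_act] reaches the last entry, on tuples. *)
Lemma rabs_ind (P : forall F F' (s : mpath F F') (u : pt F) (w v : pt F'),
    tel s u w -> el (hom F') w v -> tel s u v -> Prop) :
  (forall F G (M : fp_module F G) u w v (m : el M u w) (b : el (hom G) w v),
     P F G (pcons M (pnil G)) u w v (tconsE m (tnilE w)) b (tconsE (ract m b) (tnilE v))) ->
  (forall F G H (M : fp_module F G) (s : mpath G H) u w v z (m : el M u w)
     (q : tel s w v) (b : el (hom H) v z) (q' : tel s w z),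
     P G H s w v z q b q' ->
     P F H (pcons M s) u v z (tconsE m q) b (tconsE m q')) ->
  forall F F' (s : mpath F F') (u : pt F) (w v : pt F') (q : tel s u w) (b : el (hom F') w v)
    (q' : tel s u v), rabs q b q' -> P F F' s u w v q b q'.
Proof.
move=> h0 h1 F F' s [x u] [y w] [z v] q [p c l r] q' [t [a [i [E E']]]].
(* The acting element and its proarrow [p] stay fixed in the induction, which
   leads down to the entry that absorbs it. *)
change (pro y z) in p; change (tlast p s x) in t; change (apex (lpro F' p)) in c.
change (apex (@tsrc _ _ _ _ F F' s x y (tl_path t))) in a.
change (lft c = w) in l; change (rgt c = v) in r; change (rgt a = lft c) in i.
elim: t u w v q c l r q' a i E E' => {F F' s x} [F G M x m|F G H M s x x' m t IH] u w v q c l r q' a i.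
- case: a i => -[a a'] e i E E'; change (rgt a = a') in e; change (a' = lft c) in i.
  have := ttot_inv E; have := ttot_inv E'; case=> l2 [r2 e2] [l1 [r1 e1]].
  change (lft a = u) in l1.
  have := h0 _ _ M (Pt x u) (Pt y w) (Pt z v) (@El _ _ _ F G M (Pt x u) (Pt y w) m a l1 (etrans e r1))
    (@El _ _ _ G G (hom G) (Pt y w) (Pt z v) p c l r).
  congr P; apply: tel_eq; rewrite ?E ?E'.
  + by rewrite /ttot /=; congr existT; apply: sig_eq => /=; congr (_, _); exact: esym r1.
  + congr existT; apply: etrans _ (esym (ap_gcomp _ _ _)).
    apply: etrans _ (esym (congr1 (ap _) (ap_gcomp _ _ _))); apply: sig_eq => /=; congr (_, _).
      congr (ap _ _); exact: sig_eq.
    rewrite (ap_legr (actr M m p)); exact: esym r.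
- case: a i => -[a a'] e i E E'; change (rgt a = lft a') in e; change (rgt a' = lft c) in i.
  have := ttot_inv E; have := ttot_inv E'; case=> l2 [r2 e2] [l1 [r1 e1]].
  change (lft a = u) in l1; change (rgt a' = w) in r1.
  pose q0 := @Tel G H s (Pt x' (lft a')) (Pt y w) (tl_path t) a' erefl r1.
  have l0 : lft (ap (tl_act t) (pr i)) = lft a' by rewrite ap_legl.
  have r0 : rgt (ap (tl_act t) (pr i)) = v by rewrite ap_legr; exact: r.
  pose q0' := @Tel G H s (Pt x' (lft a')) (Pt z v) (tl_absorb t) (ap (tl_act t) (pr i)) l0 r0.
  have := h1 _ _ _ M s (Pt x u) _ _ _ (@El _ _ _ F G M (Pt x u) (Pt x' (lft a')) m a l1 e)
    q0 (@El _ _ _ H H (hom H) (Pt y w) (Pt z v) p c l r) q0' (IH _ _ _ q0 _ _ _ q0' _ i erefl erefl).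
  congr P; apply: tel_eq; rewrite ?E ?E'.
  + by rewrite /ttot /=; congr existT; apply: sig_eq.
  + congr existT; apply: etrans _ (esym (ap_gcomp _ _ _)); exact: sig_eq.
Qed.

Lemma inn_here F G H K (M : fp_module F G) (N : fp_module G H) (s : mpath H K)
    u w w' z v (m : el M u w) (b : el (hom G) w w') (n : el N w' z) (q : tel s z v) :
  inn (tconsE (ract m b) (tconsE n q)) (tconsE m (tconsE (lact b n) q)).
Proof.
have h1 : rgt (es b) = lft (pr (tcons_comp n q)) by exact: em_comp b n.
have h2 : rgt (es m) = lft (pr h1) by exact: em_comp m b.
exists (tm_here M N (em m) (em b) (em n) (tt q)), (pr h2); split.
- rewrite /ttot; congr existT; apply: etrans _ (esym (ap_gcomp _ _ _)); apply: sig_eq => /=; congr (_, _).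
  congr (ap _ _); exact: sig_eq.
- rewrite /ttot /=; congr existT; apply: sig_eq => /=; congr (_, _).
  apply: sig_eq => /=; congr (_, _); congr (ap _ _); exact: sig_eq.
Qed.

Lemma inn_there F G H (M : fp_module F G) (s : mpath G H) u w v (m : el M u w)
    (q q' : tel s w v) : inn q q' -> inn (tconsE m q) (tconsE m q').
Proof.
case=> t [a [/ttot_inv[l [r ->]] /ttot_inv[l' [r' ->]]]].
have h : rgt (es m) = lft a.
  by apply: etrans (el_r m) _; apply: etrans (esym l) _; rewrite ap_legl.
exists (tm_there M (em m) t), (pr h).
by split; rewrite /ttot /=; congr existT; apply: sig_eq.
Qed.

Lemma vtel_nil F (u : pt F) x (f : arr (po u) x) :
  vtel (HCell (idpc f)) (tnilE u) (tnilE (ptmap u f)).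
Proof. by exists (tnil F (po u)), (tnil F x), (tcnil F f), (pe u). Qed.

Lemma vtel_cons F G H (M : fp_module F G) (s : mpath G H) u w v x y z
    (f : arr (po u) x) (g : arr (po w) y) (h : arr (po v) z) (A : hcell f g) (C : hcell g h)
    (m : el M u w) m' (q : tel s w v) q' :
  vrel A m m' -> vtel C q q' -> vtel (hpaste A C) (tconsE m q) (tconsE m' q').
Proof.
case: A => m0 n0 c [a [/tot_inv[l [r ->]] /tot_inv[l' [r' ->]]]].
case=> t [t' [d [b [/ttot_inv[k [p ->]] /ttot_inv[k' [p' ->]] ->]]]].
exists (tcons M m0 t), (tcons M n0 t'), (tccons M c d).
exists (pr (etrans r (esym k) : rgt a = lft b)).
by split=> //; rewrite /ttot /=; congr existT; apply: sig_eq.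
Qed.

(** The recursion by which [tm_actr] and [tm_actl] reach the inner position, on
    tuples. *)
Lemma inn_ind (P : forall F F' (s : mpath F F') (u : pt F) (v : pt F'),
    tel s u v -> tel s u v -> Prop) :
  (forall F G H K (M : fp_module F G) (N : fp_module G H) (s : mpath H K)
     u w w' z v (m : el M u w) (b : el (hom G) w w') (n : el N w' z) (q : tel s z v),
     P F K (pcons M (pcons N s)) u v (tconsE (ract m b) (tconsE n q))
       (tconsE m (tconsE (lact b n) q))) ->
  (forall F G H (M : fp_module F G) (s : mpath G H) u w v (m : el M u w)
     (q q' : tel s w v), P G H s w v q q' ->
     P F H (pcons M s) u v (tconsE m q) (tconsE m q')) ->
  forall F F' (s : mpath F F') (u : pt F) (v : pt F') (q q' : tel s u v),
    inn q q' -> P F F' s u v q q'.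
Proof.
move=> h0 h1 F F' s [x u] [y v] q q' [t [a [E E']]].
change (tmid s x y) in t; change (apex (@tm_src _ _ _ _ F F' s x y t)) in a.
elim: t u v q q' a E E' => {F F' s x y}
  [F G H K M N s x y z w v0 m p n t|F G H M s x y z m t IH] u v q q' a E E'.
- have := ttot_inv E; have := ttot_inv E'; case=> l2 [r2 _] [l1 [r1 _]].
  rewrite ap_legl in l1; rewrite ap_legr in r1.
  case: a l1 r1 E E' {l2 r2} => -[a [[b [[c d] e3]] e2]] e1 l1 r1 E E'.
  change (rgt a = lft b) in e1; change (rgt b = lft c) in e2; change (rgt c = lft d) in e3.
  change (lft a = u) in l1; change (rgt d = v) in r1.
  have := h0 _ _ _ _ M N s (Pt x u) _ _ _ _
    (@El _ _ _ F G M (Pt x u) (Pt y (lft b)) m a l1 e1)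
    (@El _ _ _ G G (hom G) (Pt y (lft b)) (Pt z (lft c)) p b erefl e2)
    (@El _ _ _ G H N (Pt z (lft c)) (Pt w (lft d)) n c erefl e3)
    (@Tel H K s (Pt w (lft d)) (Pt v0 v) t d erefl r1).
  congr P; apply: tel_eq; rewrite ?E ?E'.
  + congr existT; apply: etrans _ (esym (ap_gcomp _ _ _)); apply: sig_eq => /=; congr (_, _).
      congr (ap _ _); exact: sig_eq.
    exact: sig_eq.
  + congr existT; apply: sig_eq => /=; congr (_, _).
    apply: sig_eq => /=; congr (_, _); congr (ap _ _); exact: sig_eq.
- have := ttot_inv E; have := ttot_inv E'; case=> l2 [r2 _] [l1 [r1 _]].
  rewrite ap_legl in l1; rewrite ap_legr in r1.
  case: a l1 r1 E E' {l2 r2} => -[a a'] e l1 r1 E E'; change (rgt a = lft a') in e.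
  change (lft a = u) in l1; change (rgt a' = v) in r1.
  pose q0 := @Tel G H s (Pt y (lft a')) (Pt z v) (tm_left t) (ap (tm_actr t) a')
    (ap_legl (tm_actr t) a') (etrans (ap_legr (tm_actr t) a') r1).
  pose q0' := @Tel G H s (Pt y (lft a')) (Pt z v) (tm_right t) (ap (tm_actl t) a')
    (ap_legl (tm_actl t) a') (etrans (ap_legr (tm_actl t) a') r1).
  have := h1 _ _ _ M s (Pt x u) _ _ (@El _ _ _ F G M (Pt x u) (Pt y (lft a')) m a l1 e)
    q0 q0' (IH _ _ q0 q0' a' erefl erefl).
  by congr P; apply: tel_eq; rewrite ?E ?E'; congr existT; apply: sig_eq.
Qed.

(** Cells of a path act entry by entry. *)
Lemma vtel_ind (P : forall F F' (s : mpath F F') (u : pt F) (v : pt F') x y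
    (f : arr (po u) x) (g : arr (po v) y), hcell f g ->
    tel s u v -> tel s (ptmap u f) (ptmap v g) -> Prop) :
  (forall F (u : pt F) x (f : arr (po u) x),
     P F F (pnil F) u u x x f f (HCell (idpc f)) (tnilE u) (tnilE (ptmap u f))) ->
  (forall F G H (M : fp_module F G) (s : mpath G H) u w v x y z
     (f : arr (po u) x) (g : arr (po w) y) (h : arr (po v) z) (A : hcell f g) (C : hcell g h)
     (m : el M u w) m' (q : tel s w v) q',
     vrel A m m' -> P G H s w v y z g h C q q' ->
     P F H (pcons M s) u v x z f h (hpaste A C) (tconsE m q) (tconsE m' q')) ->
  forall F F' (s : mpath F F') (u : pt F) (v : pt F') x y
    (f : arr (po u) x) (g : arr (po v) y) (C : hcell f g)
    (q : tel s u v) (q' : tel s (ptmap u f) (ptmap v g)),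
    vtel C q q' -> P F F' s u v x y f g C q q'.
Proof.
move=> h0 h1 F F' s [x u] [y v] x' y' /= f g C q q' [t [t' [c [a [E E' ->]]]]] {C}.
change (tpath s x y) in t; change (@tcells _ _ _ _ F F' s x y x' y' t t' f g) in c.
change (apex (@tsrc _ _ _ _ F F' s x y t)) in a.
elim: c u v q q' a E E' => {F F' s x y x' y' t t' f g}
  [F x x' f|F G H M s x y z x' y' z' m n t t' f g h k c IH] u v q q' a E E'.
- have [l [r _]] := ttot_inv E; change (a = u) in l; change (a = v) in r; subst u v.
  have := h0 F (Pt x a) x' f; congr P; apply: tel_eq; by rewrite ?E ?E'.
- case: a E E' => -[a a'] e E E'; have [l [r _]] := ttot_inv E.
  change (rgt a = lft a') in e; change (lft a = u) in l; change (rgt a' = v) in r.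
  pose m1 := @El _ _ _ F G M (Pt x u) (Pt y (lft a')) m a l e.
  have [m1' hm] := @vrel_ex _ _ _ F G M (Pt x u) (Pt y (lft a')) x' y' f g (HCell k) m1 erefl.
  pose q0 := @Tel G H s (Pt y (lft a')) (Pt z v) t a' erefl r.
  have l0 : lft (ap (tcells_src c) a') = larr G g (lft a') by rewrite ap_legl.
  have r0 : rgt (ap (tcells_src c) a') = larr H h v by rewrite ap_legr r.
  pose q0' := @Tel G H s (Pt y' (larr G g (lft a'))) (Pt z' (larr H h v)) t'
    (ap (tcells_src c) a') l0 r0.
  have := h1 _ _ _ M s (Pt x u) (Pt y (lft a')) (Pt z v) x' y' z' f g h (HCell k) (HCell (tcells_comp c)) m1 m1' q0 q0' hm
    (IH _ _ q0 q0' a' erefl erefl).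
  congr P; apply: tel_eq; rewrite ?E ?E'.
  + by congr existT; apply: sig_eq.
  + have [e1 [he1 /tot_inv[k1 [k2 ->]]]] := hm; have {}he1 : e1 = a by exact: esym (inj_pair2 _ _ _ _ _ he1).
    by congr existT; apply: sig_eq; rewrite /= he1.
Qed.

End Tels.

(** * The laws of multimodulations on elements *)

Section Components.
Variable D : strict_dbl.
Variables (PD : lax_finite_products D) (PE : lax_finite_products Span).
Local Notation model := (model PD PE).
Local Notation mpath := (Defs.path (@fp_module (sdc D) Span PD PE)).
Implicit Types F G H K : model.

Lemma is_eqcell_tl_coh F G (s : mpath F G) x y z (p : pro y z) (t : tlast p s x) :
  is_eqcell (tl_coh t).
Proof.
elim: t => {F G s x} [F G M x m|F G H M s x x' m t IH] /=.
- apply: is_eqcell_gcomp; first exact: is_eqcell_runV.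
  apply: is_eqcell_hcomp; [exact: is_eqcell_run | exact: is_eqcell_idc].
- apply: is_eqcell_gcomp; last exact: is_eqcell_assoc.
  exact: is_eqcell_hcomp (is_eqcell_idc m) IH.
Qed.

Lemma is_eqcell_tm_coh F G (s : mpath F G) x y (t : tmid s x y) : is_eqcell (tm_coh t).
Proof.
elim: t => {F G s x y} [F G H K M N s x y z w v m p n t|F G H M s x y z m t IH] /=.
- apply: is_eqcell_gcomp; last exact: is_eqcell_assoc.
  apply: is_eqcell_hcomp; [exact: is_eqcell_idc | exact: is_eqcell_assocV].
- exact: is_eqcell_hcomp (is_eqcell_idc m) IH.
Qed.

Section Tval.
Variables (F F' G G' : model) (s : mpath F F') (N : fp_module G G').
Variables (a : pretrans F G) (b : pretrans F' G') (mu : components s N a b).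

(** The value at a tuple, packed with the composite of the path, over which it
    lies. *)
Definition cval (u : pt F) (v : pt F') (q : tel s u v) : el N (tpt a u) (tpt b v) :=
  @El _ _ _ G G' N (tpt a u) (tpt b v) (tcomp (tt q)) (ap (mu (tt q)) (ts q))
    (etrans (ap_legl _ _) (congr1 _ (tel_l q))) (etrans (ap_legr _ _) (congr1 _ (tel_r q))).

Definition tel_of x y (t : tpath s x y) (e : apex (tsrc t)) :
    tel s (Pt x (lft e)) (Pt y (rgt e)) :=
  @Tel _ _ _ F F' s (Pt x (lft e)) (Pt y (rgt e)) t e erefl erefl.

(** The coherence cell in the law is an equality cell, so that the law is an
    equation between elements of [N]; its instances at elements are the slides
    of [rabs]. *)
Lemma right_equivarianceP : right_equivariance mu <->
  forall (u : pt F) (w v : pt F') (q : tel s u w) (c : el (hom F') w v) (q' : tel s u v),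
    rabs q c q' -> cval q' = ract (cval q) (tpe b c).
Proof.
split=> [h u w v q c q'|h x y z p t].
- case=> t [e [i [/ttot_inv[l [r ->]] /ttot_inv[l' [r' ->]]]]]; apply: el_eq.
  rewrite -[RHS](mcell_eqcell _ (is_eqcell_tl_coh t)); congr existT.
  apply: etrans (ap_ceq (h _ _ _ _ t) (pr i)) _.
  congr (ap _ (ap _ _)); exact: sig_eq.
- apply: ap_ceqP => [||-[[e c] i]]; [by rewrite larr_id|by rewrite larr_id|]; change (rgt e = lft c) in i; apply: (@es_eq _ _ _ _ _ N).
  pose q := tel_of e.
  pose c' : el (hom F') (Pt y (rgt e)) (Pt z (rgt c)) :=
    @El _ _ _ F' F' (hom F') (Pt y (rgt e)) (Pt z (rgt c)) p c (esym i) erefl.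
  pose q' : tel s (Pt x (lft e)) (Pt z (rgt c)) :=
    @Tel _ _ _ F F' s (Pt x (lft e)) (Pt z (rgt c)) (tl_absorb t) (ap (tl_act t) (pr i))
      (ap_legl (tl_act t) _) (ap_legr (tl_act t) _).
  have E : rabs q c' q' by exists t, e, i.
  have := congr1 (fun e => tot e) (h _ _ _ _ _ _ E).
  rewrite -[RHS](mcell_eqcell _ (is_eqcell_tl_coh t)) /tot => E'.
  apply: etrans E' _; congr existT; congr (ap _ (ap _ _)); exact: sig_eq.
Qed.

Lemma inner_equivarianceP : inner_equivariance mu <->
  forall (u : pt F) (v : pt F') (q q' : tel s u v), inn q q' -> cval q = cval q'.
Proof.
split=> [h u v q q'|h x y t].
- case=> t [e [/ttot_inv[l [r ->]] /ttot_inv[l' [r' ->]]]]; apply: el_eq.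
  rewrite -[LHS](mcell_eqcell _ (is_eqcell_tm_coh t)); congr existT.
  exact: (ap_ceq (h _ _ t) e).
- apply: ap_ceqP => [||e]; [by rewrite larr_id|by rewrite larr_id|]; apply: (@es_eq _ _ _ _ _ N).
  pose q : tel s (Pt x (lft e)) (Pt y (rgt e)) :=
    @Tel _ _ _ F F' s (Pt x (lft e)) (Pt y (rgt e)) (tm_left t) (ap (tm_actr t) e)
      (ap_legl (tm_actr t) _) (ap_legr (tm_actr t) _).
  pose q' : tel s (Pt x (lft e)) (Pt y (rgt e)) :=
    @Tel _ _ _ F F' s (Pt x (lft e)) (Pt y (rgt e)) (tm_right t) (ap (tm_actl t) e)
      (ap_legl (tm_actl t) _) (ap_legr (tm_actl t) _).
  have E : inn q q' by exists t, e.
  have := congr1 (fun e => tot e) (h _ _ _ _ E).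
  by rewrite -[LHS](mcell_eqcell _ (is_eqcell_tm_coh t)).
Qed.

Definition tel_map x y x' y' (t : tpath s x y) (t' : tpath s x' y') (f : arr x x')
    (g : arr y y') (c : tcells t t' f g) (e : apex (tsrc t)) :
    tel s (ptmap (Pt x (lft e)) f) (ptmap (Pt y (rgt e)) g) :=
  @Tel _ _ _ F F' s (ptmap (Pt x (lft e)) f) (ptmap (Pt y (rgt e)) g)
    t' (ap (tcells_src c) e) (ap_legl (tcells_src c) _) (ap_legr (tcells_src c) _).

Lemma vtel_map x y x' y' (t : tpath s x y) (t' : tpath s x' y') (f : arr x x') (g : arr y y')
    (c : tcells t t' f g) (e : apex (tsrc t)) :
  @vtel _ _ _ F F' s (Pt x (lft e)) (Pt y (rgt e)) x' y' f g (HCell (tcells_comp c))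
    (tel_of e) (tel_map c e).
Proof. by exists t, t', c, e. Qed.

Lemma vtel_elim (P : forall (u : pt F) (v : pt F') x y (f : arr (po u) x) (g : arr (po v) y)
    (C : hcell f g), tel s u v -> tel s (ptmap u f) (ptmap v g) -> Prop) :
  (forall x y x' y' (t : tpath s x y) (t' : tpath s x' y') (f : arr x x') (g : arr y y')
     (c : tcells t t' f g) (e : apex (tsrc t)),
     P (Pt x (lft e)) (Pt y (rgt e)) x' y' f g (HCell (tcells_comp c)) (tel_of e) (tel_map c e)) ->
  forall u v x y f g C q q', @vtel _ _ _ F F' s u v x y f g C q q' -> P u v x y f g C q q'.
Proof.
move=> h [x u] [y v] x' y' /= f g C q q' [t [t' [c [e [hq hq' ->]]]]].
change (tpath s x y) in t; change (@tcells _ _ _ _ F F' s x y x' y' t t' f g) in c.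
change (apex (@tsrc _ _ _ _ F F' s x y t)) in e.
have [l [r eq]] := ttot_inv hq; have [l' [r' eq']] := ttot_inv hq'.
clear hq hq'; change (@legl _ _ (tsrc t) e = u) in l; change (@legr _ _ (tsrc t) e = v) in r.
subst u v; have -> : q' = tel_map c e by rewrite eq'; apply: tel_eq.
have -> : q = tel_of e by rewrite eq; apply: tel_eq.
exact: h.
Qed.

Section Cell.
Variables (x y x' y' : ob D) (t : tpath s x y) (t' : tpath s x' y') (f : arr x x')
  (g : arr y y') (c : tcells t t' f g) (e : apex (tsrc t)).

Definition cval_map : el N (ptmap (tpt a (Pt x (lft e))) f) (ptmap (tpt b (Pt y (rgt e))) g) :=
  @El _ _ _ G G' N (ptmap (tpt a (Pt x (lft e))) f) (ptmap (tpt b (Pt y (rgt e))) g)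
    (tcomp t') (ap (mcell N (tcells_comp c) • mu t) e)
    (ap_legl (mcell N (tcells_comp c) • mu t) e) (ap_legr (mcell N (tcells_comp c) • mu t) e).

Lemma vrel_cval_map : @vrel _ _ _ G G' N (tpt a (Pt x (lft e))) (tpt b (Pt y (rgt e)))
  x' y' f g (HCell (tcells_comp c)) (cval (tel_of e)) cval_map.
Proof. by exists (ap (mu t) e). Qed.

End Cell.

End Tval.

Lemma left_equivarianceP F F1 F' G G' (M : fp_module F F1) (s : mpath F1 F')
    (N : fp_module G G') (a : pretrans F G) (b : pretrans F' G')
    (mu : components (pcons M s) N a b) : left_equivariance mu <->
  forall (u v : pt F) (w : pt F1) (z : pt F') (c : el (hom F) u v) (m : el M v w)
      (q : tel s w z),
    cval mu (tconsE (lact c m) q) = lact (tpe a c) (cval mu (tconsE m q)).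
Proof.
split=> [h u v w z c m q|h w x y z p m t].
- apply: el_eq; rewrite -[LHS](mcell_eqcell _ (is_eqcell_assoc (em c) (em m) (tcomp (tt q)))).
  congr existT.
  have i : rgt (es c) = lft (pr (tcons_comp m q)) by exact: em_comp c m.
  apply: etrans (etrans _ (ap_ceq (h _ _ _ _ (em c) (em m) (tt q)) (pr i))) _.
  + congr (ap _ (ap _ _)); apply: sig_eq => /=; congr (_, _); congr (ap _ _); exact: sig_eq.
  + transitivity (ap (actl N (em c) (em m ⊙ tcomp (tt q)))
      (ap (tpro a (em c) ⊛ mu _ _ (tcons M (em m) (tt q))) (pr i))); first by [].
    congr (ap _ _); exact: sig_eq.
- apply: ap_ceqP => [||-[[c [[e k] j]] i]]; [by rewrite larr_id|by rewrite larr_id|]; apply: (@es_eq _ _ _ _ _ N).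
  change (rgt e = lft k) in j; change (rgt c = lft e) in i.
  pose q := tel_of k.
  pose m' : el M (Pt x (lft e)) (Pt y (lft k)) :=
    @El _ _ _ F F1 M (Pt x (lft e)) (Pt y (lft k)) m e erefl j.
  pose c' : el (hom F) (Pt w (lft c)) (Pt x (lft e)) :=
    @El _ _ _ F F (hom F) (Pt w (lft c)) (Pt x (lft e)) p c erefl i.
  have := congr1 (fun e => tot e) (h _ _ _ _ c' m' q).
  rewrite -[LHS](mcell_eqcell _ (is_eqcell_assoc p m (tcomp t))) /tot => E.
  apply: etrans (etrans _ E) _; congr existT.
  + congr (ap _ (ap _ _)); apply: sig_eq => /=; congr (_, _); congr (ap _ _); exact: sig_eq.
  + congr (ap _ _); apply: sig_eq => //=; congr (_, _); congr (ap _ _); exact: sig_eq.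
Qed.

Lemma nullary_equivarianceP F G G' (N : fp_module G G') (a : pretrans F G)
    (b : pretrans F G') (mu : components (pnil F) N a b) : nullary_equivariance mu <->
  forall (u v : pt F) (c : el (hom F) u v),
    lact (tpe a c) (cval mu (tnilE v)) = ract (cval mu (tnilE u)) (tpe b c).
Proof.
split=> [h u v c|h x y p].
- apply: el_eq; rewrite -[LHS](mcell_eqcell _ (is_eqcell_run (em c))).
  rewrite -[RHS](mcell_eqcell _ (is_eqcell_lun (em c))); congr existT.
  apply: etrans (etrans _ (ap_ceq (h _ _ (em c)) (es c))) _.
  + congr (ap _ (ap _ _)); apply: sig_eq => /=; congr (_, _); congr (ap _ _).
    exact: esym (el_r c).
  + congr (ap _ (ap _ _)); apply: sig_eq => /=; congr (_, _); congr (ap _ _).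
    exact: (el_l c).
- apply: ap_ceqP => [||c]; [by rewrite larr_id|by rewrite larr_id|]; apply: (@es_eq _ _ _ _ _ N).
  pose c' : el (hom F) (Pt x (lft c)) (Pt y (rgt c)) :=
    @El _ _ _ F F (hom F) (Pt x (lft c)) (Pt y (rgt c)) p c erefl erefl.
  have := congr1 (fun e => tot e) (h _ _ c').
  rewrite -[LHS](mcell_eqcell _ (is_eqcell_run p)) -[RHS](mcell_eqcell _ (is_eqcell_lun p)).
  move=> E; apply: etrans (etrans _ E) _; congr existT.
  + congr (ap _ (ap _ _)); exact: sig_eq.
  + congr (ap _ (ap _ _)); exact: sig_eq.
Qed.

Section LaxNaturality.
Variables (F F' G G' : model) (s : mpath F F') (N : fp_module G G').
Variables (a : lax_trans F G) (b : lax_trans F' G') (mu : components s N a b).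

Lemma lax_naturalityP : lax_naturality mu <->
  forall (u : pt F) (v : pt F') x y (f : arr (po u) x) (g : arr (po v) y) (C : hcell f g)
    (q : tel s u v) (q' : tel s (ptmap u f) (ptmap v g)),
    vtel C q q' -> @square _ _ _ false G G' N (tpt a u) (tpt b v) x y f g C _ _
      (cval mu q) (cval mu q') (ecmp (lax_map_etr a) u f) (ecmp (lax_map_etr b) v g).
Proof.
have L x y x' y' (t : tpath s x y) (t' : tpath s x' y') (f : arr x x') (g : arr y y')
    (c : tcells t t' f g) (e : apex (tsrc t)) :
    tot (ract (cval_map mu c e) (ecmp (lax_map_etr b) (Pt y (rgt e)) g)) =
    existT _ (tcomp t') (ap (mcell N (run (tcomp t')) • (actr N (tcomp t') (idp y') •
      (((mcell N (tcells_comp c) • mu t) ⊛ lt_cmp b g) • runV (tsrc t)))) e).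
  rewrite -[LHS](mcell_eqcell _ (is_eqcell_run (tcomp t'))); congr existT.
  by congr (ap _ (ap _ _)); apply: sig_eq.
have R x y x' y' (t : tpath s x y) (t' : tpath s x' y') (f : arr x x') (g : arr y y')
    (c : tcells t t' f g) (e : apex (tsrc t)) :
    tot (lact (ecmp (lax_map_etr a) (Pt x (lft e)) f) (cval mu (tel_map c e))) =
    existT _ (tcomp t') (ap (mcell N (lun (tcomp t')) • (actl N (idp x') (tcomp t') •
      ((lt_cmp a f ⊛ (mu t' • tcells_src c)) • lunV (tsrc t)))) e).
  rewrite -[LHS](mcell_eqcell _ (is_eqcell_lun (tcomp t'))); congr existT.
  by congr (ap _ (ap _ _)); apply: sig_eq.
split=> [h|h x y x' y' t t' f g c].
- apply: vtel_elim => x y x' y' t t' f g c e.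
  exists (cval_map mu c e); first exact: vrel_cval_map.
  apply: el_eq; rewrite L R; congr existT; exact: (ap_ceq (h _ _ _ _ _ _ _ _ c) e).
- apply: ap_ceqP => // e; apply: (@es_eq _ _ _ _ _ N); rewrite -L -R.
  have [r hr hc] := h _ _ _ _ _ _ _ _ _ (vtel_map c e).
  by rewrite (vrel_fun (vrel_cval_map mu c e) hr) hc.
Qed.

End LaxNaturality.

Section OplaxNaturality.
Variables (F F' G G' : model) (s : mpath F F') (N : fp_module G G').
Variables (a : oplax_trans F G) (b : oplax_trans F' G') (mu : components s N a b).

Lemma oplax_naturalityP : oplax_naturality mu <->
  forall (u : pt F) (v : pt F') x y (f : arr (po u) x) (g : arr (po v) y) (C : hcell f g)
    (q : tel s u v) (q' : tel s (ptmap u f) (ptmap v g)),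
    vtel C q q' -> @square _ _ _ true G G' N (tpt a u) (tpt b v) x y f g C _ _
      (cval mu q) (cval mu q') (ecmp (oplax_map_etr a) u f) (ecmp (oplax_map_etr b) v g).
Proof.
have L x y x' y' (t : tpath s x y) (t' : tpath s x' y') (f : arr x x') (g : arr y y')
    (c : tcells t t' f g) (e : apex (tsrc t)) :
    tot (lact (ecmp (oplax_map_etr a) (Pt x (lft e)) f) (cval_map mu c e)) =
    existT _ (tcomp t') (ap (mcell N (lun (tcomp t')) • (actl N (idp x') (tcomp t') •
      ((ot_cmp a f ⊛ (mcell N (tcells_comp c) • mu t)) • lunV (tsrc t)))) e).
  rewrite -[LHS](mcell_eqcell _ (is_eqcell_lun (tcomp t'))); congr existT.
  by congr (ap _ (ap _ _)); apply: sig_eq.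
have R x y x' y' (t : tpath s x y) (t' : tpath s x' y') (f : arr x x') (g : arr y y')
    (c : tcells t t' f g) (e : apex (tsrc t)) :
    tot (ract (cval mu (tel_map c e)) (ecmp (oplax_map_etr b) (Pt y (rgt e)) g)) =
    existT _ (tcomp t') (ap (mcell N (run (tcomp t')) • (actr N (tcomp t') (idp y') •
      (((mu t' • tcells_src c) ⊛ ot_cmp b g) • runV (tsrc t)))) e).
  rewrite -[LHS](mcell_eqcell _ (is_eqcell_run (tcomp t'))); congr existT.
  by congr (ap _ (ap _ _)); apply: sig_eq.
split=> [h|h x y x' y' t t' f g c].
- apply: vtel_elim => x y x' y' t t' f g c e.
  exists (cval_map mu c e); first exact: vrel_cval_map.
  apply: el_eq; rewrite L R; congr existT; exact: (ap_ceq (h _ _ _ _ _ _ _ _ c) e).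
- apply: ap_ceqP => // e; apply: (@es_eq _ _ _ _ _ N); rewrite -L -R.
  have [r hr hc] := h _ _ _ _ _ _ _ _ _ (vtel_map c e).
  by rewrite (vrel_fun (vrel_cval_map mu c e) hr) hc.
Qed.

End OplaxNaturality.

Lemma naturalityP k (F F' G G' : model) (s : mpath F F') (N : fp_module G G')
    (a : model_map k F G) (b : model_map k F' G')
    (mu : components s N (map_trans a) (map_trans b)) : naturality mu <->
  forall (u : pt F) (v : pt F') x y (f : arr (po u) x) (g : arr (po v) y) (C : hcell f g)
    (q : tel s u v) (q' : tel s (ptmap u f) (ptmap v g)),
    vtel C q q' -> @square _ _ _ (map_flag k) G G' N (tpt (map_trans a) u)
      (tpt (map_trans b) v) x y f g C _ _
      (cval mu q) (cval mu q') (ecmp (map_etr a) u f) (ecmp (map_etr b) v g).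
Proof.
by case: k a b mu => a b mu; [exact: lax_naturalityP..|exact: oplax_naturalityP].
Qed.

End Components.

(** * Multimodulations as functions on chains *)

Section ChainFunctions.
Variable D : strict_dbl.
Variables (PD : lax_finite_products D) (PE : lax_finite_products Span).
Local Notation model := (model PD PE).
Local Notation mpath := (Defs.path (@fp_module (sdc D) Span PD PE)).
Implicit Types F G H K : model.

(** Squares paste along a common side. *)
Lemma square_ract o F G (M : fp_module F G) (U U' : pt F) (V V' W W' : pt G) x y z
    (f : arr (po U) x) (g : arr (po V) y) (h : arr (po W) z) (A : hcell f g) (B : hcell g h)
    (e : el M U V) (e' : el M U' V') (c : el (hom G) V W) (c' : el (hom G) V' W')
    (j : side o (ptmap U f) U') (k : side o (ptmap V g) V') (l : side o (ptmap W h) W') :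
  square A e e' j k -> square B c c' k l -> square (hpaste A B) (ract e c) (ract e' c') j l.
Proof.
case=> r hr hc [q hq hc']; exists (ract r q); first exact: vrel_ract.
move: j k l hc hc'; rewrite /comm; case: o => j k l hc hc'.
- by rewrite -lact_ract hc !ract_hmul; congr ract; exact: hc'.
- by rewrite ract_hmul -lact_ract -hc ract_hmul; congr ract; exact: hc'.
Qed.

(** A multimodulation on elements.  The laws [cmod_l] and [cmod_r] contain the
    outer equivariances, and for the empty path also the nullary one: an element
    of a model is a chain that can be multiplied from either side. *)
Record cmod o F F' G G' (s : mpath F F') (N : fp_module G G')
    (a : etr o F G) (b : etr o F' G') := Cmod {
  cmod_fun : forall u v, chain s u v -> el N (tpt a u) (tpt b v);
  cmod_over : forall u v (x : chain s u v), em (cmod_fun x) = chain_pro x;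
  cmod_step : forall u v (x x' : chain s u v), chain_step x x' -> cmod_fun x = cmod_fun x';
  cmod_l : forall u u' v (c : el (hom F) u u') (x : chain s u' v),
    cmod_fun (clact c x) = lact (tpe a c) (cmod_fun x);
  cmod_r : forall u v v' (x : chain s u v) (c : el (hom F') v v'),
    cmod_fun (cract x c) = ract (cmod_fun x) (tpe b c);
  cmod_nat : forall u v x y (f : arr (po u) x) (g : arr (po v) y) (C : hcell f g)
      (t : chain s u v) t',
    cvrel C t t' -> @square _ _ _ o G G' N (tpt a u) (tpt b v) x y f g C _ _
      (cmod_fun t) (cmod_fun t') (ecmp a u f) (ecmp b v g)
}.

Lemma cmod_eq o F F' G G' (s : mpath F F') (N : fp_module G G')
    (a : etr o F G) (b : etr o F' G') (p : cmod s N a b) u v (x x' : chain s u v) :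
  chain_eq x x' -> cmod_fun p x = cmod_fun p x'.
Proof. by apply: clos_eq => y y'; apply: cmod_step. Qed.

(** ** From multimodulations to functions on chains *)

Record nform F F' (s : mpath F F') (u : pt F) (v : pt F') := NForm {
  nw : pt F';
  nq : tel s u nw;
  nb : el (hom F') nw v
}.
Arguments NForm {F F' s u v nw} nq nb.

(** Every interposed element is moved to the factor on its right.  The last one
    has no such factor and remains; for the empty path it is the whole chain. *)
Fixpoint lnorm F F' (s : mpath F F') : forall u v, chain s u v -> nform s u v :=
  match s in Defs.path _ F F' return forall u v, chain s u v -> nform s u v with
  | pnil F => fun u v x => @NForm F F (pnil F) u v u (tnilE u) x
  | pcons F G H M s' => fun u v x =>
      NForm (tconsE (lact (link_a x) (link_m x)) (nq (lnorm (link_t x)))) (nb (lnorm (link_t x)))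
  end.

(** Stated for a function [p] of tuples with a fixed first end point, so that in
    the induction the first entry can be absorbed into [p]. *)
Lemma lnorm_step F F' (s : mpath F F') G G' (N : fp_module G G') (b : pretrans F' G')
    (u : pt F) (U : pt G) (p : forall w, tel s u w -> el N U (tpt b w)) :
  (forall w v (q : tel s u w) (c : el (hom F') w v) (q' : tel s u v),
     rabs q c q' -> p v q' = ract (p w q) (tpe b c)) ->
  (forall v (q q' : tel s u v), inn q q' -> p v q = p v q') ->
  forall v (x x' : chain s u v), chain_step x x' ->
  ract (p _ (nq (lnorm x))) (tpe b (nb (lnorm x))) =
  ract (p _ (nq (lnorm x'))) (tpe b (nb (lnorm x'))).
Proof.
elim: s b u p => [//|K L {}F' M s IH] b u p hr hi v x x'.
case=> {x x'} [w1 w2 w3 c d m y|w1 w2 w3 c m d y|w1 w2 c m y y' h] /=.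
- by rewrite lact_hmul.
- rewrite -lact_ract; case: s M b v w2 w3 m d p hr hi y {IH} => [{}L|{}L H {}F' Q s] M b v w2 w3 m d p hr hi y /=.
  + by rewrite (hr _ _ _ _ _ (rabs_here (lact c m) d)) tpe_hmul ract_hmul.
  + by rewrite lact_hmul (hi _ _ _ (inn_here _ _ _ _)).
- apply: (IH b w2 (fun w q => p w (tconsE (lact c m) q)) _ _ v y y' h).
  + by move=> w v0 q e q' hq; apply: hr; apply: rabs_there.
  + by move=> v0 q q' hq; apply: hi; apply: inn_there.
Qed.

Variant vnform F F' (s : mpath F F') (u : pt F) (v : pt F') x y
    (f : arr (po u) x) (g : arr (po v) y) :
    hcell f g -> nform s u v -> nform s (ptmap u f) (ptmap v g) -> Prop :=
| VNForm w z (h : arr (po w) z) (A : hcell f h) (B : hcell h g)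
    (q : tel s u w) (c : el (hom F') w v) (q' : tel s (ptmap u f) (ptmap w h))
    (c' : el (hom F') (ptmap w h) (ptmap v g)) :
    vtel A q q' -> vrel B c c' -> vnform (hpaste A B) (NForm q c) (NForm q' c').

(** The vertical action respects multiplication, hence the moves of [lnorm]. *)
Lemma cvrel_lnorm F F' (s : mpath F F') (u : pt F) (v : pt F') x y
    (f : arr (po u) x) (g : arr (po v) y) (C : hcell f g) (t : chain s u v) t' :
  cvrel C t t' -> vnform C (lnorm t) (lnorm t').
Proof.
elim: s u v x y f g C t t' => [K|K L {}F' M s IH] u v x y f g C t t'.
  move=> h; rewrite -[C]hpaste1l; apply: VNForm h; exact: vtel_nil.
case=> w w' z z' h h' A B {}C a m {}t a' m' {}t' hA hB /IH /=.
case=> {C} p r k C C' q c q' c' h1 h2; rewrite -hpasteA -hpasteA.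
apply: VNForm h2; apply: vtel_cons h1; exact: vrel_lact.
Qed.

Section OfMm.
Variables (k : map_kind) (F F' G G' : model) (s : mpath F F') (N : fp_module G G').
Variables (a : model_map k F G) (b : model_map k F' G').
Variable mu : multimodulation s N a b.

Definition mval (u : pt F) (v : pt F') (q : tel s u v) :
    el N (tpt (map_etr a) u) (tpt (map_etr b) v) := cval (mm_cell mu) q.

Definition mm_fun (u : pt F) (v : pt F') (x : chain s u v) :
    el N (tpt (map_etr a) u) (tpt (map_etr b) v) :=
  ract (mval (nq (lnorm x))) (tpe (map_etr b) (nb (lnorm x))).

End OfMm.

Lemma em_lnorm F F' (s : mpath F F') (u : pt F) (v : pt F') (x : chain s u v) :
  tcomp (tt (nq (lnorm x))) ⊙ em (nb (lnorm x)) = chain_pro x.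
Proof.
elim: s u v x => [K|K L {}F' M s IH] u v x /=; first exact: comp1p.
by rewrite !comppA IH.
Qed.

Lemma lnorm_cract F F' (s : mpath F F') (u : pt F) (v v' : pt F') (x : chain s u v)
    (c : el (hom F') v v') :
  lnorm (cract x c) = NForm (nq (lnorm x)) (hmul (nb (lnorm x)) c).
Proof. by elim: s u v v' x c => [//|K L {}F' M s IH] u v v' x c /=; rewrite IH. Qed.

Lemma mm_fun_l k F F' G G' (s : mpath F F') (N : fp_module G G')
    (a : model_map k F G) (b : model_map k F' G') (mu : multimodulation s N a b)
    u u' v (c : el (hom F) u u') (x : chain s u' v) :
  mm_fun mu (clact c x) = lact (tpe (map_etr a) c) (mm_fun mu x).
Proof.
case: s a b mu u u' v c x => [K|K L {}F' M s] a b mu u u' v c x.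
- have /nullary_equivarianceP h := mm_end mu.
  rewrite /mm_fun /= tpe_hmul -ract_hmul -lact_ract; congr ract; exact: esym (h _ _ c).
- have /left_equivarianceP h := mm_end mu.
  by rewrite /mm_fun /= lact_hmul -lact_ract; congr ract; exact: h.
Qed.

(** The value at a chain is the value at its normal form, acted on by the
    remaining element. *)
Definition of_mm k F F' G G' (s : mpath F F') (N : fp_module G G')
    (a : model_map k F G) (b : model_map k F' G') (mu : multimodulation s N a b) :
    cmod s N (map_etr a) (map_etr b).
Proof.
exists (@mm_fun _ _ _ _ _ _ _ _ _ mu).
- move=> u v x; exact: (em_lnorm x).
- move=> u v x x' h; apply: (lnorm_step (b := map_etr b) (p := fun w => @mval _ _ _ _ _ _ _ _ _ mu u w)) h.
  + exact: ((right_equivarianceP _).1 (mm_right mu) u).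
  + exact: ((inner_equivarianceP _).1 (mm_inner mu) u).
- exact: mm_fun_l.
- move=> u v v' x c; rewrite /mm_fun lnorm_cract ract_hmul -tpe_hmul //.
- move=> u v x y f g C t t' /cvrel_lnorm; rewrite /mm_fun.
  case: (lnorm t) (lnorm t') / => w z h A B q c q' c' hq hc /=.
  apply: (@square_ract _ _ _ _ _ _ _ _ _ _ _ _ _ _ _ _ _ _ _ _ _ _ _ (ecmp (map_etr b) w h)).
  + exact: ((naturalityP _).1 (mm_natural mu)).
  + exact: (etr_nat (map_is_etr b) hc).
Defined.

(** ** From functions on chains to multimodulations *)

(** The chain of the given elements with identities interposed.  Its end points
    are arguments, together with equations, so that it can be used at
    points that are not literally the legs of [e]. *)
Fixpoint chain_of F F' (s : mpath F F') x y (t : tpath s x y) :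
    forall (e : apex (tsrc t)) (u : (F x : SET)) (v : (F' y : SET)),
    lft e = u -> rgt e = v -> chain s (Pt x u) (Pt y v) :=
  match t in @tpath _ _ _ _ F F' s x y return
    forall (e : apex (tsrc t)) (u : (F x : SET)) (v : (F' y : SET)),
    lft e = u -> rgt e = v -> chain s (Pt x u) (Pt y v) with
  | tnil F x => fun e u v hl hr =>
      @El _ _ _ F F (hom F) (Pt x u) (Pt x v) (idp x) (ap (unitor F x) e)
        (etrans (ap_legl (unitor F x) e) hl) (etrans (ap_legr (unitor F x) e) hr)
  | tcons F G H M s x y z m t' => fun e u v hl hr =>
      Link (uid (Pt x u))
        (@El _ _ _ F G M (Pt x u) (Pt y (lft (sval e).2)) m (sval e).1 hl (proj2_sig e))
        (chain_of (t := t') (e := (sval e).2) erefl hr)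
  end.

Definition chain_of_tel F F' (s : mpath F F') u v (q : tel s u v) : chain s u v :=
  chain_of (tel_l q) (tel_r q).

Arguments chain_of_tel : simpl never.

Lemma chain_of_tel_nil F (u : pt F) : chain_of_tel (tnilE u) = uid u.
Proof. exact: el_eq. Qed.

Lemma chain_of_tel_cons F G H (M : fp_module F G) (s : mpath G H) u w v
    (m : el M u w) (q : tel s w v) : chain_of_tel (tconsE m q) = Link (uid u) m (chain_of_tel q).
Proof.
case: u w v m q => [x u] [y w] [z v] [m e l r] [t a l' r'].
change (pro x y) in m; change (apex (@mpro _ _ _ _ M x y m)) in e.
change (tpath s y z) in t; change (apex (@tsrc _ _ _ _ G H s y z t)) in a.
change (lft e = u) in l; change (rgt e = w) in r.
change (lft a = w) in l'; change (rgt a = v) in r'; subst u v; case: w / l' r => r.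
rewrite /chain_of_tel /=.
set m1 := El _ _ _ _; set m2 := El _ _ _ _.
by have -> : m1 = m2 by exact: el_eq.
Qed.

Lemma lnorm_chain_of_tel F F' (s : mpath F F') u v (q : tel s u v) :
  lnorm (chain_of_tel q) = NForm q (uid v).
Proof.
elim/tel_elim: _ / q => {F F' s u v} [F u|F G H M s u w v m q IH].
  by rewrite chain_of_tel_nil.
by rewrite chain_of_tel_cons /= IH lact1.
Qed.

(** Normalizing a chain is a sequence of slides. *)
Lemma chain_eq_lnorm F F' (s : mpath F F') u v (x : chain s u v) :
  chain_eq x (cract (chain_of_tel (nq (lnorm x))) (nb (lnorm x))).
Proof.
elim: s u v x => [K|K L {}F' M s IH] u v x.
  rewrite [nq _]/= [nb _]/= chain_of_tel_nil /= hmul1l; exact: chain_eq_refl.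
case: x => w w' a m x; rewrite [lnorm _]/= [nq _]/= [nb _]/= chain_of_tel_cons.
apply: chain_eq_trans (@chain_eq_in _ _ _ _ _ _ M s _ _ _ _ (uid u) (lact a m) _ _ (IH _ _ x)).
have := @chain_eq_slidel _ _ _ _ _ _ M s _ _ _ _ _ (uid u) a m x; rewrite hmul1l; exact.
Qed.

Lemma rabs_chain_of_tel F F' (s : mpath F F') (u : pt F) (w v : pt F')
    (q : tel s u w) (b : el (hom F') w v) (q' : tel s u v) :
  rabs q b q' -> chain_eq (chain_of_tel q') (cract (chain_of_tel q) b).
Proof.
apply: (rabs_ind (P := fun F F' s u w v q b q' => chain_eq (chain_of_tel q') (cract (chain_of_tel q) b)))
  => {F F' s u w v q b q'} [F G M u w v m b|F G H M s u w v z m q b q' h].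
- rewrite !chain_of_tel_cons !chain_of_tel_nil.
  have := @chain_eq_slider _ _ _ _ _ _ M (pnil G) _ _ _ _ _ (uid u) m b (uid v).
  by rewrite /= hmul1l hmul1r.
- rewrite !chain_of_tel_cons; exact: (@chain_eq_in _ _ _ _ _ _ M s).
Qed.

Lemma inn_chain_of_tel F F' (s : mpath F F') (u : pt F) (v : pt F') (q q' : tel s u v) :
  inn q q' -> chain_eq (chain_of_tel q) (chain_of_tel q').
Proof.
apply: (inn_ind (P := fun F F' s u v q q' => chain_eq (chain_of_tel q) (chain_of_tel q')))
  => {F F' s u v q q'} [F G H K M N s u w w' z v m b n q|F G H M s u w v m q q' h].
- rewrite !chain_of_tel_cons.
  apply: chain_eq_trans (@chain_eq_slider _ _ _ _ _ _ M (pcons N s) _ _ _ _ _ (uid u) m b _) _.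
  apply: (@chain_eq_in _ _ _ _ _ _ M (pcons N s)); rewrite /= hmul1r -[X in Link X n](hmul1l b).
  exact: (@chain_eq_slidel _ _ _ _ _ _ N s).
- rewrite !chain_of_tel_cons; exact: (@chain_eq_in _ _ _ _ _ _ M s).
Qed.

Lemma vtel_chain_of_tel F F' (s : mpath F F') (u : pt F) (v : pt F') x y
    (f : arr (po u) x) (g : arr (po v) y) (C : hcell f g) (q : tel s u v) q' :
  vtel C q q' -> cvrel C (chain_of_tel q) (chain_of_tel q').
Proof.
apply: (vtel_ind (P := fun F F' s u v x y f g C q q' => cvrel C (chain_of_tel q) (chain_of_tel q')))
  => {F F' s u v x y f g C q q'} [F u x f|F G H M s u w v x y z f g h A C m m' q q' hA hC].
- rewrite !chain_of_tel_nil; exact: vrel_uid.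
- rewrite !chain_of_tel_cons -[hpaste A C]hpaste1l; apply: Cvrel => //; exact: vrel_uid.
Qed.

Lemma chain_pro_chain_of F F' (s : mpath F F') x y (t : tpath s x y) (e : apex (tsrc t)) u v
    (hl : lft e = u) (hr : rgt e = v) : chain_pro (chain_of hl hr) = tcomp t.
Proof.
elim: t e u v hl hr => {F F' s x y} [//|F G H M s x y z m t IH] e u v hl hr /=.
by rewrite IH comp1p.
Qed.

Section ToMm.
Variables (k : map_kind) (F F' G G' : model) (s : mpath F F') (N : fp_module G G').
Variables (a : model_map k F G) (b : model_map k F' G').
Variable p : cmod s N (map_etr a) (map_etr b).

Lemma chain_of_over x y (t : tpath s x y) (e : apex (tsrc t)) :
  em (cmod_fun p (chain_of (t := t) (e := e) erefl erefl)) = tcomp t.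
Proof. by rewrite cmod_over chain_pro_chain_of. Qed.

(** The value lies over the composite of the path by [cmod_over], and is moved
    there along this equation. *)
Definition comp_fun x y (t : tpath s x y) (e : apex (tsrc t)) : apex (mpro N (tcomp t)) :=
  eq_rect _ (fun m => apex (mpro N m)) (es (cmod_fun p (chain_of (t := t) (e := e) erefl erefl))) _
    (chain_of_over e).

Lemma comp_funE x y (t : tpath s x y) (e : apex (tsrc t)) :
  existT (fun m => apex (mpro N m)) _ (comp_fun e) =
  tot (cmod_fun p (chain_of (t := t) (e := e) erefl erefl)).
Proof. by rewrite /comp_fun; case: _ / (chain_of_over e). Qed.

Lemma comp_fun_legs x y (t : tpath s x y) (e : apex (tsrc t)) :
  lft (comp_fun e) = tob (map_trans a) x (lft e) /\ rgt (comp_fun e) = tob (map_trans b) y (rgt e).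
Proof.
have [l [r _]] := @tot_inv _ _ _ G G' N (tpt (map_etr a) (Pt x (lft e)))
  (tpt (map_etr b) (Pt y (rgt e))) _ _ _ (esym (comp_funE e)); split; [exact: l | exact: r].
Qed.

Definition comps : components s N (map_trans a) (map_trans b) := fun x y t =>
  @SpanCell _ _ _ _ (tsrc t) (mpro N (tcomp t)) (tob (map_trans a) x) (tob (map_trans b) y)
    (@comp_fun x y t) (fun e => (comp_fun_legs e).1) (fun e => (comp_fun_legs e).2).

Lemma cval_comps u v (q : tel s u v) : cval comps q = cmod_fun p (chain_of_tel q).
Proof.
case: u v q => [x u] [y v] [t e l r].
change (tpath s x y) in t; change (apex (@tsrc _ _ _ _ F F' s x y t)) in e.
change (lft e = u) in l; change (rgt e = v) in r; subst u v.
apply: el_eq; exact: (comp_funE e).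
Qed.

End ToMm.

Lemma comps_end k F F' G G' (s : mpath F F') (N : fp_module G G')
    (a : model_map k F G) (b : model_map k F' G') (p : cmod s N (map_etr a) (map_etr b)) :
  end_equivariance (comps p).
Proof.
case: s a b p => [K|K L {}F' M s] a b p.
- apply/nullary_equivarianceP => u v c; rewrite !cval_comps !chain_of_tel_nil.
  have := cmod_l p c (uid v : chain (pnil K) v v); have := cmod_r p (uid u : chain (pnil K) u u) c.
  by rewrite /= hmul1l hmul1r => -> ->.
- apply/left_equivarianceP => u v w z c m q; rewrite !cval_comps !chain_of_tel_cons.
  apply: etrans _ (cmod_l p c _); rewrite /= hmul1r.
  apply: (cmod_eq (s := pcons M s) p); apply: chain_eq_sym.
  by rewrite -[X in Link X m](hmul1l c); apply: (@chain_eq_slidel _ _ _ _ _ _ M s).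
Qed.

Definition to_mm k F F' G G' (s : mpath F F') (N : fp_module G G')
    (a : model_map k F G) (b : model_map k F' G') (p : cmod s N (map_etr a) (map_etr b)) :
    multimodulation s N a b.
Proof.
exists (comps p).
- apply/naturalityP => u v x y f g C q q' h; rewrite !cval_comps.
  exact: (cmod_nat p (vtel_chain_of_tel h)).
- exact: comps_end.
- apply/right_equivarianceP => u w v q c q' h; rewrite !cval_comps.
  by rewrite (cmod_eq p (rabs_chain_of_tel h)) cmod_r.
- apply/inner_equivarianceP => u v q q' h; rewrite !cval_comps.
  exact: (cmod_eq p (inn_chain_of_tel h)).
Defined.

(** A chain slides to its normal form, and the remaining element is handled by
    [cmod_r]. *)
Lemma to_mmK k F F' G G' (s : mpath F F') (N : fp_module G G')
    (a : model_map k F G) (b : model_map k F' G') (p : cmod s N (map_etr a) (map_etr b))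
    u v (x : chain s u v) : cmod_fun (of_mm (to_mm p)) x = cmod_fun p x.
Proof.
apply: etrans (esym (cmod_eq p (chain_eq_lnorm x))); rewrite cmod_r -cval_comps //.
Qed.

Lemma of_mm_chain_of_tel k F F' G G' (s : mpath F F') (N : fp_module G G')
    (a : model_map k F G) (b : model_map k F' G') (mu : multimodulation s N a b)
    u v (q : tel s u v) : cmod_fun (of_mm mu) (chain_of_tel q) = cval (mm_cell mu) q.
Proof.
by rewrite /= /mm_fun lnorm_chain_of_tel /= tpe_uid ract1.
Qed.

(** A component at a tuple is the value at the chain with identities interposed. *)
Lemma mm_eq k F F' G G' (s : mpath F F') (N : fp_module G G')
    (a : model_map k F G) (b : model_map k F' G') (mu nu : multimodulation s N a b) :
  (forall u v (x : chain s u v), cmod_fun (of_mm mu) x = cmod_fun (of_mm nu) x) -> mu = nu.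
Proof.
move=> h; have e : mm_cell mu = mm_cell nu.
  do 3!apply: functional_extensionality_dep => ?; apply: span_eq => e.
  apply: (@es_eq _ _ _ _ _ N).
  have := congr1 (fun e => tot e) (h _ _ (chain_of_tel (tel_of e))).
  by rewrite !of_mm_chain_of_tel.
case: mu nu e {h} => c h1 h2 h3 h4 [c' h1' h2' h3' h4'] /= e; case: _ / e h1' h2' h3' h4' => *.
by congr Multimodulation; apply: proof_irrelevance.
Qed.

End ChainFunctions.

(** * Maps of chains *)

Section ChainMaps.
Variable D : strict_dbl.
Variables (PD : lax_finite_products D) (PE : lax_finite_products Span).
Local Notation model := (model PD PE).
Local Notation mpath := (Defs.path (@fp_module (sdc D) Span PD PE)).
Implicit Types F G H K : model.

(** The analogue of [comm] for chains, where equations hold up to slides. *)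
Definition commx o F G (t : mpath F G) (U U' : pt F) (V V' : pt G)
    (z : chain t U V) (y : chain t U' V') : side o U U' -> side o V V' -> Prop :=
  match o return side o U U' -> side o V V' -> Prop with
  | false => fun j k => chain_eq (cract z k) (clact j y)
  | true => fun j k => chain_eq (clact j z) (cract y k)
  end.

Definition squarex o F G (t : mpath F G) (U : pt F) (V : pt G) x y
    (f : arr (po U) x) (g : arr (po V) y) (C : hcell f g) (U' : pt F) (V' : pt G)
    (e : chain t U V) (e' : chain t U' V')
    (j : side o (ptmap U f) U') (k : side o (ptmap V g) V') : Prop :=
  exists2 z, cvrel C e z & commx z e' j k.

Lemma commx_nil o F (U U' V V' : pt F) (r : el (hom F) U V) (e : el (hom F) U' V')
    (j : side o U U') (k : side o V V') :
  comm r e j k -> @commx o F F (pnil F) U U' V V' r e j k.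
Proof.
move: j k; rewrite /comm /commx; case: o => j k h.
- have {}h : clact j (r : chain (pnil F) U V) = cract (e : chain (pnil F) U' V') k by exact: h.
  rewrite h; exact: chain_eq_refl.
- have {}h : cract (r : chain (pnil F) U V) k = clact j (e : chain (pnil F) U' V') by exact: h.
  rewrite h; exact: chain_eq_refl.
Qed.

(** This is the mechanism behind naturality of composites: the comparison element
    enters at one end, is exchanged at [r], slides into the rest and leaves at
    the other end. *)
Lemma commx_cons o F G H (M : fp_module F G) (s : mpath G H) (U U' : pt F) (V V' : pt G)
    (W W' : pt H) (r : el M U V) (m : el M U' V') (z : chain s V W) (y : chain s V' W')
    (j : side o U U') (k : side o V V') (l : side o W W') :
  comm r m j k -> commx z y k l ->
  @commx o F H (pcons M s) U U' W W' (Link (uid U) r z) (Link (uid U') m y) j l.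
Proof.
move: j k l; rewrite /comm /commx; case: o => j k l h h'.
- rewrite [clact _ _]/= hmul1r -[X in Link X r](hmul1l j).
  apply: chain_eq_trans (@chain_eq_slidel _ _ _ _ _ _ M s _ _ _ _ _ (uid U') j r z) _.
  rewrite h; apply: chain_eq_trans (@chain_eq_slider _ _ _ _ _ _ M s _ _ _ _ _ (uid U') m k z) _.
  exact: (@chain_eq_in _ _ _ _ _ _ M s).
- apply: chain_eq_trans (@chain_eq_in _ _ _ _ _ _ M s _ _ _ _ (uid U) r _ _ h') _.
  apply: chain_eq_trans (chain_eq_sym (@chain_eq_slider _ _ _ _ _ _ M s _ _ _ _ _ (uid U) r k y)) _.
  rewrite h; apply: chain_eq_trans (chain_eq_sym (@chain_eq_slidel _ _ _ _ _ _ M s _ _ _ _ _ (uid U) j m y)) _.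
  rewrite [clact _ _]/= hmul1r hmul1l; exact: chain_eq_refl.
Qed.

(** The properties that make the composite with a function as in [cmod] again
    such a function; all equations are up to slides. *)
Record chain_map o F F' G G' (s : mpath F F') (t : mpath G G')
    (a : etr o F G) (b : etr o F' G') := ChainMap {
  cmap_fun : forall u v, chain s u v -> chain t (tpt a u) (tpt b v);
  cmap_over : forall u v (x : chain s u v), chain_pro (cmap_fun x) = chain_pro x;
  cmap_step : forall u v (x x' : chain s u v), chain_step x x' -> chain_eq (cmap_fun x) (cmap_fun x');
  cmap_l : forall u u' v (c : el (hom F) u u') (x : chain s u' v),
    chain_eq (cmap_fun (clact c x)) (clact (tpe a c) (cmap_fun x));
  cmap_r : forall u v v' (x : chain s u v) (c : el (hom F') v v'),
    chain_eq (cmap_fun (cract x c)) (cract (cmap_fun x) (tpe b c));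
  cmap_nat : forall u v x y (f : arr (po u) x) (g : arr (po v) y) (C : hcell f g)
      (e : chain s u v) e',
    cvrel C e e' -> @squarex o G G' t (tpt a u) (tpt b v) x y f g C _ _
      (cmap_fun e) (cmap_fun e') (ecmp a u f) (ecmp b v g)
}.

Lemma cmap_eq o F F' G G' (s : mpath F F') (t : mpath G G')
    (a : etr o F G) (b : etr o F' G') (p : chain_map s t a b) u v (x x' : chain s u v) :
  chain_eq x x' -> chain_eq (cmap_fun p x) (cmap_fun p x').
Proof. by apply: clos_map => y y'; apply: cmap_step. Qed.

Definition cmap_nil o F G (a : etr o F G) (ha : is_etr a) : chain_map (pnil F) (pnil G) a a.
Proof.
exists (fun u v x => tpe a x : chain (pnil G) (tpt a u) (tpt a v)).
- by [].
- by [].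
- by move=> u u' v c x; rewrite /= tpe_hmul; apply: chain_eq_refl.
- by move=> u u' v c x; rewrite /= tpe_hmul; apply: chain_eq_refl.
- move=> u v x y f g C e e' h; have [r hr hc] := etr_nat ha h; exists r => //.
  exact: commx_nil.
Defined.

Section Cons.
Variables (o : bool) (F F1 F' G G1 G' : model) (s1 : mpath F F1) (s2 : mpath F1 F').
Variables (N : fp_module G G1) (t : mpath G1 G').
Variables (a : etr o F G) (b : etr o F1 G1) (c : etr o F' G').
Variables (p : cmod s1 N a b) (q : chain_map s2 t b c).

(** The value of [p] replaces the first block, which includes the element at its
    front; hence the identity there. *)
Definition cut_map (u : pt F) (v : pt F') (k : cut s1 s2 u v) :
    chain (pcons N t) (tpt a u) (tpt c v) :=
  Link (uid (tpt a u)) (cmod_fun p (c1 k)) (cmap_fun q (c2 k)).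

(** An element at the cut may be given to either block, as [p] is equivariant on
    the right and [q] on the left. *)
Lemma cut_map_eq u v (k k' : cut s1 s2 u v) : cuteq k k' -> chain_eq (cut_map k) (cut_map k').
Proof.
apply: clos_map => {}k {}k' [w x x' y h|w x y y' h|w w' x d y]; rewrite /cut_map /=.
- rewrite (cmod_step p h); exact: rst_refl.
- by apply: (@chain_eq_in _ _ _ _ _ _ N t); apply: cmap_step.
- rewrite cmod_r; apply: rst_trans (@chain_eq_slider _ _ _ _ _ _ N t _ _ _ _ _ _ _ _ _) _.
  by apply: (@chain_eq_in _ _ _ _ _ _ N t); apply: chain_eq_sym; apply: cmap_l.
Qed.

Definition cmap_cons : chain_map (papp s1 s2) (pcons N t) a c.
Proof.
exists (fun u v x => cut_map (csplit x)).
- by move=> u v x; rewrite [RHS]chain_pro_split /= cmap_over cmod_over comp1p.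
- by move=> u v x x' h; apply: cut_map_eq; apply: csplit_eq; apply: rst_step.
- move=> u u' v d x; apply: chain_eq_trans (cut_map_eq (csplit_clact d x)) _.
  rewrite /cut_map /= cmod_l hmul1r -[X in chain_eq _ X]/(Link _ _ _).
  apply: chain_eq_sym; rewrite -[X in Link X (cmod_fun p _)](hmul1l (tpe a d)).
  exact: (@chain_eq_slidel _ _ _ _ _ _ N t).
- move=> u v v' x d; rewrite csplit_cract /cut_map /=.
  by apply: (@chain_eq_in _ _ _ _ _ _ N t); apply: cmap_r.
- move=> u v x y f g C e e' /cvrel_split.
  case: (csplit e) (csplit e') / => w z h A B e1 e2 e1' e2' h1 h2.
  have [r hr hc] := cmod_nat p h1; have [y2 hy hc2] := cmap_nat q h2.
  exists (Link (uid (ptmap (tpt a u) f)) r y2 : chain (pcons N t) _ _).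
    rewrite -[hpaste A B]hpaste1l.
    apply: (@Cvrel _ _ _ G G1 N _ _ (tpt a u) x (po (tpt c v)) y f g _ (tpt a u) (tpt b w) x z f h)
      => //; exact: vrel_uid.
  exact: commx_cons hc hc2.
Defined.

End Cons.

Definition ccast F F' (s s' : mpath F F') (e : s = s') u v (x : chain s' u v) : chain s u v :=
  match e in _ = s' return chain s' u v -> chain s u v with erefl => id end x.

Definition cmap_cast o F F' G G' (s s' : mpath F F') (e : s = s') (t : mpath G G')
    (a : etr o F G) (b : etr o F' G') (p : chain_map s t a b) : chain_map s' t a b :=
  match e in _ = s' return chain_map s' t a b with erefl => p end.

Lemma cmap_castE o F F' G G' (s s' : mpath F F') (e : s = s') (t : mpath G G')
    (a : etr o F G) (b : etr o F' G') (p : chain_map s t a b) u v (x : chain s' u v) :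
  cmap_fun (cmap_cast e p) x = cmap_fun p (ccast e x).
Proof. by case: _ / e x. Qed.

Lemma comm_stpe_x o F G H K (t : mpath F G) (P : fp_module H K)
    (a : etr o F H) (b : etr o G K) (p : cmod t P a b) (U U' : pt F) (V V' : pt G)
    (W : pt H) (Z : pt K) (q : el P W Z) (z : chain t U V) (y : chain t U' V')
    (i : side o W (tpt a U)) (i' : side o Z (tpt b V)) (j : side o U U') (k : side o V V') :
  comm q (cmod_fun p z) i i' -> commx z y j k ->
  comm q (cmod_fun p y) (smul i (stpe a j)) (smul i' (stpe b k)).
Proof.
case: o a b p i i' j k => a b p i i' j k h h'.
- change (lact i q = ract (cmod_fun p z) i') in h.
  change (chain_eq (clact j z) (cract y k)) in h'.
  change (lact (hmul (tpe a j) i) q = ract (cmod_fun p y) (hmul (tpe b k) i')).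
  by rewrite lact_hmul h -lact_ract -cmod_l (cmod_eq p h') cmod_r ract_hmul.
- change (ract q i' = lact i (cmod_fun p z)) in h.
  change (chain_eq (cract z k) (clact j y)) in h'.
  change (ract q (hmul i' (tpe b k)) = lact (hmul i (tpe a j)) (cmod_fun p y)).
  by rewrite -ract_hmul h lact_ract -cmod_r (cmod_eq p h') cmod_l lact_hmul.
Qed.

(** Composition of functions; naturality pastes the square of [p] to the square
    of chains coming from [q]. *)
Definition cmod_comp o F F' G G' H H' (s : mpath F F') (t : mpath G G') (P : fp_module H H')
    (a : etr o F G) (b : etr o F' G') (a' : etr o G H) (b' : etr o G' H')
    (p : cmod t P a' b') (q : chain_map s t a b) : cmod s P (etr_comp a' a) (etr_comp b' b).
Proof.
exists (fun u v x => cmod_fun p (cmap_fun q x)).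
- by move=> u v x; exact: etrans (cmod_over p (cmap_fun q x)) (cmap_over q x).
- move=> u v x x' h; exact: (cmod_eq p (cmap_step q h)).
- move=> u u' v c x; apply: etrans (cmod_eq p (cmap_l q c x)) _.
  rewrite cmod_l; congr lact; exact: (esym (tpe_comp a' a c)).
- move=> u v v' x c; apply: etrans (cmod_eq p (cmap_r q x c)) _.
  rewrite cmod_r; congr ract; exact: (esym (tpe_comp b' b c)).
- move=> u v x y f g C t0 t' h; have [z hz hc] := cmap_nat q h; have [r hr hc'] := cmod_nat p hz.
  by exists r => //; apply: comm_stpe_x hc' hc.
Defined.

Definition cmod_cast o F F' G G' (s : mpath F F') (N : fp_module G G')
    (a a' : etr o F G) (b b' : etr o F' G') (ea : a = a') (eb : b = b')
    (p : cmod s N a b) : cmod s N a' b' :=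
  match ea in _ = a', eb in _ = b' return cmod s N a' b' with erefl, erefl => p end.

Lemma cmod_castE o F F' G G' (s : mpath F F') (N : fp_module G G')
    (a a' : etr o F G) (b b' : etr o F' G') (ea : a = a') (eb : b = b')
    (p : cmod s N a b) u v (x : chain s u v) :
  tot (cmod_fun (cmod_cast ea eb p) x) = tot (cmod_fun p x).
Proof. by case: _ / ea; case: _ / eb. Qed.

(** ** Sequences of multimodulations *)

Section Kind.
Variable k : map_kind.
Local Notation V := (model_graph PD PE k).

(** Cuts a chain into blocks, one for each multimodulation, and replaces every
    block by its value. *)
Fixpoint cells_map (F F' G G' : vob V) (s : Defs.path vpro F F') (t : Defs.path vpro G G')
    (a : varr F G) (a' : varr F' G') (c : cells s t a a') :
    chain_map s t (map_etr a) (map_etr a') :=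
  match c in @cells _ F F' G G' s t a a' return
    @chain_map (map_flag k) F F' G G' s t (@map_etr _ _ _ k F G a) (@map_etr _ _ _ k F' G' a') with
  | cnil F G a => cmap_nil (@map_is_etr _ _ _ k F G a)
  | ccons _ _ _ _ _ _ s1 s2 s e N t a a' a'' m c' =>
      cmap_cast e (cmap_cons (of_mm m) (cells_map c'))
  end.

End Kind.

End ChainMaps.

(** * Identities and units on chains *)

Section VirtualDoubleCategory.
Variable D : strict_dbl.
Variables (PD : lax_finite_products D) (PE : lax_finite_products Span).
Local Notation model := (model PD PE).
Local Notation mpath := (Defs.path (@fp_module (sdc D) Span PD PE)).
Implicit Types F G H K : model.

(** Equality up to slides for chains whose end points need not be convertible:
    for a variable kind, identity and composite maps act on points as expected
    only up to an equation. *)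
Inductive chain_heq F F' (s : mpath F F') x y (u : (F x : SET)) (v : (F' y : SET))
    (t : chain s (Pt x u) (Pt y v)) :
    forall u' v', chain s (Pt x u') (Pt y v') -> Prop :=
| ChainHeq t' : chain_eq t t' -> chain_heq t t'.

Lemma chain_heq_trans F F' (s : mpath F F') x y (u u' u'' : (F x : SET)) (v v' v'' : (F' y : SET))
    (t : chain s (Pt x u) (Pt y v)) (t' : chain s (Pt x u') (Pt y v'))
    (t'' : chain s (Pt x u'') (Pt y v'')) :
  chain_heq t t' -> chain_heq t' t'' -> chain_heq t t''.
Proof. case=> {}t' h; case=> {}t'' h'; split; exact: chain_eq_trans h h'. Qed.

Lemma tot_uid F x (u u' : (F x : SET)) : u = u' -> tot (uid (Pt x u)) = tot (uid (Pt x u')).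
Proof. by move->. Qed.

Lemma chain_heq_nil F x y (u u' : (F x : SET)) (v v' : (F y : SET))
    (a : el (hom F) (Pt x u) (Pt y v)) (a' : el (hom F) (Pt x u') (Pt y v')) :
  tot a = tot a' -> @chain_heq F F (pnil F) x y u v a u' v' a'.
Proof.
move=> h; have [e e'] := tot_legs h; subst u' v'.
by rewrite (el_eq h); split; apply: chain_eq_refl.
Qed.

Lemma chain_heq_link F G H (M : fp_module F G) (s : mpath G H) x y z w
    (u u' : (F x : SET)) (p p' : (F y : SET)) (q q' : (G z : SET)) (v v' : (H w : SET))
    (a : el (hom F) (Pt x u) (Pt y p)) (a' : el (hom F) (Pt x u') (Pt y p'))
    (m : el M (Pt y p) (Pt z q)) (m' : el M (Pt y p') (Pt z q'))
    (t : chain s (Pt z q) (Pt w v)) (t' : chain s (Pt z q') (Pt w v')) :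
  tot a = tot a' -> tot m = tot m' -> chain_heq t t' ->
  @chain_heq F H (pcons M s) x w u v (Link a m t) u' v' (Link a' m' t').
Proof.
move=> h h' ht; have [e _] := tot_legs h; have [e' _] := tot_legs h'; subst u' p'.
move: m' h'; case: ht => {}t' ht m' h'.
by rewrite -(el_eq h) -(el_eq h'); split; apply: (@chain_eq_in _ _ _ _ _ _ M s).
Qed.

Lemma cmod_heq o F F' G G' (s : mpath F F') (N : fp_module G G')
    (a : etr o F G) (b : etr o F' G') (p : cmod s N a b) x y
    (u u' : (F x : SET)) (v v' : (F' y : SET))
    (t : chain s (Pt x u) (Pt y v)) (t' : chain s (Pt x u') (Pt y v')) :
  chain_heq t t' -> tot (cmod_fun p t) = tot (cmod_fun p t').
Proof. by case=> {}t' h; rewrite (cmod_eq p h). Qed.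

Lemma cmap_heq o F F' G G' (s : mpath F F') (r : mpath G G')
    (a : etr o F G) (b : etr o F' G') (p : chain_map s r a b) x y
    (u u' : (F x : SET)) (v v' : (F' y : SET))
    (t : chain s (Pt x u) (Pt y v)) (t' : chain s (Pt x u') (Pt y v')) :
  chain_heq t t' -> chain_heq (cmap_fun p t) (cmap_fun p t').
Proof. by case=> {}t' h; split; apply: cmap_eq. Qed.

Lemma cut_map_heq o F F1 F' G G1 G' (s1 : mpath F F1) (s2 : mpath F1 F')
    (N : fp_module G G1) (t : mpath G1 G')
    (a a' : etr o F G) (b b' : etr o F1 G1) (c c' : etr o F' G')
    (p : cmod s1 N a b) (q : chain_map s2 t b c) (p' : cmod s1 N a' b') (q' : chain_map s2 t b' c')
    (u : pt F) (v : pt F') (k : cut s1 s2 u v) :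
  tot (cmod_fun p (c1 k)) = tot (cmod_fun p' (c1 k)) ->
  @chain_heq G1 G' t (po (cw k)) (po v) _ _ (cmap_fun q (c2 k)) _ _ (cmap_fun q' (c2 k)) ->
  @chain_heq G G' (pcons N t) (po u) (po v) _ _ (cut_map p q k) _ _ (cut_map p' q' k).
Proof.
by move=> h h'; apply: chain_heq_link => //; apply: tot_uid; case: (tot_legs h).
Qed.

(** ** Identities *)

Lemma comm_suid o F G (M : fp_module F G) (U : pt F) (V : pt G) (r : el M U V) :
  comm r r (suid o U) (suid o V).
Proof. by rewrite /comm /suid; case: o; rewrite lact1 ract1. Qed.

Lemma commx_suid o F G (t : mpath F G) (U : pt F) (V : pt G) (r : chain t U V) :
  commx r r (suid o U) (suid o V).
Proof. by rewrite /commx /suid; case: o; rewrite clact1 cract1; apply: chain_eq_refl. Qed.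

(** The identity multimodulation multiplies the three entries of the chain. *)
Definition id_cmod o F G (M : fp_module F G) :
  cmod (pcons M (pnil G)) M (etr_one o F) (etr_one o G).
Proof.
exists (fun u v (x : chain (pcons M (pnil G)) u v) =>
  lact (link_a x) (ract (link_m x) (link_t x)) : el M (tpt (etr_one o F) u) (tpt (etr_one o G) v)).
- by [].
- move=> u v x x' [w1 w2 w3 a c m y|w1 w2 w3 a m c y|//] /=.
  + by rewrite lact_hmul lact_ract.
  + by rewrite ract_hmul.
- by move=> u u' v c x; rewrite tpe_one /= lact_hmul.
- by move=> u v v' x c; rewrite tpe_one /= lact_ract ract_hmul.
- move=> u v x y f g C t t' [w w' z z' h h' A B {}C a m {}t a' m' {}t' hA hB hC].
  exists (lact a' (ract m' t')); last exact: comm_suid.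
  by apply: vrel_lact => //; apply: vrel_ract.
Defined.

(** The identity on the first entry leaves a chain as it is, up to moving the
    element in front. *)
Lemma id_cmod_cons o F G H (M : fp_module F G) (s : mpath G H) G' (t : mpath G G')
    (b : etr o H G') (q : chain_map s t (etr_one o G) b) u w w' v
    (a : el (hom F) u w) (m : el M w w') (x : chain s w' v) :
  chain_eq (cmap_fun (cmap_cons (id_cmod o M) q) (Link a m x : chain (papp (pcons M (pnil G)) s) u v))
      (Link a m (cmap_fun q x) : chain (pcons M t) u (tpt b v)).
Proof.
rewrite /= /cut_map /= ract1; apply: chain_eq_sym.
have := @chain_eq_slidel _ _ _ _ _ _ M t _ _ _ _ _ (uid u) a m (cmap_fun q x).
by rewrite hmul1l.
Qed.

Fixpoint cmap_id o F F' (s : mpath F F') : chain_map s s (etr_one o F) (etr_one o F') :=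
  match s in Defs.path _ F F' return chain_map s s (etr_one o F) (etr_one o F') with
  | pnil F => cmap_nil (is_etr_one o F)
  | pcons _ _ _ M s' => cmap_cons (id_cmod o M) (cmap_id o s')
  end.

Lemma cmap_idE o F F' (s : mpath F F') u v (x : chain s u v) : chain_eq (cmap_fun (cmap_id o s) x) x.
Proof.
elim: s u v x => [K|K L {}F' M s IH] u v x.
  rewrite /= tpe_one; exact: chain_eq_refl.
case: x => w w' a m x; apply: chain_eq_trans (id_cmod_cons _ a m x) _.
exact: (@chain_eq_in _ _ _ _ _ _ M s _ _ _ _ a m _ _ (IH _ _ x)).
Qed.

(** ** Inserting and removing a unit *)

(** Chains for the empty path are the elements of the unit. *)
Definition unit_cmod o G : cmod (pnil G) (hom G) (etr_one o G) (etr_one o G).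
Proof.
exists (fun u v (x : chain (pnil G) u v) => x : el (hom G) (tpt (etr_one o G) u) (tpt (etr_one o G) v)).
- by [].
- by [].
- by move=> u u' v c x; rewrite tpe_one.
- by move=> u v v' x c; rewrite tpe_one.
- move=> u v x y f g C t t' h; exists t' => //; exact: comm_suid.
Defined.

(** Inserts an identity, as an entry of the unit, between the two paths. *)
Fixpoint insert_unit o F G H (s1 : mpath F G) (s2 : mpath G H) :
    chain_map (papp s1 s2) (papp s1 (pcons (hom G) s2)) (etr_one o F) (etr_one o H) :=
  match s1 in Defs.path _ F G return forall s2 : mpath G H,
    chain_map (papp s1 s2) (papp s1 (pcons (hom G) s2)) (etr_one o F) (etr_one o H) with
  | pnil G => fun s2 => cmap_cons (unit_cmod o G) (cmap_id o s2)
  | pcons _ _ _ M s => fun s2 => cmap_cons (id_cmod o M) (insert_unit o s s2)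
  end s2.

(** Multiplies the entry of the unit into the rest of the chain. *)
Definition collapse_head o G H (s : mpath G H) :
  chain_map (pcons (hom G) s) s (etr_one o G) (etr_one o H).
Proof.
exists (fun u v (x : chain (pcons (hom G) s) u v) =>
  clact (link_a x) (clact (link_m x) (link_t x)) : chain s (tpt (etr_one o G) u) (tpt (etr_one o H) v)).
- by move=> u v x; rewrite !chain_pro_clact.
- move=> u v x x' [w1 w2 w3 a c m y|w1 w2 w3 a m c y|w1 w2 a m y y' h] /=.
  + rewrite !clact_hmul; exact: chain_eq_refl.
  + rewrite ract_hom clact_hmul; exact: chain_eq_refl.
  + by do 2!apply: chain_eq_clact; apply: rst_step.
- by move=> u u' v c x; rewrite tpe_one /= clact_hmul; apply: chain_eq_refl.
- by move=> u v v' x c; rewrite tpe_one /= !clact_cract; apply: chain_eq_refl.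
- move=> u v x y f g C t t' [w w' z z' h h' A B {}C a m {}t a' m' {}t' hA hB hC].
  exists (clact a' (clact m' t')); last exact: commx_suid.
  by apply: cvrel_clact => //; apply: cvrel_clact.
Defined.

Fixpoint collapse o F G H (s1 : mpath F G) (s2 : mpath G H) :
    chain_map (papp s1 (pcons (hom G) s2)) (papp s1 s2) (etr_one o F) (etr_one o H) :=
  match s1 in Defs.path _ F G return forall s2 : mpath G H,
    chain_map (papp s1 (pcons (hom G) s2)) (papp s1 s2) (etr_one o F) (etr_one o H) with
  | pnil G => fun s2 => collapse_head o s2
  | pcons _ _ _ M s => fun s2 => cmap_cons (id_cmod o M) (collapse o s s2)
  end s2.

Lemma collapse_insert o F G H (s1 : mpath F G) (s2 : mpath G H) u v
    (x : chain (papp s1 s2) u v) :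
  chain_eq (cmap_fun (collapse o s1 s2) (cmap_fun (insert_unit o s1 s2) x)) x.
Proof.
elim: s1 s2 u v x => [K|K L {}G M s IH] s2 u v x.
  rewrite /= !clact1; exact: cmap_idE.
case: x => w w' a m x.
apply: chain_eq_trans (cmap_eq (collapse o (pcons M s) s2) (id_cmod_cons (insert_unit o s s2) a m x)) _.
apply: chain_eq_trans (id_cmod_cons (collapse o s s2) a m _) _.
apply: (@chain_eq_in _ _ _ _ _ _ M (papp s s2)); exact: IH.
Qed.

Lemma insert_collapse o F G H (s1 : mpath F G) (s2 : mpath G H) u v
    (x : chain (papp s1 (pcons (hom G) s2)) u v) :
  chain_eq (cmap_fun (insert_unit o s1 s2) (cmap_fun (collapse o s1 s2) x)) x.
Proof.
elim: s1 s2 u v x => [K|K L {}G M s IH] s2 u v x.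
  case: x => w w' a m x; rewrite /= /cut_map.
  apply: chain_eq_trans (@chain_eq_in _ _ _ _ _ _ (hom K) s2 _ _ _ _ (uid u) (uid u) _ _ (cmap_idE _ _)) _.
  rewrite -clact_hmul.
  apply: chain_eq_trans (chain_eq_sym (@chain_eq_slider _ _ _ _ _ _ (hom K) s2 _ _ _ _ _ (uid u) (uid u) (hmul a m) x)) _.
  rewrite ract_hom hmul1l.
  apply: chain_eq_trans (chain_eq_sym (@chain_eq_slidel _ _ _ _ _ _ (hom K) s2 _ _ _ _ _ (uid u) a m x)) _.
  rewrite hmul1l; exact: chain_eq_refl.
case: x => w w' a m x.
apply: chain_eq_trans (cmap_eq (insert_unit o (pcons M s) s2) (id_cmod_cons (collapse o s s2) a m x)) _.
apply: chain_eq_trans (id_cmod_cons (insert_unit o s s2) a m _) _.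
apply: (@chain_eq_in _ _ _ _ _ _ M (papp s (pcons (hom G) s2))); exact: IH.
Qed.

End VirtualDoubleCategory.

(** * The virtual double category of models *)

Section Models.
Variable D : strict_dbl.
Variables (PD : lax_finite_products D) (PE : lax_finite_products Span).
Local Notation model := (model PD PE).
Local Notation mpath := (Defs.path (@fp_module (sdc D) Span PD PE)).
Implicit Types F G H K : model.
Variable k : map_kind.
Local Notation V := (model_graph PD PE k).
Local Notation o := (map_flag k).

Definition mm_of F F' G G' (s : mpath F F') (N : fp_module G G')
    (A : etr o F G) (B : etr o F' G') (a : model_map k F G) (b : model_map k F' G')
    (ea : map_etr a = A) (eb : map_etr b = B) (p : cmod s N A B) : multimodulation s N a b :=
  to_mm (cmod_cast (esym ea) (esym eb) p).

Lemma mm_ofE F F' G G' (s : mpath F F') (N : fp_module G G')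
    (A : etr o F G) (B : etr o F' G') (a : model_map k F G) (b : model_map k F' G')
    (ea : map_etr a = A) (eb : map_etr b = B) (p : cmod s N A B) u v (x : chain s u v) :
  tot (cmod_fun (of_mm (mm_of ea eb p)) x) = tot (cmod_fun p x).
Proof. by rewrite to_mmK; exact: cmod_castE. Qed.

Definition models_id F G (M : fp_module F G) :
    multimodulation (pcons M (pnil G)) M (model_map_one k F) (model_map_one k G) :=
  mm_of (map_etr_one k F) (map_etr_one k G) (id_cmod o M).

Definition models_comp (F F' G G' H H' : vob V) (s : Defs.path vpro F F')
    (t : Defs.path vpro G G') (P : vpro H H') (a : varr F G) (a' : varr F' G')
    (b : varr G H) (b' : varr G' H') (c : cells s t a a') (p : vcell t P b b') :
    vcell s P (model_map_comp b a) (model_map_comp b' a') :=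
  @mm_of F F' H H' s P _ _ (model_map_comp b a) (model_map_comp b' a') (map_etr_comp b a)
    (map_etr_comp b' a') (cmod_comp (of_mm p) (cells_map c)).

Definition models_vdc : vdc V :=
  @Vdc V (model_map_one k) (fun F G H b a => model_map_comp b a)
    (fun F G H K c b a => model_map_compA c b a)
    (fun F G a => model_map_one_comp a) (fun F G a => model_map_comp_one a) models_id models_comp.

Lemma models_compE (F F' G G' H H' : vob V) (s : Defs.path vpro F F')
    (t : Defs.path vpro G G') (P : vpro H H') (a : varr F G) (a' : varr F' G')
    (b : varr G H) (b' : varr G' H') (c : cells s t a a') (p : vcell t P b b')
    (u : pt F) (v : pt F') (x : chain s u v) :
  tot (cmod_fun (of_mm (models_comp c p)) x) = tot (cmod_fun (of_mm p) (cmap_fun (cells_map c) x)).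
Proof. exact: mm_ofE. Qed.

Lemma models_idE F G (M : fp_module F G) (u : pt F) (v : pt G)
    (x : chain (pcons M (pnil G)) u v) :
  tot (cmod_fun (of_mm (models_id M)) x) = tot (lact (link_a x) (ract (link_m x) (link_t x))).
Proof. exact: mm_ofE. Qed.

Lemma mm_vceq (F F' G G' : vob V) (s : Defs.path vpro F F') (N : vpro G G')
    (a b : varr F G) (a' b' : varr F' G') (p : vcell s N a a') (q : vcell s N b b') :
  a = b -> a' = b' ->
  (forall (u : pt F) (v : pt F') (x : chain s u v),
     tot (cmod_fun (of_mm p) x) = tot (cmod_fun (of_mm q) x)) ->
  vceq p q.
Proof.
move=> e e'; case: _ / e q => q; case: _ / e' q => q h.
have -> : p = q by apply: mm_eq => u v x; apply: el_eq; apply: h.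
exact: vceq_refl.
Qed.

Lemma tot_tpe_etr F G (A B : etr o F G) u v (e : el (hom F) u v) :
  A = B -> tot (tpe A e) = tot (tpe B e).
Proof. by move->. Qed.

Lemma cells_map_id F F' (s : mpath F F') (u : pt F) (v : pt F') (x : chain s u v) :
  @chain_heq _ _ _ F F' s (po u) (po v) _ _ (cmap_fun (cells_map (id_cells models_vdc s)) x) _ _ x.
Proof.
suff h : @chain_heq _ _ _ F F' s (po u) (po v) _ _ (cmap_fun (cells_map (id_cells models_vdc s)) x) _ _
    (cmap_fun (cmap_id o s) x).
  by apply: chain_heq_trans h _; split; apply: cmap_idE.
elim: s u v x => [K|K L {}F' M s IH] u v x.
  by apply: chain_heq_nil; apply: tot_tpe_etr; apply: map_etr_one.
apply: cut_map_heq; last exact: IH.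
exact: mm_ofE.
Qed.

Lemma ccast_cons F G H (M : fp_module F G) (s s' : mpath G H) (e : s = s')
    (E : pcons M s = pcons M s') u v w w' (a : el (hom F) u w) (m : el M w w')
    (x : chain s' w' v) :
  ccast E (Link a m x : chain (pcons M s') u v) = Link a m (ccast e x).
Proof. by case: _ / e E x => E x; rewrite (proof_irrelevance _ E erefl). Qed.

Lemma csplit_nil F F' (s : mpath F F') u v (x : chain s u v) :
  let c := @csplit _ _ _ F F' F' s (pnil F') u v (ccast (papp_nil s) x) in
  cract (c1 c) (c2 c) = x.
Proof.
move: (papp_nil s) => e /=.
elim: s u v x e => [K|K L {}F' M s IH] u v x e.
  by rewrite (proof_irrelevance _ e erefl) /= hmul1l.
case: x => w w' a m x; rewrite (ccast_cons (papp_nil s)) /=.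
by have := IH _ _ x (papp_nil s) => /= ->.
Qed.

Lemma models_idl (F F' G G' : vob V) (s : Defs.path vpro F F') (N : vpro G G')
    (f : varr F G) (f' : varr F' G') (m : vcell s N f f') :
  vceq (vcompc models_vdc (ccons (papp_nil s) m (cnil f')) (vidc models_vdc N)) m.
Proof.
apply: mm_vceq; [exact: model_map_one_comp..|].
move=> u v x; apply: etrans (models_compE _ _ x) _.
apply: etrans (@models_idE _ _ N _ _ (cmap_fun (cells_map (ccons (papp_nil s) m (cnil f'))) x)) _.
rewrite -[in RHS](csplit_nil x) cmod_r [cells_map _]/= cmap_castE.
set c := csplit _.
exact: (congr1 (fun e => tot e)
  (lact1 (ract (cmod_fun (of_mm m) (c1 c)) (tpe (map_etr f') (c2 c))))).
Qed.

Lemma models_idr (F F' G G' : vob V) (s : Defs.path vpro F F') (N : vpro G G')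
    (f : varr F G) (f' : varr F' G') (m : vcell s N f f') :
  vceq (vcompc models_vdc (id_cells models_vdc s) m) m.
Proof.
apply: mm_vceq; [exact: model_map_comp_one..|].
move=> u v x; apply: etrans (models_compE _ _ x) _.
exact: (@cmod_heq _ _ _ _ _ _ _ _ s _ _ _ (of_mm m) _ _ _ _ _ _ _ _ (cells_map_id x)).
Qed.

Record cut3 F G H K (s1 : mpath F G) (s2 : mpath G H) (s3 : mpath H K) u v := Cut3 {
  d : pt G;
  d' : pt H;
  d1 : chain s1 u d;
  d2 : chain s2 d d';
  d3 : chain s3 d' v
}.

(** Both ways of cutting a chain into three parts leave the interposed elements
    in the same places. *)
Lemma csplit_assoc F G H K (s1 : mpath F G) (s2 : mpath G H) (s3 : mpath H K) u v
    (x : chain (papp (papp s1 s2) s3) u v)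
    (e : papp s1 (papp s2 s3) = papp (papp s1 s2) s3) :
  Cut3 (c1 (csplit (c1 (csplit x)))) (c2 (csplit (c1 (csplit x)))) (c2 (csplit x)) =
  Cut3 (c1 (csplit (ccast e x))) (c1 (csplit (c2 (csplit (ccast e x)))))
    (c2 (csplit (c2 (csplit (ccast e x))))).
Proof.
elim: s1 s2 s3 u v x e => [L|L L' {}G M s1 IH] s2 s3 u v x e.
  by rewrite (proof_irrelevance _ e erefl).
case: x => w w' a m x; rewrite (ccast_cons (esym (papp_assoc s1 s2 s3))).
have /= := congr1 (fun c => Cut3 (Link a m (d1 c) : chain (pcons M s1) u _) (d2 c) (d3 c))
  (IH s2 s3 _ _ x (esym (papp_assoc s1 s2 s3))); exact.
Qed.

(** The second part of the sequence acts on what the first part leaves over. *)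
Lemma cells_map_app (F F' G G' F'' G'' : vob V) (s : Defs.path vpro F F')
    (t : Defs.path vpro G G') (f : varr F G) (f' : varr F' G') (c : cells s t f f')
    (s' : Defs.path vpro F' F'') (t' : Defs.path vpro G' G'') (f'' : varr F'' G'')
    (c' : cells s' t' f' f'') (u : pt F) (v : pt F'') (x : chain (papp s s') u v) :
  @chain_eq _ _ _ G G'' (papp t t') _ _ (cmap_fun (cells_map (cells_app c c')) x)
    (cjoin (cmap_fun (cells_map c) (c1 (csplit x))) (cmap_fun (cells_map c') (c2 (csplit x)))).
Proof.
elim: c F'' G'' s' t' f'' c' u v x => {F F' G G' s t f f'} [F G f|F F1 F' G G1 G' s1 s2 s e N t f f1 f' m c IH]
  F'' G'' s' t' f'' c' u v x.
  rewrite /= tpe_uid clact1; exact: chain_eq_refl.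
case: s / e x => x; rewrite [cells_app _ _]/= [cells_map (ccons _ _ (cells_app _ _))]/= cmap_castE.
move: (esym (papp_assoc s1 s2 s')) => e.
apply: chain_eq_trans (@chain_eq_in _ _ _ _ _ _ N (papp t t') _ _ _ _ _ _ _ _ (IH _ _ _ _ _ c' _ _ _)) _.
have := congr1 (fun k => Link (uid (tpt (map_etr f) u)) (cmod_fun (of_mm m) (d1 k))
  (cjoin (cmap_fun (cells_map c) (d2 k)) (cmap_fun (cells_map c') (d3 k))) : chain (pcons N (papp t t')) _ _)
  (csplit_assoc x e).
by move=> /= ->; apply: rst_refl.
Qed.

(** Acting with the inner and then with the outer multimodulations is done block
    by block: the image of the first block is cut off again, up to a slide. *)
Lemma cells_map_comp (F F' G G' H H' : vob V) (s : Defs.path vpro F F')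
    (t : Defs.path vpro G G') (r : Defs.path vpro H H') (f : varr F G) (f' : varr F' G')
    (g : varr G H) (g' : varr G' H') (c : cells2 s t r f f' g g')
    (u : pt F) (v : pt F') (x : chain s u v) :
  @chain_heq _ _ _ H H' r (po u) (po v) _ _
    (cmap_fun (cells_map (outer_cells c)) (cmap_fun (cells_map (inner_cells c)) x)) _ _
    (cmap_fun (cells_map (comp_cells models_vdc c)) x).
Proof.
elim: c u v x => {F F' G G' H H' s t r f f' g g'} [F G H f g|F F1 F' G G1 G' H H1 H' s s' t t' N r f f1 f' g g1 g' c n c' IH] u v x.
  apply: chain_heq_nil; apply: etrans (esym (tot_tpe_etr x (map_etr_comp g f))).
  by rewrite /= (tpe_comp (map_trans g) (map_trans f)).
have h := cells_map_app c (inner_cells c') x.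
have h2 := cmap_eq (cells_map (outer_cells (c2cons c n c'))) h.
have h3 := cut_map_eq (of_mm n) (cells_map (outer_cells c'))
  (csplit_join (cmap_fun (cells_map c) (c1 (csplit x))) (cmap_fun (cells_map (inner_cells c')) (c2 (csplit x)))).
apply: chain_heq_trans (ChainHeq (chain_eq_trans h2 h3)) _.
apply: chain_heq_link (IH _ _ _).
- apply: tot_uid.
  exact (congr1 (fun A : etr o _ _ => tob (epre A) (po u) (pe u)) (esym (map_etr_comp g f))).
- exact: esym (models_compE c n (c1 (csplit x))).
Qed.

Lemma models_assoc (F F' G G' H H' K K' : vob V) (s : Defs.path vpro F F')
    (t : Defs.path vpro G G') (r : Defs.path vpro H H') (P : vpro K K')
    (f : varr F G) (f' : varr F' G') (g : varr G H) (g' : varr G' H')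
    (h : varr H K) (h' : varr H' K') (c : cells2 s t r f f' g g') (p : vcell r P h h') :
  vceq (vcompc models_vdc (inner_cells c) (vcompc models_vdc (outer_cells c) p))
       (vcompc models_vdc (comp_cells models_vdc c) p).
Proof.
apply: mm_vceq; [exact: esym (model_map_compA _ _ _)..|].
move=> u v x; apply: etrans (models_compE _ _ x) _.
apply: etrans (models_compE (outer_cells c) p (cmap_fun (cells_map (inner_cells c)) x)) _.
apply: etrans _ (esym (models_compE _ _ x)).
exact: cmod_heq (cells_map_comp c x).
Qed.

Lemma models_is_vdc : is_vdc models_vdc.
Proof. by split; [exact: models_idl | exact: models_idr | exact: models_assoc]. Qed.

(** ** Units *)

Definition models_unit G : multimodulation (pnil G) (hom G) (model_map_one k G) (model_map_one k G) :=
  mm_of (map_etr_one k G) (map_etr_one k G) (unit_cmod o G).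

Lemma cells_map_insert F G H (s1 : mpath F G) (s2 : mpath G H) (u : pt F) (v : pt H)
    (x : chain (papp s1 s2) u v) :
  @chain_heq _ _ _ F H (papp s1 (pcons (hom G) s2)) (po u) (po v) _ _
    (cmap_fun (cells_map (@insert_nullary V models_vdc F G H s1 s2 (hom G) (models_unit G))) x) _ _
    (cmap_fun (insert_unit o s1 s2) x).
Proof.
elim: s1 s2 u v x => [L|L L' {}G M s1 IH] s2 u v x.
  apply: cut_map_heq; first exact: mm_ofE.
  apply: chain_heq_trans (cells_map_id _) _; split; apply: chain_eq_sym; apply: cmap_idE.
rewrite [cells_map _]/= cmap_castE; move: (esym _) => e; rewrite (proof_irrelevance _ e erefl).
apply: cut_map_heq; first exact: mm_ofE.
exact: IH.
Qed.

(** A function on chains is extended by collapsing the additional entry.  This is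
    inverse to insertion since the two operations on chains are inverse up to
    slides. *)
Lemma models_have_units : has_units models_vdc.
Proof.
move=> G; exists (hom G), (models_unit G) => F H K L s1 s2 N f g.
have e (F1 F2 : model) (a : model_map k F1 F2) :
    map_etr a = etr_comp (map_etr (model_map_comp a (model_map_one k F1))) (etr_one o F1).
  by rewrite etr_comp_one model_map_comp_one.
pose ext (m : vcell (papp s1 s2) N (model_map_comp f (model_map_one k F))
    (model_map_comp g (model_map_one k H))) : vcell (papp s1 (pcons (hom G) s2)) N f g :=
  mm_of (e _ _ f) (e _ _ g) (cmod_comp (of_mm m) (collapse o s1 s2)).
have extE m (u : pt F) (v : pt H) (x : chain (papp s1 (pcons (hom G) s2)) u v) :
    tot (cmod_fun (of_mm (ext m)) x) = tot (cmod_fun (of_mm m) (cmap_fun (collapse o s1 s2) x)).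
  exact: mm_ofE.
exists ext => m.
- apply: mm_eq => u v x; apply: el_eq; apply: etrans (extE _ _ _ x) _.
  apply: etrans (models_compE _ m (cmap_fun (collapse o s1 s2) x)) _.
  apply: etrans (cmod_heq (of_mm m) (cells_map_insert (cmap_fun (collapse o s1 s2) x))) _.
  exact (congr1 (fun e => tot e) (cmod_eq (of_mm m) (insert_collapse o x))).
- apply: mm_eq => u v x; apply: el_eq; apply: etrans (models_compE _ _ x) _.
  pose c := @insert_nullary V models_vdc F G H s1 s2 (hom G) (models_unit G).
  apply: etrans (extE m _ _ (cmap_fun (cells_map c) x)) _.
  have h := cmap_heq (collapse o s1 s2) (cells_map_insert x).
  apply: etrans (cmod_heq (of_mm m) h) _.
  exact (congr1 (fun e => tot e) (cmod_eq (of_mm m) (collapse_insert o x))).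
Qed.

(** ** The composite of components *)

Lemma is_eqcell_tapp_coh F G H (s1 : mpath F G) (s2 : mpath G H) x y z
    (t1 : tpath s1 x y) (t2 : tpath s2 y z) : is_eqcell (tapp_coh t1 t2).
Proof.
elim: t1 s2 t2 => {F G s1 x y} [F x|F G K M s x y z' m t1 IH] s2 t2.
  exact: is_eqcell_lunV.
apply: is_eqcell_gcomp; first exact: is_eqcell_assocV.
exact: is_eqcell_hcomp (is_eqcell_idc m) (IH _ _).
Qed.

Lemma is_eqcell_bcoh (F F' G G' : vob V) (s : Defs.path vpro F F') (t : Defs.path vpro G G')
    (a : varr F G) (a' : varr F' G') (c : cells s t a a') x y (q : blocks c x y) :
  is_eqcell (bcoh q).
Proof.
elim: q => {F F' G G' s t a a' c x y} [F G a x|F F' F'' G G' G'' s1 s2 s e N t a a' a'' mu c x y z t1 q IH].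
  exact: is_eqcell_idc.
case: s / e; apply: is_eqcell_gcomp; last exact: is_eqcell_tapp_coh.
exact: is_eqcell_hcomp (is_eqcell_idc _) IH.
Qed.

(** The coherence cell that separates two blocks only rebrackets pairs, as does
    cutting the chain. *)
Lemma csplit_tapp F G H (s1 : mpath F G) (s2 : mpath G H) x y z
    (t1 : tpath s1 x y) (t2 : tpath s2 y z) (e : apex (tsrc (tapp t1 t2)))
    (e1 : apex (tsrc t1)) (e2 : apex (tsrc t2)) (h : rgt e1 = lft e2)
    u v w (hl : lft e = u) (hr : rgt e = v) (hl1 : lft e1 = u) (hr1 : rgt e1 = w)
    (hl2 : lft e2 = w) (hr2 : rgt e2 = v) :
  ap (tapp_src t1 t2) e = pr h ->
  csplit (chain_of hl hr) = Cut (chain_of hl1 hr1) (chain_of hl2 hr2).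
Proof.
elim: t1 s2 t2 e e1 e2 h u v w hl hr hl1 hr1 hl2 hr2 => {F G s1 x y}
  [F x|F G K M s1 x y y' m t1 IH] s2 t2 e e1 e2 h u v w hl hr hl1 hr1 hl2 hr2.
  move/(congr1 sval) => [/= h1 h2]; subst e2; change (lft e = e1) in h1; subst e1.
  change (lft e = u) in hl1; change (lft e = w) in hr1.
  case: u / hl hl1 => hl1; case: w / hr1 hl2 => hl2.
  rewrite (proof_irrelevance _ hl2 erefl) (proof_irrelevance _ hr2 hr).
  congr Cut; exact: el_eq.
case: e hl hr => -[a e] i hl hr; change (rgt a = lft e) in i.
change (lft a = u) in hl; change (rgt e = v) in hr.
move/(congr1 sval) => [/= h1 h2]; subst e1 e2.
set p := tapp_src t1 t2 e in hl1 hr1 hl2 hr2 *.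
have hp : lft (sval p).1 = lft e by exact: (ap_legl (tapp_src t1 t2) e).
have E : ap (tapp_src t1 t2) e = pr (proj2_sig p) by rewrite -[LHS]/p; case: (p) => -[].
have := congr1 (cut_in (uid (Pt x u)) (@El _ _ _ F G M (Pt x u) (Pt y (lft e)) m a hl i))
  (IH s2 t2 e _ _ _ _ v w erefl hr hp hr1 hl2 hr2 E).
move=> {}E; apply: etrans E _.
rewrite /cut_in [c1 _]/= [c2 _]/=; congr Cut; rewrite /=.
move: (etrans erefl _) => i'; rewrite (proof_irrelevance _ hl1 hl).
clear h hl1 hl2 hr2; change (rgt (sval p).1 = w) in hr1; by case: (lft e) / hp i => i; rewrite (proof_irrelevance _ i i').
Qed.

(** On a path that is given in blocks, the cuts are made at the ends of the
    blocks, where all interposed elements are identities. *)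
Lemma cells_map_blocks (F F' G G' : vob V) (s : Defs.path vpro F F') (t : Defs.path vpro G G')
    (a : varr F G) (a' : varr F' G') (c : cells s t a a') x y (q : blocks c x y)
    (e : apex (tsrc (bpath q))) u v (hl : lft e = u) (hr : rgt e = v)
    u' v' (hl' : lft (ap (bcell q) e) = u') (hr' : rgt (ap (bcell q) e) = v') :
  @chain_heq _ _ _ G G' t x y _ _ (cmap_fun (cells_map c) (chain_of hl hr)) _ _ (chain_of hl' hr').
Proof.
elim: q e u v u' v' hl hr hl' hr' => {F F' G G' s t a a' c x y}
  [F G a x|F F' F'' G G' G'' s1 s2 s e0 N t a a' a'' mu c x y z t1 q IH] e u v u' v' hl hr hl' hr'.
  apply: chain_heq_nil; rewrite /tot /=; congr existT.
  exact: (ap_ceq (tpro_id (map_trans a) x) e).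
case: s / e0 e hl hr hl' hr' => e hl hr hl' hr'.
pose p := tapp_src t1 (bpath q) e.
have hl1 : lft (sval p).1 = u by apply: etrans _ hl; exact: (ap_legl (tapp_src t1 (bpath q)) e).
have hr2 : rgt (sval p).2 = v by apply: etrans _ hr; exact: (ap_legr (tapp_src t1 (bpath q)) e).
have E : ap (tapp_src t1 (bpath q)) e = pr (proj2_sig p) by rewrite -[LHS]/p; case: (p) => -[].
have {}E := csplit_tapp hl hr hl1 erefl (esym (proj2_sig p)) hr2 E.
change (@chain_heq _ _ _ G G'' (pcons N t) x z _ _ (cut_map (of_mm mu) (cells_map c) (csplit (chain_of hl hr)))
  _ _ (chain_of hl' hr')); rewrite E.
apply: chain_heq_link; last exact: IH.
- by apply: tot_uid; rewrite -hl' ap_legl hl.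
- pose q1 := @Tel _ _ _ F F' s1 (Pt x u) (Pt y (rgt (sval p).1)) t1 (sval p).1 hl1 erefl.
  have E1 := congr1 (fun e => tot e) (of_mm_chain_of_tel mu q1).
  apply: etrans E1 _; rewrite /tot; congr existT.
Qed.

Lemma models_standard_composition : standard_composition models_vdc.
Proof.
split=> [F G H b a|F F' G G' H H' s t P a a' b b' c nu x y q].
  exact: is_map_comp_model_map.
have E F1 F2 F3 (f : model_map k F2 F3) (g : model_map k F1 F2) z :
    larr F3 (ida z) ∘ tob (map_trans (model_map_comp f g)) z =
    tob (map_trans f) z ∘ tob (map_trans g) z.
  rewrite larr_id.
  exact (congr1 (fun A : etr o F1 F3 => tob (epre A) z) (map_etr_comp f g)).
apply: ap_ceqP => [||e]; [exact: E..|].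
apply: (@es_eq _ _ _ _ _ P).
have h0 := mcell_eqcell (ap (mm_cell (vcompc models_vdc c nu) (bpath q)) e)
  (is_eqcell_bcoh q).
apply: etrans h0 _.
have h := congr1 (fun e => tot e) (of_mm_chain_of_tel (vcompc models_vdc c nu) (tel_of e)).
rewrite /= in h.
apply: etrans (esym h) _.
apply: etrans (models_compE c nu (chain_of_tel (tel_of e))) _.
have h1 := cells_map_blocks (c := c) (q := q) (e := e) erefl erefl erefl erefl.
apply: etrans (cmod_heq (of_mm nu) h1) _.
have h2 := congr1 (fun e => tot e) (of_mm_chain_of_tel nu (tel_of (ap (bcell q) e))).
exact: h2.
Qed.

End Models.

Theorem corollary11p7 (T : fp_double_theory) (k : map_kind) :
  exists W : vdc (models T k),
    [/\ is_vdc W, has_units W & standard_composition W].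
Proof.
pose D := StrictDbl (th_double T) (th_strict T).
exists (@models_vdc D (th_products T) Span_finite_products k); split.
- exact: (@models_is_vdc D (th_products T) Span_finite_products k).
- exact: (@models_have_units D (th_products T) Span_finite_products k).
- exact: (@models_standard_composition D (th_products T) Span_finite_products k).
Qed.
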